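(* Let $H$ be a finite-dimensional non-cosemisimple Hopf algebra over $\Bbbk$ with no nontrivial skew-primitives, and let $|G(H)|=r$. Then $$\dim H \ \ge\ \min\{(2d+2)r+2\,\mathrm{lcm}(d^2,r)\ \mid\ d>1\},$$ where $d$ ranges over the integers greater than $1$.
   Context: $\Bbbk$ is an algebraically closed field of characteristic $0$. $G(H)$ is the group of group-like elements of $H$. A Hopf algebra is cosemisimple if it equals its coradical as a coalgebra. $H$ has no nontrivial skew-primitives if every $x\in H$ with $\Delta(x)=x\otimes g+h\otimes x$ for some $g,h\in G(H)$ lies in $\Bbbk G(H)$ (equivalently, $H$ has no pointed Hopf subalgebra other than group algebras). $\mathrm{lcm}$ denotes the least common multiple. *)

(* Defs.v *)
From HB Require Import structures.
From mathcomp Require Import all_boot all_order all_algebra all_field.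

Set Implicit Arguments.
Unset Strict Implicit.
Unset Printing Implicit Defensive.

Import GRing.Theory.
Local Open Scope ring_scope.

Reserved Notation "u '\ox' v" (at level 40, left associativity).

(* Tensor products of finite-dimensional vector spaces, modelled by the matrix
   of coordinates in the products of the vectors of the library's bases.
   tensor_liftP below is the universal property. *)
Section Tensor.

Variable k : fieldType.

Definition tensor (U V : vectType k) : vectType k :=
  'M[k]_(\dim {:U}, \dim {:V}).

Definition tensor_pure (U V : vectType k) (u : U) (v : V) : tensor U V :=
  \matrix_(i, j) (coord (vbasis {:U}) i u * coord (vbasis {:V}) j v).

Local Notation "u \ox v" := (tensor_pure u v) : ring_scope.

(* Meaningful only when b is bilinear. *)
Definition tensor_lift (U V W : vectType k) (b : U -> V -> W) :
    'Hom(tensor U V, W) :=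
  linfun (fun t : tensor U V => \sum_(i < \dim {:U}) \sum_(j < \dim {:V})
    (t : 'M_(_, _)) i j *: b (vbasis {:U})`_i (vbasis {:V})`_j).

Definition tensor_map (U V U' V' : vectType k) (f : 'Hom(U, U')) (g : 'Hom(V, V')) :
    'Hom(tensor U V, tensor U' V') :=
  tensor_lift (fun u v => f u \ox g v).

Definition tensor_assoc (U V W : vectType k) :
    'Hom(tensor (tensor U V) W, tensor U (tensor V W)) :=
  tensor_lift (fun uv w => tensor_lift (fun u v => u \ox (v \ox w)) uv).

Definition tensorv (U V : vectType k) (D : {vspace U}) (E : {vspace V}) :
    {vspace tensor U V} :=
  <<[seq u \ox v | u <- vbasis D, v <- vbasis E]>>%VS.

Definition tensor_mul (A : falgType k) (s t : tensor A A) : tensor A A :=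
  tensor_lift (fun a b => tensor_lift (fun c d => (a * c) \ox (b * d)) t) s.

Lemma tensor_pure_linearl (U V : vectType k) (v : V) :
  linear (fun u : U => u \ox v).
Proof.
by move=> a u u'; apply/matrixP => i j; rewrite !mxE linearP /= mulrDl mulrA.
Qed.

Lemma tensor_pure_linearr (U V : vectType k) (u : U) :
  linear (fun v : V => u \ox v).
Proof.
by move=> a v v'; apply/matrixP => i j; rewrite !mxE linearP /= mulrDr mulrCA.
Qed.

Definition linear_fun (U V : lmodType k) (f : U -> V) & linear f := f.

HB.instance Definition _ (U V : lmodType k) (f : U -> V) (fl : linear f) :=
  GRing.isLinear.Build k U V *:%R (linear_fun fl) fl.

Fact linear_pack (U V : lmodType k) (f : U -> V) :
  linear f -> {F : {linear U -> V} | f = F}.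
Proof. by move=> fl; exists (linear_fun fl). Qed.

Lemma tensor_liftE (U V W : vectType k) (b : U -> V -> W) (t : tensor U V) :
  tensor_lift b t = \sum_(i < \dim {:U}) \sum_(j < \dim {:V})
    (t : 'M_(_, _)) i j *: b (vbasis {:U})`_i (vbasis {:V})`_j.
Proof.
rewrite /tensor_lift; set f := fun t : tensor U V => _.
suff /linear_pack[F fE] : linear f by rewrite -[RHS]/(f t) fE lfunE.
move=> a s s'; rewrite /f scaler_sumr -big_split; apply: eq_bigr => i _ /=.
rewrite scaler_sumr -big_split; apply: eq_bigr => j _ /=.
by rewrite !mxE scalerDl scalerA.
Qed.

Lemma tensor_lift_pure (U V W : vectType k) (b : U -> V -> W) :
    (forall v, linear (b^~ v)) -> (forall u, linear (b u)) ->
  forall u v, tensor_lift b (u \ox v) = b u v.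
Proof.
move=> bl br u v; rewrite tensor_liftE.
have [F FE] := linear_pack (bl v).
rewrite -[RHS]/((b^~ v) u) FE [in RHS](coord_vbasis (memvf u)) linear_sum.
apply: eq_bigr => i _; rewrite linearZ /= -FE.
have [G GE] := linear_pack (br (vbasis {:U})`_i).
rewrite GE [in RHS](coord_vbasis (memvf v)) linear_sum scaler_sumr.
by apply: eq_bigr => j _; rewrite linearZ /= scalerA mxE.
Qed.

Lemma tensor_pure_span (U V : vectType k) (t : tensor U V) :
  t = \sum_(i < \dim {:U}) \sum_(j < \dim {:V})
        (t : 'M_(_, _)) i j *: ((vbasis {:U})`_i \ox (vbasis {:V})`_j).
Proof.
apply/matrixP => i j; rewrite summxE (bigD1 i) //= summxE (bigD1 j) //=.
rewrite !mxE !coord_free ?(basis_free (vbasisP _)) // !eqxx !mulr1.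
rewrite !big1 ?addr0 // => [i' ne|j' ne].
  rewrite summxE big1 // => j' _.
  by rewrite !mxE !coord_free ?(basis_free (vbasisP _)) // (negPf ne) mul0r mulr0.
by rewrite !mxE !coord_free ?(basis_free (vbasisP _)) // (negPf ne) !mulr0.
Qed.

Lemma tensor_liftP (U V W : vectType k) (b : U -> V -> W) :
    (forall v, linear (b^~ v)) -> (forall u, linear (b u)) ->
  forall f : 'Hom(tensor U V, W),
  (forall u v, f (u \ox v) = b u v) <-> f = tensor_lift b.
Proof.
move=> bl br f; split=> [fE | -> u v]; last exact: tensor_lift_pure.
apply/lfunP => t; rewrite [in LHS](tensor_pure_span t) tensor_liftE.
rewrite linear_sum; apply: eq_bigr => i _; rewrite linear_sum.
by apply: eq_bigr => j _; rewrite linearZ /= fE.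
Qed.

Lemma tensor_liftC (U V W : vectType k) (b1 b2 b : U -> V -> W) (a : k) t :
  (forall u v, b u v = a *: b1 u v + b2 u v) ->
  tensor_lift b t = a *: tensor_lift b1 t + tensor_lift b2 t.
Proof.
move=> bE; rewrite !tensor_liftE scaler_sumr -big_split; apply: eq_bigr => i _.
rewrite scaler_sumr -big_split; apply: eq_bigr => j _ /=.
by rewrite bE scalerDr !scalerA mulrC.
Qed.

Lemma tensor_map_pure (U V U' V' : vectType k)
    (f : 'Hom(U, U')) (g : 'Hom(V, V')) u v :
  tensor_map f g (u \ox v) = f u \ox g v.
Proof.
apply: tensor_lift_pure => [{}v a x y|{}u a x y].
  by rewrite linearP tensor_pure_linearl.
by rewrite linearP tensor_pure_linearr.
Qed.

Lemma tensor_assoc_pure (U V W : vectType k) (u : U) (v : V) (w : W) :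
  tensor_assoc U V W (u \ox v \ox w) = u \ox (v \ox w).
Proof.
rewrite tensor_lift_pure => [|{}w|uv a x y]; last 2 first.
- by move=> a x y; rewrite linearP.
- apply: tensor_liftC => x' y'.
  by rewrite !tensor_pure_linearr.
apply: tensor_lift_pure => [y a x x'|x a y y']; first exact: tensor_pure_linearl.
by rewrite tensor_pure_linearl tensor_pure_linearr.
Qed.

Lemma tensor_mul_pure (A : falgType k) (a b c d : A) :
  tensor_mul (a \ox b) (c \ox d) = (a * c) \ox (b * d).
Proof.
have mull e : linear (fun x : A => x * e).
  by move=> s x y; rewrite mulrDl scalerAl.
have mulr e : linear (fun x : A => e * x).
  by move=> s x y; rewrite mulrDr scalerAr.
rewrite /tensor_mul tensor_lift_pure => [|y s x x'|x s y y'].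
- apply: tensor_lift_pure => [y s x x'|x s y y'].
    by rewrite mulr tensor_pure_linearl.
  by rewrite mulr tensor_pure_linearr.
- by apply: tensor_liftC => e f; rewrite mull tensor_pure_linearl.
- by apply: tensor_liftC => e f; rewrite mull tensor_pure_linearr.
Qed.

End Tensor.

Notation "u \ox v" := (tensor_pure u v) : ring_scope.

HB.mixin Record isCoalgebra (k : fieldType) C of Vector k C := {
  comul : 'Hom(C, tensor C C);
  counit : 'Hom(C, k^o);
  comulA_subproof : forall x,
    tensor_assoc C C C (tensor_map comul \1 (comul x)) =
    tensor_map \1 comul (comul x);
  counitl_subproof : forall x,
    tensor_lift (fun y z : C => (counit y : k) *: z) (comul x) = x;
  counitr_subproof : forall x,
    tensor_lift (fun y z : C => (counit z : k) *: y) (comul x) = x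
}.

#[short(type="fdCoalgType")]
HB.structure Definition Coalgebra (k : fieldType) :=
  {C of isCoalgebra k C & Vector k C}.

Lemma comulA (k : fieldType) (C : fdCoalgType k) (x : C) :
  tensor_assoc C C C (tensor_map comul \1 (comul x)) =
  tensor_map \1 comul (comul x).
Proof. exact: comulA_subproof. Qed.

Lemma counitl (k : fieldType) (C : fdCoalgType k) (x : C) :
  tensor_lift (fun y z : C => (counit y : k) *: z) (comul x) = x.
Proof. exact: counitl_subproof. Qed.

Lemma counitr (k : fieldType) (C : fdCoalgType k) (x : C) :
  tensor_lift (fun y z : C => (counit z : k) *: y) (comul x) = x.
Proof. exact: counitr_subproof. Qed.

HB.mixin Record isBialgebra (k : fieldType) H of Falgebra k H & Coalgebra k H :=
{
  comul1_subproof : comul (1 : H) = 1 \ox 1;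
  comulM_subproof : forall x y : H,
    comul (x * y) = tensor_mul (comul x) (comul y);
  counit1_subproof : counit (1 : H) = 1;
  counitM_subproof : forall x y : H, counit (x * y) = counit x * counit y
}.

#[short(type="fdBialgType")]
HB.structure Definition Bialgebra (k : fieldType) :=
  {H of isBialgebra k H & Falgebra k H & Coalgebra k H}.

Lemma comul1 (k : fieldType) (H : fdBialgType k) :
  comul (1 : H) = 1 \ox 1.
Proof. exact: comul1_subproof. Qed.

Lemma comulM (k : fieldType) (H : fdBialgType k) (x y : H) :
  comul (x * y) = tensor_mul (comul x) (comul y).
Proof. exact: comulM_subproof. Qed.

Lemma counit1 (k : fieldType) (H : fdBialgType k) :
  counit (1 : H) = 1.
Proof. exact: counit1_subproof. Qed.

Lemma counitM (k : fieldType) (H : fdBialgType k) (x y : H) :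
  counit (x * y) = counit x * counit y.
Proof. exact: counitM_subproof. Qed.

HB.mixin Record isHopf (k : fieldType) H of Bialgebra k H := {
  antipode : 'End(H);
  antipodel_subproof : forall x : H,
    tensor_lift (fun y z => antipode y * z) (comul x) = (counit x)%:A;
  antipoder_subproof : forall x : H,
    tensor_lift (fun y z => y * antipode z) (comul x) = (counit x)%:A
}.

#[short(type="fdHopfAlgType")]
HB.structure Definition HopfAlgebra (k : fieldType) :=
  {H of isHopf k H & Bialgebra k H}.

Lemma antipodel (k : fieldType) (H : fdHopfAlgType k) (x : H) :
  tensor_lift (fun y z : H => antipode y * z) (comul x) = (counit x)%:A.
Proof. exact: antipodel_subproof. Qed.

Lemma antipoder (k : fieldType) (H : fdHopfAlgType k) (x : H) :
  tensor_lift (fun y z : H => y * antipode z) (comul x) = (counit x)%:A.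
Proof. exact: antipoder_subproof. Qed.

Section Coradical.

Variables (k : fieldType) (C : fdCoalgType k).

Definition subcoalgebra (D : {vspace C}) : bool :=
  (comul @: D <= tensorv D D)%VS.

Definition simple_subcoalgebra (D : {vspace C}) : Prop :=
  [/\ subcoalgebra D, D != 0%VS
    & forall E : {vspace C},
        subcoalgebra E -> (E <= D)%VS -> E = 0%VS \/ E = D].

Definition coradical (x : C) : Prop :=
  exists2 Ds : seq {vspace C},
    (forall D, D \in Ds -> simple_subcoalgebra D)
    & x \in (\sum_(D <- Ds) D)%VS.

Definition cosemisimple : Prop := forall x : C, coradical x.

End Coradical.

Section GroupLike.

Variables (k : fieldType) (H : fdHopfAlgType k).

Definition grouplike : pred H := [pred g | (g != 0) && (comul g == g \ox g)].

Definition grouplike_span (x : H) : Prop :=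
  exists2 gs : seq H, all grouplike gs & x \in <<gs>>%VS.

Definition no_nontrivial_skew_primitives : Prop :=
  forall g h x : H, grouplike g -> grouplike h ->
    comul x = x \ox g + h \ox x -> grouplike_span x.

End GroupLike.

Definition has_card (T : eqType) (P : pred T) (n : nat) : Prop :=
  exists s : seq T, [/\ uniq s, s =i P & size s = n].

Definition is_min (P : nat -> Prop) (m : nat) : Prop :=
  P m /\ forall n, P n -> (m <= n)%N.

Arguments cosemisimple {k} C.
Arguments no_nontrivial_skew_primitives {k} H.
Arguments grouplike {k} H.

(* Main.v *)
(** We work in the convolution algebra [A] dual to [H].  Its maximal ideals [m] are the
    annihilators of the simple subcoalgebras of [H]; by Burnside's theorem they have
    codimension [d ^ 2], where [d] is the dimension of the simple [A / m]-modules, and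
    those of codimension 1 correspond to the grouplike elements.  Orthogonal idempotents
    [e_m] lifting the units of the [A / m] give
    [dim H >= sum over m, m' of dim (e_m A e_m')].

    By Larson and Sweedler [A] is a Frobenius algebra, so a block [m] which is not simple
    projective contributes twice, through its top and its socle, to the [e_m A e_m'] with
    [m'] in any set of ideals stable under the Nakayama automorphism.  As [H] is not
    cosemisimple, Maschke's theorem shows that the trivial module is not projective; as
    there are no nontrivial skew-primitives, some simple module of dimension [d > 1]
    occurs right below the top of its projective cover.  Let [V] be the set of the [m] of
    codimension [d ^ 2] such that [e_g A e_m] is nonzero for some grouplike [g].
    Translating by grouplikes and using the Frobenius form, each of the [r] grouplikes is
    linked with [V] on both sides.  The pairs of ideals in [G(H)], in [V], and the mixed
    ones contribute [2 r], [2 d ^ 2 |V|] and [2 d r].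

    Finally [r] divides [d ^ 2 |V|], the dimension of a subcoalgebra [M] stable under left
    multiplication by the grouplikes: conjugation by the matrix coefficients of [M] shows
    [tr (g | M) tr (g | H) = tr (g | M) dim H], and [tr (g | H) = dim H] is impossible for
    [g <> 1] because these traces are sums of roots of unity; so [tr (g | M) = 0] for
    [g <> 1], and averaging over the grouplikes gives the divisibility. *)
Require Import Defs.
From HB Require Import structures.
From mathcomp Require Import all_boot all_order all_algebra all_field.
From Stdlib Require Import Classical ClassicalEpsilon.
From mathcomp Require Import cyclic zify ring.

Set Implicit Arguments.
Unset Strict Implicit.
Unset Printing Implicit Defensive.

Import GRing.Theory.
Local Open Scope ring_scope.

(** * Linear algebra *)

(** The Frobenius form is evaluation at a nonzero integral [t] of [H]. The existence of [t], the
    nondegeneracy of the form and the bijectivity of the antipode all come out of the Hopf module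
    structure of [H] over its dual. The size of [V] is out of control: it is only known that [V] is
    nonempty and that d^2 |V| is a multiple of d^2 and of r, hence at least their least common
    multiple. This is the origin of lcm(d^2, r), while 2 r + 2 d r gives (2 d + 2) r. Linkage is not
    symmetric: the Nakayama automorphism turns a nonzero e_m A e_p into a nonzero e_p A e_m', with
    m' the preimage of m, and this supplies the second d r. Dimensions add up only for exactly
    orthogonal idempotents, so all the e_m are polynomials in a single element. The ground field has
    no absolute value, so the estimate on sums of roots of unity is first turned into the
    coprimality of two rational polynomials, checked over the complex numbers, and then carried to
    characteristic 0. *)

Section LinearFunctions.

Variables (k : fieldType) (U V : lmodType k) (f : U -> V).
Hypothesis f_lin : linear f.

Lemma linear_fun0 : f 0 = 0.
Proof. by have [F ->] := linear_pack f_lin; rewrite linear0. Qed.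

Lemma linear_funB u v : f (u - v) = f u - f v.
Proof. by have [F ->] := linear_pack f_lin; rewrite linearB. Qed.

Lemma linear_funZ c u : f (c *: u) = c *: f u.
Proof. by have [F ->] := linear_pack f_lin; rewrite linearZ. Qed.

Lemma linear_fun_sum (I : finType) (u : I -> U) : f (\sum_i u i) = \sum_i f (u i).
Proof. by have [F ->] := linear_pack f_lin; rewrite linear_sum. Qed.

End LinearFunctions.

Section LinearAlgebra.

Variables (k : fieldType) (V : vectType k).
Implicit Types (U W : {vspace V}) (P : {vspace V} -> Prop).

Lemma exists_max_dim P U0 :
  P U0 -> exists2 U, P U & forall W, P W -> (\dim W <= \dim U)%N.
Proof.
move=> PU0; apply: NNPP => noU.
have big n : exists2 U, P U & (n <= \dim U)%N.
  elim: n => [|n [U PU le_n]]; first by exists U0.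
  apply: NNPP => noW; apply: noU; exists U => // W PW.
  rewrite leqNgt; apply/negP => lt_UW; apply: noW.
  by exists W => //; apply: leq_ltn_trans lt_UW.
have [U _] := big (\dim {:V}).+1.
by rewrite ltnNge dimvS ?subvf.
Qed.

(** A subspace of maximal dimension inside [Q] contains every [x] satisfying [Q], since adjoining
    the line of [x] stays inside [Q]. Annihilators, cyclic modules and eigenspaces given by a
    proposition thus become values of type [{vspace V}]. *)
Lemma vspace_comprehension (Q : V -> Prop) :
    Q 0 -> (forall a u v, Q u -> Q v -> Q (a *: u + v)) ->
  exists U : {vspace V}, forall x, x \in U <-> Q x.
Proof.
move=> Q0 Qlin; pose P U := forall x, x \in U -> Q x.
have [|U PU maxU] := @exists_max_dim P 0%VS; first by move=> x /[!memv0] /eqP->.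
exists U => x; split=> [/PU // | Qx].
have PUx : P (<[x]> + U)%VS.
  by move=> _ /memv_addP[_ /vlineP[a ->] [u Uu ->]]; apply: Qlin; last exact: PU.
have/eqP Uxx : U == (<[x]> + U)%VS by rewrite eqEdim addvSr maxU.
by rewrite Uxx; apply: subvP (addvSl _ _) _ (memv_line x).
Qed.

Lemma dim_le_functionals m (f : 'I_m -> V -> k) U :
    (forall i, scalar (f i)) ->
    (forall u, u \in U -> (forall i, f i u = 0) -> u = 0) ->
  (\dim U <= m)%N.
Proof.
move=> f_lin f_inj; pose F u : 'rV[k]_m := \row_i f i u.
have F_lin : linear F.
  by move=> a u v; apply/rowP => i; rewrite !mxE f_lin.
have [G GE] := linear_pack F_lin.
have kerU : (U :&: lker (linfun G) = 0)%VS.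
  apply/eqP; rewrite -subv0; apply/subvP => u /memv_capP[Uu].
  rewrite memv_ker lfunE /= -GE memv0 => /eqP Fu0.
  by apply/eqP/f_inj => // i; move/rowP/(_ i): Fu0; rewrite !mxE.
rewrite -(limg_ker_dim (linfun G) U) kerU dimv0 add0n.
apply: leq_trans (dimvS (subvf _)) _; rewrite dimvf dim_matrix.
by rewrite [X in (X <= _)%N](mul1n m).
Qed.

End LinearAlgebra.

(** * Orthogonals for a nondegenerate pairing *)

Section Pairing.

Variables (k : fieldType) (U V : vectType k) (beta : U -> V -> k).
Hypothesis beta_linl : forall v, scalar (beta^~ v).
Hypothesis beta_linr : forall u, scalar (beta u).
Hypothesis beta_nondeg : forall u, (forall v, beta u v = 0) -> u = 0.

Lemma pairing_suml (I : finType) (c : I -> k) (u : I -> U) v :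
  beta (\sum_i c i *: u i) v = \sum_i c i * beta (u i) v.
Proof.
have beta_lin : linear (beta^~ v : U -> k^o) := beta_linl v.
rewrite [LHS](linear_fun_sum beta_lin); apply: eq_bigr => i _.
exact: (linear_funZ beta_lin).
Qed.

Lemma pairing_sumr (I : finType) (c : I -> k) u (v : I -> V) :
  beta u (\sum_i c i *: v i) = \sum_i c i * beta u (v i).
Proof.
have beta_lin : linear (beta u : V -> k^o) := beta_linr u.
rewrite [LHS](linear_fun_sum beta_lin); apply: eq_bigr => i _.
exact: (linear_funZ beta_lin).
Qed.

Lemma beta0r u : beta u 0 = 0.
Proof. by have := beta_linr u (-1) 0 0; rewrite scaler0 addr0 mulN1r addNr. Qed.

Lemma perp_exists (W : {vspace U}) :
  exists W' : {vspace V}, forall v, v \in W' <-> {in W, forall u, beta u v = 0}.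
Proof.
apply: vspace_comprehension => [u _ | a v v' v0 v'0 u Wu]; first exact: beta0r.
by rewrite beta_linr v0 // v'0 // mulr0 addr0.
Qed.

(** Two inequalities: a basis of a complement of [W'] separates the points of [W], and a basis of
    [W] separates the points of that complement. *)
Lemma dim_perp (W : {vspace U}) (W' : {vspace V}) :
  (forall v, v \in W' <-> {in W, forall u, beta u v = 0}) ->
  (\dim W + \dim W')%N = \dim {:V}.
Proof.
move=> W'E; have dimC : \dim W'^C = (\dim {:V} - \dim W')%N by exact: dimv_compl.
have leV : (\dim W' <= \dim {:V})%N by rewrite dimvS ?subvf.
suff eqC : \dim W = \dim W'^C by rewrite eqC dimC subnK.
apply/eqP; rewrite eqn_leq; apply/andP; split.
  apply: (@dim_le_functionals _ _ _ (fun i u => beta u (vbasis W'^C)`_i)) => //.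
  move=> u Wu u0; apply: beta_nondeg => v.
  have /memv_addP[v1 W'v1 [v2 Cv2 ->]] : v \in (W' + W'^C)%VS.
    by rewrite addv_complf memvf.
  rewrite -[v1]scale1r beta_linr (proj1 (W'E _) W'v1) // mulr0 add0r.
  rewrite (coord_vbasis Cv2) pairing_sumr big1 // => i _.
  by rewrite u0 mulr0.
apply: (@dim_le_functionals _ _ _ (fun i => beta (vbasis W)`_i)) => //.
move=> v Cv v0; apply/eqP; rewrite -memv0 -(capv_compl W') memv_cap Cv andbT.
apply/W'E => u Wu; rewrite (coord_vbasis Wu) pairing_suml big1 // => i _.
by rewrite v0 mulr0.
Qed.

End Pairing.

Lemma pairing_nondegr (k : fieldType) (U V : vectType k) (beta : U -> V -> k) :
    (forall v, scalar (beta^~ v)) -> (forall u, scalar (beta u)) ->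
    (forall u, (forall v, beta u v = 0) -> u = 0) ->
    \dim {:U} = \dim {:V} ->
  forall v, (forall u, beta u v = 0) -> v = 0.
Proof.
move=> bl br nd dimUV v v0; have [W WE] := perp_exists br fullv.
have := dim_perp bl br nd WE; rewrite dimUV -[RHS]addn0 => /addnI/eqP.
rewrite dimv_eq0 => /eqP W0; apply/eqP; rewrite -memv0 -W0.
by apply/WE => u _; apply: v0.
Qed.

(** The second orthogonal contains [W], and [dim_perp] used twice gives it the same dimension. *)
Lemma double_perp (k : fieldType) (U V : vectType k) (beta : U -> V -> k)
    (W : {vspace U}) (W' : {vspace V}) :
    (forall v, scalar (beta^~ v)) -> (forall u, scalar (beta u)) ->
    (forall u, (forall v, beta u v = 0) -> u = 0) ->
    \dim {:U} = \dim {:V} ->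
    (forall v, v \in W' <-> {in W, forall u, beta u v = 0}) ->
  forall u, u \in W <-> {in W', forall v, beta u v = 0}.
Proof.
move=> bl br nd dimUV W'E u.
have [W'' W''E] := @perp_exists _ _ _ (fun v u => beta u v) bl W'.
have /eqP-> : W == W''.
  rewrite eqEdim; apply/andP; split.
    by apply/subvP => w Ww; apply/W''E => v /W'E; apply.
  rewrite -(leq_add2l (\dim W')) (dim_perp br bl _ W''E).
    by rewrite addnC (dim_perp bl br nd W'E) dimUV.
  exact: pairing_nondegr nd dimUV.
exact: W''E.
Qed.

(** * Simple modules over finite-dimensional algebras *)

Lemma closed_eigenvalue (k : closedFieldType) n (T : 'M[k]_n) :
  (0 < n)%N -> exists c, eigenvalue T c.
Proof.
move=> n_gt0; have /closed_rootP[c] : size (char_poly T) != 1%N.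
  by rewrite size_char_poly eqSS -lt0n.
by rewrite -eigenvalue_root_char; exists c.
Qed.

Section Burnside.

Variables (k : closedFieldType) (d : nat) (E : {vspace 'M[k]_d}).
Hypothesis E1 : 1%:M \in E.
Hypothesis EM : forall X Y, X \in E -> Y \in E -> X *m Y \in E.
Hypothesis E_irr : forall W : {vspace 'rV[k]_d},
  (forall w X, w \in W -> X \in E -> w *m X \in W) -> W = 0%VS \/ W = fullv.

(** Jacobson density for one extra vector, by induction on [s]. If all elements of [E] killing
    [w :: s] killed [v], then for [X] killing [s] the vector [v *m X] would be a function of
    [w *m X]; this function commutes with [E], hence is a scalar by Schur. *)
Lemma irreducible_density (s : seq 'rV[k]_d) v :
    free s -> v \notin <<s>>%VS ->
  exists2 X, X \in E & (forall u, u \in s -> u *m X = 0) /\ v *m X != 0.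
Proof.
elim: s v => [|w s IHs] v.
  rewrite span_nil memv0 => _ v_neq0.
  by exists 1%:M => //; split=> [u /[!in_nil]//|]; rewrite mulmx1.
rewrite free_cons => /andP[w_s free_s] v_ws; apply: NNPP => noX.
have [I0 I0E] : exists I0 : {vspace 'M[k]_d}, forall X,
    X \in I0 <-> X \in E /\ forall u, u \in s -> u *m X = 0.
  apply: vspace_comprehension => [|a X Y [EX X0] [EY Y0]].
    by split=> [|u _]; rewrite ?mem0v ?mulmx0.
  split=> [|u su]; first by rewrite memvD ?memvZ.
  by rewrite mulmxDr -scalemxAr X0 // Y0 // scaler0 addr0.
have I0M X Y : X \in I0 -> Y \in E -> X *m Y \in I0.
  case/I0E=> EX X0 EY; apply/I0E; split=> [|u su]; first exact: EM.
  by rewrite mulmxA X0 // mul0mx.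
have [W1 W1E] : exists W1 : {vspace 'rV[k]_d}, forall y,
    y \in W1 <-> exists2 X, X \in I0 & y = w *m X.
  apply: vspace_comprehension => [|a y z [X I0X ->] [Y I0Y ->]].
    by exists 0; rewrite ?mem0v ?mulmx0.
  by exists (a *: X + Y); rewrite ?memvD ?memvZ // mulmxDr -scalemxAr.
have [X0 EX0 [sX0 wX0]] := IHs w free_s w_s.
have W1f : W1 = fullv.
  case: (E_irr (W := W1)) => // [y Y /W1E[X I0X ->] EY | W10].
    by apply/W1E; exists (X *m Y); rewrite ?mulmxA //; apply: I0M.
  case/negP: wX0; rewrite -memv0 -W10; apply/W1E; exists X0 => //.
  exact/I0E.
have /fin_all_exists2[X I0X wX] (i : 'I_d) :
    exists2 X, X \in I0 & delta_mx 0 i = w *m X.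
  by apply/W1E; rewrite W1f memvf.
(* [T] is meant to send [w *m X] to [v *m X] for [X] in [I0]; this determines it because [w *m I0]
   is the whole row space. *)
pose T := \matrix_i (v *m X i).
have TE Y : Y \in I0 -> v *m Y = w *m Y *m T.
  move=> I0Y; set y := w *m Y.
  have wZ : w *m (Y - \sum_i y 0 i *: X i) = 0.
    rewrite mulmxBr mulmx_sumr [X in _ - X](_ : _ = y) ?subrr //.
    rewrite [RHS]row_sum_delta; apply: eq_bigr => i _.
    by rewrite -scalemxAr -wX.
  have I0Z : Y - \sum_i y 0 i *: X i \in I0.
    by rewrite memvB // memv_suml // => i _; rewrite memvZ.
  have vZ : v *m (Y - \sum_i y 0 i *: X i) = 0.
    apply: NNPP => /eqP vZ; apply: noX; have [EZ sZ] := proj1 (I0E _) I0Z.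
    by eexists; [exact: EZ|split=> // u /predU1P[-> // | /sZ]].
  move/eqP: vZ; rewrite mulmxBr subr_eq0 => /eqP->.
  rewrite mulmx_sumr [in RHS]mulmx_sum_row; apply: eq_bigr => i _.
  by rewrite -scalemxAr rowK.
have Tcomm Y : Y \in E -> T *m Y = Y *m T.
  move=> EY; apply/row_matrixP => i; rewrite !row_mul rowK -mulmxA.
  by rewrite TE ?I0M // mulmxA -wX -rowE.
have d_gt0 : (0 < d)%N.
  by have /rV0Pn[j _] := wX0; apply: leq_ltn_trans (ltn_ord j).
have [c /eigenvalueP[u uT u_neq0]] := closed_eigenvalue T d_gt0.
have [K KE] : exists K : {vspace 'rV[k]_d}, forall y, y \in K <-> y *m T = c *: y.
  apply: vspace_comprehension => [|a y z yT zT].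
    by rewrite mul0mx scaler0.
  by rewrite mulmxDl -scalemxAl yT zT scalerDr !scalerA mulrC.
have Kf : K = fullv.
  case: (E_irr (W := K)) => // [y Y /KE yT EY | K0].
    by apply/KE; rewrite -mulmxA -Tcomm // mulmxA yT scalemxAl.
  by case/negP: u_neq0; rewrite -memv0 -K0; apply/KE.
(* With [T] the scalar [c], all of [I0] kills [v - c *: w], so the induction hypothesis forces this
   vector into the span of [s]. *)
have vw : v - c *: w \in <<s>>%VS.
  apply: contraT => /(IHs _ free_s)[Y EY [sY /eqP[]]].
  have I0Y : Y \in I0 by apply/I0E.
  rewrite mulmxBl TE // -scalemxAl (proj1 (KE _)) ?subrr //.
  by rewrite Kf memvf.
case/negP: v_ws; rewrite -(subrK (c *: w) v) span_cons addrC memv_add //.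
by rewrite memvZ ?memv_line.
Qed.

Lemma free_delta_row : free [tuple delta_mx 0 j : 'rV[k]_d | j < d].
Proof.
apply/freeP => c c0 i; move/rowP/(_ i): c0; rewrite mxE summxE (bigD1 i) //=.
rewrite nth_mktuple !mxE !eqxx mulr1 big1 ?addr0 // => j ne_ji.
by rewrite nth_mktuple !mxE eqxx eq_sym (negPf ne_ji) mulr0.
Qed.

(** Density applied to the standard basis with its [i]-th vector taken out. *)
Lemma irreducible_row_unit (i : 'I_d) :
  exists2 X, X \in E & row i X != 0 /\ forall j, j != i -> row j X = 0.
Proof.
have := free_delta_row; set b := tval _ => free_b.
have bE j : delta_mx 0 j \in b by apply/mapP; exists j; rewrite ?mem_enum.
have perm_b := perm_to_rem (bE i).
have := free_b; rewrite (perm_free perm_b) free_cons => /andP[ni free_r].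
have [X EX [rX iX]] := irreducible_density free_r ni.
exists X => //; split=> [|j ne_ji]; first by rewrite rowE.
rewrite rowE rX // mem_rem_uniq ?free_uniq // inE bE andbT.
apply/eqP => /rowP/(_ j)/eqP.
by rewrite !mxE !eqxx (negPf ne_ji) oner_eq0.
Qed.

(** By irreducibility, multiplying a matrix supported on row [i] by elements of [E] turns that row
    into any vector; every matrix is a sum of such one-row matrices. *)
Lemma burnside Y : Y \in E.
Proof.
have row_in (i : 'I_d) (y : 'rV[k]_d) : \matrix_j (if j == i then y else 0) \in E.
  have [X EX [iX rX]] := irreducible_row_unit i; set u := row i X in iX.
  have [W WE] : exists W : {vspace 'rV[k]_d}, forall y,
      y \in W <-> exists2 Z, Z \in E & y = u *m Z.
    apply: vspace_comprehension => [|a y1 y2 [Z EZ ->] [Z' EZ' ->]].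
      by exists 0; rewrite ?mem0v ?mulmx0.
    by exists (a *: Z + Z'); rewrite ?memvD ?memvZ // mulmxDr -scalemxAr.
  have [Z EZ yZ] : exists2 Z, Z \in E & y = u *m Z.
    apply/WE; case: (E_irr (W := W)) => [w Z /WE[Z' EZ' ->] EZ | W0 | ->].
    - by apply/WE; exists (Z' *m Z); [exact: EM | rewrite mulmxA].
    - by case/negP: iX; rewrite -memv0 -W0; apply/WE; exists 1%:M; rewrite ?mulmx1.
    by rewrite memvf.
  suff -> : \matrix_j (if j == i then y else 0) = X *m Z by exact: EM.
  apply/row_matrixP => j; rewrite rowK row_mul; case: eqP => [-> // | /eqP/rX->].
  by rewrite mul0mx.
have -> : Y = \sum_i \matrix_j (if j == i then row i Y else 0).
  apply/row_matrixP => j; rewrite linear_sum (bigD1 j) //= rowK eqxx.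
  by rewrite big1 ?addr0 // => i ne_ij; rewrite rowK eq_sym (negPf ne_ij).
by apply: memv_suml => i _; apply: row_in.
Qed.

End Burnside.

Section Ideals.

Variables (k : fieldType) (A : falgType k).
Implicit Types (I K : {vspace A}).

Definition ideal I := forall a x b, x \in I -> a * x * b \in I.

Definition maximal_ideal I :=
  [/\ ideal I, 1 \notin I
    & forall K, ideal K -> (I <= K)%VS -> 1 \notin K -> K = I].

Lemma ideal_mull I a x : ideal I -> x \in I -> a * x \in I.
Proof. by move=> idI Ix; rewrite -[a * x]mulr1 idI. Qed.

Lemma ideal_mulr I x b : ideal I -> x \in I -> x * b \in I.
Proof. by move=> idI Ix; rewrite -[x]mul1r idI. Qed.

End Ideals.

(* Left and right modules are treated at once: [act] may be multiplicative or
   antimultiplicative. *)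
Definition is_action (k : fieldType) (A : falgType k) (M : vectType k)
    (act : A -> M -> M) :=
  [/\ forall x, linear (act^~ x), forall a, linear (act a),
      forall x, act 1 x = x
    & (forall a b x, act (a * b) x = act a (act b x)) \/
      (forall a b x, act (a * b) x = act b (act a x))].

Definition stable (k : fieldType) (A : falgType k) (M : vectType k)
    (act : A -> M -> M) (N : {vspace M}) :=
  forall a x, x \in N -> act a x \in N.

Lemma left_action (k : fieldType) (A : falgType k) :
  is_action (fun a x : A => a * x).
Proof.
split=> [x a b c|a b x y|x|]; first by rewrite mulrDl scalerAl.
- by rewrite mulrDr scalerAr.
- by rewrite mul1r.
by left=> a b x; rewrite mulrA.
Qed.

Lemma right_action (k : fieldType) (A : falgType k) :
  is_action (fun a x : A => x * a).
Proof.
split=> [x a b c|a b x y|x|]; first by rewrite mulrDr scalerAr.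
- by rewrite mulrDl scalerAl.
- by rewrite mulr1.
by right=> a b x; rewrite mulrA.
Qed.

(** Coordinates along a complement of [N'] in [N] stand for the quotient of [N] by [N']; only the
    values of [pi] on [N] are meaningful. *)
Lemma quotient_coordinates (k : fieldType) (M : vectType k) (N' N : {vspace M}) :
    (N' <= N)%VS ->
  exists pi : {linear M -> 'rV[k]_(\dim (N :\: N'))},
    [/\ forall x, x \in N -> (pi x == 0) = (x \in N')
      & forall y, exists2 x, x \in N & pi x = y].
Proof.
move=> sN'N; set U := (N :\: N')%VS.
have UN' : (U :&: N' = 0)%VS by apply: capv_diff.
have UDN' : (U + N' = N)%VS by rewrite -[RHS](addv_diff_cap N N') (capv_idPr sN'N).
pose f x := \row_i coord (vbasis U) i (daddv_pi U N' x).
have f_lin : linear f by move=> a x y; apply/rowP => i; rewrite !mxE !linearP.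
have [pi piE] := linear_pack f_lin; exists pi; rewrite -piE; split=> [x Nx | y].
  have xE : daddv_pi U N' x + daddv_pi N' U x = x by rewrite daddv_pi_add ?UDN'.
  apply/eqP/idP => [fx0 | N'x]; last first.
    suff x0 : daddv_pi U N' x = 0 by apply/rowP => i; rewrite !mxE x0 linear0.
    apply/eqP; rewrite -memv0 -UN' memv_cap memv_pi.
    by rewrite (canRL (addrK _) xE) memvB ?memv_pi.
  suff: daddv_pi U N' x + daddv_pi N' U x \in N' by rewrite xE.
  rewrite (coord_vbasis (memv_pi U N' x)) big1 ?add0r ?memv_pi // => i _.
  by move/rowP/(_ i): fx0; rewrite !mxE => ->; rewrite scale0r.
have Uu : \sum_i y 0 i *: (vbasis U)`_i \in U.
  by apply: memv_suml => i _; rewrite memvZ // vbasis_mem ?mem_nth ?size_tuple.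
exists (\sum_i y 0 i *: (vbasis U)`_i).
  by rewrite -UDN' (subvP (addvSl _ _)).
apply/rowP => i; rewrite !mxE daddv_pi_id // coord_sum_free //.
exact: basis_free (vbasisP _).
Qed.

Lemma mul_delta_mxlr (R : nzRingType) d (i p q j : 'I_d) (X : 'M[R]_d) :
  delta_mx i p *m X *m delta_mx q j = X p q *: delta_mx i j.
Proof.
apply/matrixP => a b; rewrite -mulmxA !mxE (bigD1 p) //= !mxE (bigD1 q) //=.
rewrite !mxE !eqxx andbT big1 => [|r ne_rq]; last by rewrite !mxE (negPf ne_rq) mulr0.
rewrite big1 => [|r ne_rp]; last by rewrite !mxE (negPf ne_rp) andbF mul0r.
by case: (a == i); case: (b == j); rewrite ?(mulr1, mul1r, mulr0, mul0r, addr0).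
Qed.


Section SimpleSection.

Variables (k : closedFieldType) (A : falgType k) (M : vectType k).
Variable act : A -> M -> M.
Hypothesis actP : is_action act.

(** The action on the quotient is a map [rho] to square matrices of size [d]. Burnside makes it
    onto, so its kernel has codimension [d ^ 2], and the kernel is maximal because a matrix algebra
    is simple. *)
Lemma annihilator_of_simple (N' N : {vspace M}) d (pi : {linear M -> 'rV[k]_d}) :
    stable act N' -> stable act N -> (N' <= N)%VS -> N' != N ->
    (forall W, stable act W -> (N' <= W)%VS -> (W <= N)%VS -> W = N' \/ W = N) ->
    (forall x, x \in N -> (pi x == 0) = (x \in N')) ->
    (forall y, exists2 x, x \in N & pi x = y) ->
  exists2 I, maximal_ideal I & [/\ \dim {:A} = (\dim I + d ^ 2)%N,
      (0 < d)%N
    & forall a, a \in I <-> {in N, forall x, act a x \in N'}].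
Proof.
move=> stN' stN sN'N neN'N simpleN pi0 pi_onto.
have nsNN' : ~~ (N <= N')%VS by rewrite eqEsubv sN'N in neN'N.
have [act_linl act_linr act1 actM] := actP.
have /fin_all_exists2[u Nu piu] (i : 'I_d) := pi_onto (delta_mx 0 i).
pose f a := \matrix_i pi (act a (u i)).
have f_lin : linear f.
  by move=> a x y; apply/row_matrixP => i; rewrite linearP /= !rowK act_linl linearP.
have [rho rhoE] := linear_pack f_lin.
have rho_row a i : row i (rho a) = pi (act a (u i)) by rewrite -rhoE rowK.
have piM x a : x \in N -> pi (act a x) = pi x *m rho a.
  move=> Nx; pose z := x - \sum_i pi x 0 i *: u i.
  have Nz : z \in N by rewrite memvB // memv_suml // => i _; rewrite memvZ.
  have piz : pi z == 0.
    rewrite linearB linear_sum subr_eq0 {1}[pi x]row_sum_delta; apply/eqP.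
    by apply: eq_bigr => i _; rewrite linearZ /= piu.
  have : pi (act a z) == 0 by rewrite pi0 ?stN // stN' // -pi0.
  have -> : act a z = act a x - \sum_i pi x 0 i *: act a (u i).
    rewrite (linear_funB (act_linr a)) (linear_fun_sum (act_linr a)); congr (_ - _).
    by apply: eq_bigr => i _; rewrite (linear_funZ (act_linr a)).
  rewrite linearB linear_sum subr_eq0 => /eqP->.
  by rewrite mulmx_sum_row; apply: eq_bigr => i _; rewrite linearZ /= rho_row.
have rho1 : rho 1 = 1%:M.
  by apply/row_matrixP => i; rewrite rho_row act1 piu rowE mulmx1.
(* Matrices act on rows from the right, so a left action makes [rho] reverse products. Two-sided
   ideals do not see the difference. *)
have rhoM : (forall a b, rho (a * b) = rho b *m rho a) \/
            (forall a b, rho (a * b) = rho a *m rho b).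
  case: actM => actM; [left | right] => a b; apply/row_matrixP => i.
    by rewrite row_mul !rho_row actM piM ?stN.
  by rewrite row_mul !rho_row actM piM ?stN.
pose E := limg (linfun rho).
have EE a : rho a \in E by rewrite -[rho a]lfunE memv_img ?memvf.
have rho_onto X : exists a, rho a = X.
  suff /memv_imgP[a _ ->] : X \in E by exists a; rewrite lfunE.
  apply: burnside => [|X1 X2|W stW].
  - by rewrite -rho1.
  - move=> /memv_imgP[a _ ->] /memv_imgP[b _ ->]; rewrite !lfunE /=.
    by case: rhoM => <-.
  have [K KE] : exists K : {vspace M}, forall x, x \in K <-> x \in N /\ pi x \in W.
    apply: vspace_comprehension => [|a x y [Nx Wx] [Ny Wy]].
      by rewrite linear0 !mem0v.
    by rewrite linearP !memvD ?memvZ.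
  have [|||KN'|KN] := simpleN K.
  - move=> a x /KE[Nx Wx]; apply/KE; split; first exact: stN.
    by rewrite piM // stW.
  - apply/subvP => x N'x; have Nx := subvP sN'N x N'x; apply/KE; split=> //.
    by move: N'x; rewrite -pi0 // => /eqP->; rewrite mem0v.
  - by apply/subvP => x /KE[].
  - left; apply/eqP; rewrite -subv0; apply/subvP => y Wy.
    have [x Nx xy] := pi_onto y; rewrite memv0 -xy pi0 // -KN'.
    by apply/KE; rewrite xy.
  right; apply/eqP; rewrite eqEsubv subvf; apply/subvP => y _.
  by have [x + <-] := pi_onto y; rewrite -KN => /KE[].
pose I := lker (linfun rho).
have IE a : (a \in I) = (rho a == 0) by rewrite memv_ker lfunE.
have IP a : a \in I <-> {in N, forall x, act a x \in N'}.
  rewrite IE; split=> [/eqP a0 x Nx | aN]; first by rewrite -pi0 ?stN // piM // a0 mulmx0.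
  apply/eqP/row_matrixP => i; rewrite rho_row row0; apply/eqP.
  by rewrite pi0 ?stN // aN.
have rhoMM a c b : exists x y, rho (x * c * y) = rho a *m rho c *m rho b.
  by case: rhoM => rhoM; [exists b, a | exists a, b]; rewrite !rhoM ?mulmxA.
have d_gt0 : (0 < d)%N.
  have [x Nx N'x] := subvPn nsNN'; have := N'x.
  by rewrite -pi0 // => /rV0Pn[j _]; apply: leq_ltn_trans (ltn_ord j).
exists I; split=> //.
- move=> a x b /[!IE] /eqP x0.
  by case: rhoM => rhoM; rewrite !rhoM x0 ?mulmx0 ?mul0mx ?mulmx0.
- rewrite IE rho1; apply/eqP => /matrixP/(_ (Ordinal d_gt0) (Ordinal d_gt0))/eqP.
  by rewrite !mxE eqxx oner_eq0.
(* An element [c] of [K] outside [I] has a nonzero matrix entry; matrix units move this entry to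
   each diagonal position, and the sum is 1 modulo [I]. *)
- move=> K idK sIK nK1; apply/eqP; rewrite eq_sym eqEsubv sIK; apply/subvP => c Kc.
  rewrite IE; apply: contraR nK1 => rc_neq0.
  have [p [q pq_neq0]] : exists p q, rho c p q != 0.
    apply: NNPP => c0; case/eqP: rc_neq0; apply/matrixP => p q; rewrite mxE.
    by apply: NNPP => /eqP pq; apply: c0; exists p, q.
  have dE (i : 'I_d) : exists2 z, z \in K & rho z = delta_mx i i.
    have [[a aE] [b bE]] := (rho_onto (delta_mx i p), rho_onto (delta_mx q i)).
    have [x [y xyE]] := rhoMM a c b.
    exists ((rho c p q)^-1 *: (x * c * y)); first by rewrite memvZ // idK.
    by rewrite linearZ /= xyE aE bE mul_delta_mxlr scalerA mulVf ?scale1r.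
  have /fin_all_exists2[z Kz zE] := dE.
  have Ksum : \sum_i z i \in K by apply: memv_suml => i _.
  rewrite -(subrK (\sum_i z i) 1) memvD // (subvP sIK) // IE linearB linear_sum.
  by rewrite /= rho1 subr_eq0 mx1_sum_delta; apply/eqP/eq_bigr => i _; rewrite zE.
rewrite -(limg_ker_dim (linfun rho) fullv) capfv; congr (_ + _)%N.
suff -> : (linfun rho @: fullv = fullv)%VS by rewrite dimvf dim_matrix.
apply/eqP; rewrite eqEsubv subvf; apply/subvP => X _.
by have [a <-] := rho_onto X; apply: EE.
Qed.

(** [N'] is a proper stable subspace of maximal dimension. *)
Lemma simple_section (N : {vspace M}) :
    stable act N -> N != 0%VS ->
  exists N' I d, [/\ stable act N', (N' <= N)%VS, maximal_ideal I,
      forall a, a \in I <-> {in N, forall x, act a x \in N'}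
    & [/\ \dim N = (\dim N' + d)%N, (0 < d)%N & \dim {:A} = (\dim I + d ^ 2)%N]].
Proof.
move=> stN N_neq0; pose P W := [/\ stable act W, (W <= N)%VS & W != N].
have [|N' [stN' sN'N neN'] maxN'] := @exists_max_dim _ _ P 0%VS.
  have [_ act_linr _ _] := actP.
  split; rewrite ?sub0v // 1?eq_sym // => a x /[!memv0] /eqP->.
  by rewrite (linear_fun0 (act_linr a)).
have [pi [pi0 pi_onto]] := quotient_coordinates sN'N.
have [W stW sN'W sWN|I maxI [dimI d_gt0 IE]] :=
  annihilator_of_simple stN' stN sN'N neN' _ pi0 pi_onto.
  have [-> | neW] := eqVneq W N; [by right | left].
  by apply/eqP; rewrite eq_sym eqEdim sN'W maxN'.
exists N', I, (\dim (N :\: N')); split=> //; split=> //.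
by rewrite -(dimv_cap_compl N N') (capv_idPr sN'N).
Qed.

End SimpleSection.

Lemma functional_choice (S T : Type) (P : S -> T -> Prop) :
  (forall x, exists y, P x y) -> exists f, forall x, P x (f x).
Proof.
move=> exP; exists (fun x => proj1_sig (constructive_indefinite_description _ (exP x))).
by move=> x; case: constructive_indefinite_description.
Qed.

Lemma pchar0_natr_eq0 (k : fieldType) (n : nat) : [pchar k] =i pred0 ->
  (n%:R == 0 :> k) = (n == 0%N).
Proof. by move=> /(proj1 (pcharf0P _)). Qed.

Lemma pchar0_natr_inj (k : fieldType) (i j : nat) : [pchar k] =i pred0 ->
  i%:R = j%:R :> k -> i = j.
Proof.
move=> char0; wlog le_ij : i j / (i <= j)%N.
  by move=> IH eq_ij; case/orP: (leq_total i j) => /IH; [apply | move/(_ (esym eq_ij))].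
move/eqP; rewrite eq_sym -subr_eq0 -natrB // pchar0_natr_eq0 // subn_eq0.
by move=> le_ji; apply/eqP; rewrite eqn_leq le_ij.
Qed.

(** * Maximal ideals and lifting of block idempotents *)

Section MaximalIdeals.

Variables (k : fieldType) (A : falgType k).
Implicit Types (I K m : {vspace A}) (s : seq {vspace A}).

Lemma ideal1 I : ideal I -> 1 \in I -> I = fullv.
Proof.
move=> idI I1; apply/eqP; rewrite eqEsubv subvf; apply/subvP => x _.
by rewrite -[x]mulr1 ideal_mull.
Qed.

Lemma ideal_addv I K : ideal I -> ideal K -> ideal (I + K)%VS.
Proof.
move=> idI idK a _ b /memv_addP[x Ix [y Ky ->]].
by rewrite mulrDr mulrDl memv_add ?idI ?idK.
Qed.

Lemma ideal_bigcapv s : (forall m, m \in s -> ideal m) -> ideal (\bigcap_(m <- s) m)%VS.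
Proof.
move=> id_s a x b; elim: s id_s => [|m s IHs] id_s; first by rewrite big_nil !memvf.
rewrite big_cons !memv_cap => /andP[mx sx]; rewrite id_s ?mem_head //=.
by apply: IHs => // m' sm'; apply: id_s; rewrite inE sm' orbT.
Qed.

Lemma maximal_ideal_comax m K : maximal_ideal m -> ideal K -> ~~ (K <= m)%VS ->
  exists2 x, x \in K & 1 - x \in m.
Proof.
case=> idm m1 maxm idK nsKm.
have : 1 \in (K + m)%VS.
  apply: contraR nsKm => nKm1; rewrite -(maxm _ (ideal_addv idK idm)) ?addvSl //.
  exact: addvSr.
by case/memv_addP=> x Kx [y my ->]; exists x; rewrite // [x + y]addrC addrK.
Qed.

Lemma maximal_ideal_neq m m' :
  maximal_ideal m -> maximal_ideal m' -> m != m' -> ~~ (m <= m')%VS.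
Proof.
move=> [_ _ maxm] [idm' m'1 _]; apply: contra => smm'.
by rewrite (maxm m').
Qed.

(** Chinese remainders: [x] is a product with one factor per ideal of [s], lying in that ideal and
    congruent to 1 modulo [m]. *)
Lemma exists_off_ideal m s :
    maximal_ideal m -> {in s, forall m', maximal_ideal m'} -> m \notin s ->
  exists2 x, {in s, forall m', x \in m'} & 1 - x \in m.
Proof.
move=> maxm; elim: s => [|m' s IHs] max_s; first by exists 1; rewrite ?subrr ?mem0v.
rewrite inE negb_or eq_sym => /andP[ne_m ms].
have max_s' : {in s, forall m', maximal_ideal m'}.
  by move=> m2 sm2; apply: max_s; rewrite inE sm2 orbT.
have [x sx mx] := IHs max_s' ms.
have maxm' := max_s m' (mem_head _ _); have [idm' _ _] := maxm'.
have [y m'y my] := maximal_ideal_comax maxm idm' (maximal_ideal_neq maxm' maxm ne_m).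
exists (x * y) => [m2 /predU1P[-> | sm2] |].
- exact: ideal_mull.
- have [idm2 _ _] : maximal_ideal m2 by apply: max_s'.
  exact: ideal_mulr (sx _ sm2).
have [idm _ _] := maxm.
rewrite (_ : 1 - x * y = (1 - x) + x * (1 - y)); first by rewrite memvD ?ideal_mull.
by rewrite mulrBr mulr1 addrA subrK.
Qed.

Lemma dim_bigcap_maximal s : uniq s -> {in s, forall m, maximal_ideal m} ->
  (\dim (\bigcap_(m <- s) m)%VS + \sum_(m <- s) (\dim {:A} - \dim m))%N = \dim {:A}.
Proof.
elim: s => [|m s IHs]; first by rewrite !big_nil addn0.
case/andP=> ms uniq_s max_s; rewrite !big_cons.
have max_s' : {in s, forall m, maximal_ideal m}.
  by move=> m' sm'; apply: max_s; rewrite inE sm' orbT.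
have maxm := max_s m (mem_head _ _); have [idm _ _] := maxm.
have [x sx mx] := exists_off_ideal maxm max_s' ms.
have id_s : ideal (\bigcap_(m' <- s) m')%VS.
  by apply: ideal_bigcapv => m' /max_s'[].
have capx : x \in (\bigcap_(m' <- s) m')%VS.
  elim: (s) sx => [|m' s' IH] s'x; first by rewrite big_nil memvf.
  rewrite big_cons memv_cap s'x ?mem_head //= IH // => m2 sm2.
  by rewrite s'x // inE sm2 orbT.
have sumf : (m + \bigcap_(m' <- s) m' = fullv)%VS.
  apply: ideal1; first exact: ideal_addv.
  by rewrite -(subrK x 1) memv_add.
have := dimv_sum_cap m (\bigcap_(m' <- s) m').
have := IHs uniq_s max_s'; have := dimvS (subvf m); rewrite sumf; lia.
Qed.

Lemma maximal_ideal_codim_gt0 m : maximal_ideal m -> (0 < \dim {:A} - \dim m)%N.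
Proof.
case=> _ m1 _; rewrite subn_gt0 ltn_neqAle dimvS ?subvf // andbT.
apply: contra m1 => /eqP dim_m; suff /eqP-> : m == fullv by rewrite memvf.
by rewrite eqEdim subvf dim_m leqnn.
Qed.

(** The codimensions of distinct maximal ideals are positive and add up to at most [\dim {:A}],
    which bounds the number of ideals. *)
Lemma exists_maximal_ideals : exists2 ms : seq {vspace A},
  uniq ms & forall m, m \in ms <-> maximal_ideal m.
Proof.
apply: NNPP => no_ms.
have big n : exists s, [/\ uniq s, {in s, forall m, maximal_ideal m} & size s = n].
  elim: n => [|n [s [uniq_s max_s sz_s]]]; first by exists [::].
  apply: NNPP => no_s; apply: no_ms; exists s => // m; split; first exact: max_s.
  move=> maxm; apply: contraT => ms; case: no_s; exists (m :: s).
  by split=> /=; rewrite ?ms ?sz_s // => m' /predU1P[-> | /max_s].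
have [s [uniq_s max_s sz_s]] := big (\dim {:A}).+1.
have := dim_bigcap_maximal uniq_s max_s.
suff : (size s <= \sum_(m <- s) (\dim {:A} - \dim m))%N by rewrite sz_s; lia.
elim: (s) max_s => [|m s' IH] max_s; first by rewrite big_nil.
rewrite big_cons -[size _]/(1 + size s')%N leq_add //; last first.
  by apply: IH => m' sm'; apply: max_s; rewrite inE sm' orbT.
exact/maximal_ideal_codim_gt0/max_s/mem_head.
Qed.

(* Modulo the radical, [e] is the central idempotent of the block [A / m]. *)
Definition block_idempotent m (e : A) :=
  [/\ e * e = e, 1 - e \in m & forall m', maximal_ideal m' -> m' != m -> e \in m'].

Lemma annihilating_poly (b : A) : exists2 p : {poly k}, p != 0 & horner_alg b p = 0.
Proof.
pose n := \dim {:A}; pose f (v : 'rV[k]_n.+1) := horner_alg b (rVpoly v).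
have f_lin : linear f by move=> a u v; rewrite /f !linearP /= mulr_algl.
have [F FE] := linear_pack f_lin.
have : lker (linfun F) != 0%VS.
  rewrite -dimv_eq0; have := limg_ker_dim (linfun F) fullv.
  rewrite capfv [\dim {:'rV_(n.+1)}]dimvf dim_matrix => dimE.
  have := dimvS (subvf (linfun F @: fullv)%VS); rewrite -/n; lia.
rewrite -vpick0; set v := vpick _ => v_neq0; exists (rVpoly v).
  by apply: contraNneq v_neq0 => v0; rewrite -[v]rVpolyK v0 linear0.
have : v \in lker (linfun F) by apply: memv_pick.
by rewrite memv_ker lfunE /= -FE => /eqP.
Qed.

Lemma horner_alg_mod m (b : A) c (p : {poly k}) :
  ideal m -> b - c%:A \in m -> horner_alg b p - (p.[c])%:A \in m.
Proof.
move=> idm bc; have /factor_theorem[q qE] : root (p - p.[c]%:P) c.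
  by rewrite rootE !hornerE subrr.
rewrite (_ : _ - _ = horner_alg b (p - p.[c]%:P)).
  by rewrite qE rmorphM rmorphB /= horner_algX horner_algC ideal_mull.
by rewrite rmorphB /= horner_algC.
Qed.

(* [e c] is the projection onto the generalized eigenspace of [b] for [c], a polynomial
   in [b], so that all the [e c] commute. *)
Lemma spectral_idempotents (b : A) : exists e : k -> A,
  [/\ forall c, e c * e c = e c,
      forall c c', c != c' -> e c * e c' = 0
    & forall m c c', ideal m -> 1 \notin m -> b - c%:A \in m ->
        e c' - (c == c')%:R%:A \in m].
Proof.
have [p p_neq0 pb0] := annihilating_poly b.
(* [n] is the multiplicity of [c] as a root of [p]. The Bezout term [v * q] is 1 modulo the [n]-th
   power and 0 modulo [q]; when [c] is not a root, [n] is 0 and the idempotent is 0. *)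
have step c : exists q u v n,
    [/\ p = q * ('X - c%:P) ^+ n, ~~ root q c & u * ('X - c%:P) ^+ n + v * q = 1].
  have [n [q]] := multiplicity_XsubC p c; rewrite p_neq0 /= => qc pE.
  have /Bezout_eq1_coprimepP[[u v] /= uvE] : coprimep (('X - c%:P) ^+ n) q.
    by rewrite coprimep_expl // coprimep_sym coprimep_XsubC.
  by exists q, u, v, n.
have /functional_choice[e eP] (c : k) : exists e : A, exists q u v n,
    [/\ p = q * ('X - c%:P) ^+ n, ~~ root q c & u * ('X - c%:P) ^+ n + v * q = 1]
    /\ e = horner_alg b (v * q).
  have [q [u [v [n H]]]] := step c.
  by exists (horner_alg b (v * q)), q, u, v, n.
exists e; split=> [c | c c' ne_c | m c c' idm m1 bc].
- have [q [u [v [n [[pE _ uvE] ->]]]]] := eP c.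
  apply/eqP; rewrite -rmorphM -subr_eq0 -rmorphB.
  rewrite (_ : _ - _ = - (u * v) * p); first by rewrite rmorphM /= pb0 mulr0.
  by rewrite -{3}[v * q]mulr1 -uvE pE; move: (_ ^+ n) => t; ring.
- have [q [u [v [n [[pE qc uvE] ->]]]]] := eP c.
  have [q' [u' [v' [n' [[pE' q'c' uvE'] ->]]]]] := eP c'.
  have : ('X - c'%:P) ^+ n' %| q.
    have: ('X - c'%:P) ^+ n' %| q * ('X - c%:P) ^+ n by rewrite -pE pE' dvdp_mull.
    rewrite Gauss_dvdpl // coprimep_expl // coprimep_expr //.
    by rewrite coprimep_XsubC root_XsubC.
  case/dvdpP=> q2 ->; rewrite -rmorphM.
  rewrite (_ : _ * _ = v * q2 * v' * p); first by rewrite rmorphM /= pb0 mulr0.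
  by rewrite pE'; ring.
have [q [u [v [n [[pE qc' uvE] ->]]]]] := eP c'.
(* Modulo [m] the element [b] is the scalar [c], so a polynomial annihilating [b] must vanish at
   [c]. *)
have pc : p.[c] = 0.
  have := horner_alg_mod p idm bc; rewrite pb0 sub0r memvN => pcm.
  apply: contraNeq m1 => pc; rewrite -[1]scale1r -(mulVf pc) -scalerA.
  by rewrite memvZ.
suff <- : (v * q).[c] = (c == c')%:R by apply: horner_alg_mod.
have [eq_c | ne_c] := eqVneq c c'.
  have := congr1 (fun r => r.[c]) uvE; rewrite !hornerE eq_c subrr.
  case: n pE {uvE} => [|n _]; last by rewrite expr0n mulr0 add0r.
  by rewrite expr0 mulr1 => pE; case/negP: qc'; rewrite rootE -eq_c -pE pc.
have : q.[c] * (c - c') ^+ n = 0 by rewrite -pc pE !hornerE.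
move/eqP; rewrite mulf_eq0 => /orP[/eqP qc0 | ].
  by rewrite hornerM qc0 mulr0.
by rewrite expf_eq0 subr_eq0 (negPf ne_c) andbF.
Qed.

(** One element [b], congruent to a different scalar modulo each maximal ideal, provides everything:
    its spectral idempotents tell the ideals apart and are orthogonal in [A] itself, not just modulo
    the radical. *)
Lemma exists_block_idempotents : [pchar k] =i pred0 ->
  exists e : {vspace A} -> A,
    (forall m, maximal_ideal m -> block_idempotent m (e m)) /\
    (forall m m', maximal_ideal m -> maximal_ideal m' -> m != m' -> e m * e m' = 0).
Proof.
move=> char0; have [ms uniq_ms msE] := exists_maximal_ideals.
have /functional_choice[x xP] (m : {vspace A}) : exists x, maximal_ideal m ->
    (forall m', maximal_ideal m' -> m' != m -> x \in m') /\ 1 - x \in m.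
  have [maxm | nmaxm] := classic (maximal_ideal m); last by exists 0.
  have [||x sx mx] := @exists_off_ideal m (rem m ms) maxm.
  - by move=> m' /mem_rem/msE.
  - by rewrite mem_rem_uniq // inE eqxx.
  exists x => _; split=> // m' /msE m'ms ne_m; apply: sx.
  by rewrite mem_rem_uniq // inE ne_m.
(* Positions in the list serve as scalars; they are pairwise distinct in characteristic 0. *)
pose alpha m : k := (index m ms)%:R.
pose b := \sum_(m <- ms) alpha m *: x m.
have alpha_inj m m' : maximal_ideal m -> maximal_ideal m' -> alpha m = alpha m' -> m = m'.
  move=> /msE m_ms /msE m'_ms /(pchar0_natr_inj char0).
  by move/(congr1 (nth m ms)); rewrite !nth_index.
have b_mod m : maximal_ideal m -> b - (alpha m)%:A \in m.
  move=> maxm; rewrite /b (bigD1_seq m) ?uniq_ms //=; last exact/msE.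
  have [_ mx] := xP m maxm; rewrite addrAC -scalerBr memvD //.
    by rewrite memvZ // -opprB memvN.
  rewrite big_seq_cond; apply: memv_suml => m' /andP[/msE maxm' ne_m].
  by rewrite memvZ // (proj1 (xP m' maxm')) // eq_sym.
have [e [eK e0 e_mod]] := spectral_idempotents b.
exists (fun m => e (alpha m)); split=> [m maxm | m m' maxm maxm' ne_m]; last first.
  by apply: e0; apply: contra ne_m => /eqP/alpha_inj->.
have [idm m1 _] := maxm; split=> // [|m' maxm' ne_m].
  have := e_mod m (alpha m) (alpha m) idm m1 (b_mod m maxm).
  by rewrite eqxx scale1r -memvN opprB.
have [idm' m'1 _] := maxm'.
have := e_mod m' (alpha m') (alpha m) idm' m'1 (b_mod m' maxm').
case: eqP => [/alpha_inj eq_m | _]; last by rewrite scale0r subr0.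
by rewrite eq_m ?eqxx in ne_m.
Qed.

End MaximalIdeals.

Section BlockSections.

Variables (k : closedFieldType) (A : falgType k) (M : vectType k).
Variable act : A -> M -> M.
Hypothesis actP : is_action act.
Implicit Types (m : {vspace A}) (N : {vspace M}).

(** [N1] is generated by [act e x], and [N'] is a maximal proper stable subspace of it. As [e] fixes
    the generator, it does not annihilate the simple quotient; and [m] is the only maximal ideal
    that misses [e]. *)
Lemma block_section N x m e :
    stable act N -> x \in N -> block_idempotent m e -> act e x != 0 ->
  exists N1 N' d, [/\ (N1 <= N)%VS, (N' <= N1)%VS, act e x \in N1, act e x \notin N'
    & [/\ forall a, a \in m <-> {in N1, forall y, act a y \in N'},
          \dim N1 = (\dim N' + d)%N, (0 < d)%N & \dim {:A} = (\dim m + d ^ 2)%N]].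
Proof.
move=> stN Nx [ee me e_in] z_neq0; set z := act e x in z_neq0 *.
have [act_linl act_linr act1 actM] := actP.
have [N1 N1E] : exists N1 : {vspace M}, forall y, y \in N1 <-> exists a, y = act a z.
  apply: vspace_comprehension => [|c y y' [a ->] [b ->]].
    by exists 0; rewrite (linear_fun0 (act_linl z)).
  by exists (c *: a + b); rewrite act_linl.
have stN1 : stable act N1.
  move=> b _ /N1E[a ->]; apply/N1E.
  by case: actM => actM; [exists (b * a) | exists (a * b)]; rewrite actM.
have N1z : z \in N1 by apply/N1E; exists 1; rewrite act1.
have sN1N : (N1 <= N)%VS by apply/subvP => _ /N1E[a ->]; rewrite !stN.
have N1_neq0 : N1 != 0%VS by apply: contraNneq z_neq0 => N10; rewrite -memv0 -N10.
have [N' [I [d [stN' sN'N1 maxI IE [dimN1 d_gt0 dimA]]]]] := simple_section actP stN1 N1_neq0.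
have N'z : z \notin N'.
  apply/negP => N'z; suff : (N1 <= N')%VS by move/dimvS; rewrite dimN1; lia.
  by apply/subvP => _ /N1E[a ->]; apply: stN'.
have Ie : e \notin I.
  apply: contra N'z => /IE/(_ z N1z); rewrite /z.
  by case: actM => <-; rewrite ee.
have Im : I = m by apply/eqP; apply: contraNT Ie => ne_I; apply: e_in.
by exists N1, N', d; rewrite -Im.
Qed.

(** Since [1 - e] is in [m], the idempotent [e] acts as the identity on a simple quotient of
    dimension [d], which is therefore covered by [P]. *)
Lemma block_part_dim N x m e d (P : {vspace M}) :
    stable act N -> x \in N -> block_idempotent m e -> act e x != 0 ->
    \dim {:A} = (\dim m + d ^ 2)%N -> (forall y, y \in N -> act e y \in P) ->
  (d <= \dim P)%N.
Proof.
move=> stN Nx me x_neq0 dimA NP.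
have [N1 [N' [d' [sN1N sN'N1 _ _ [mE dimN1 _ dimA']]]]] := block_section stN Nx me x_neq0.
have -> : d = d'.
  by apply/eqP; rewrite -(eqn_exp2r _ _ (isT : 0 < 2)%N) -(eqn_add2l (\dim m)) -dimA dimA'.
have [_ m1e _] := me; have [act_linl _ act1 _] := actP.
have : (N1 <= P + N')%VS.
  apply/subvP => y N1y; rewrite -[y](subrK (act e y)) addrC memv_add ?NP ?(subvP sN1N) //.
  by have := proj1 (mE _) m1e y N1y; rewrite (linear_funB (act_linl y)) act1.
by move/dimvS; rewrite dimN1; have [+ _] := dimv_add_leqif P N'; lia.
Qed.

(** All idempotents of the block act as the identity on the quotient given by [block_section]. *)
Lemma block_part_neq0 N x m e e' :
    stable act N -> x \in N -> block_idempotent m e -> act e x != 0 ->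
    block_idempotent m e' ->
  exists2 y, y \in N & act e' y != 0.
Proof.
move=> stN Nx me x_neq0 me'.
have [N1 [N' [d' [sN1N sN'N1 N1z N'z [mE _ _ _]]]]] := block_section stN Nx me x_neq0.
have [_ m1e _] := me'; have [act_linl _ act1 _] := actP.
exists (act e x); first exact: (subvP sN1N).
apply: contraNneq N'z => z0; have := proj1 (mE _) m1e _ N1z.
by rewrite (linear_funB (act_linl _)) act1 z0 subr0.
Qed.

End BlockSections.

(** * Transport of ideals and idempotents along algebra automorphisms *)

Section Automorphisms.

Variables (k : fieldType) (A : falgType k).
Implicit Types (m : {vspace A}) (tau : A -> A).

Definition algebra_automorphism tau :=
  [/\ linear tau, {morph tau : x y / x * y}, tau 1 = 1 & bijective tau].

Lemma injective_automorphism tau :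
  linear tau -> {morph tau : x y / x * y} -> tau 1 = 1 -> injective tau ->
  algebra_automorphism tau.
Proof.
move=> tau_lin tauM tau1 tau_inj; split=> //.
have [F FE] := linear_pack tau_lin.
have kerF : lker (linfun F) == 0%VS.
  by apply/lker0P => x y; rewrite !lfunE /= -FE => /tau_inj.
exists (linfun F)^-1%VF => x; rewrite FE -[F _]lfunE.
  by rewrite lker0_lfunK.
by rewrite lker0_lfunVK.
Qed.

Lemma automorphism_inv tau : algebra_automorphism tau ->
  exists sigma, [/\ algebra_automorphism sigma, cancel tau sigma & cancel sigma tau].
Proof.
move=> [tau_lin tauM tau1 [sigma sigmaK tauK]]; exists sigma; split=> //.
have tau_inj := can_inj sigmaK; split; last by exists tau.
- by move=> a x y; apply: tau_inj; rewrite tau_lin !tauK.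
- by move=> x y; apply: tau_inj; rewrite tauM !tauK.
by apply: tau_inj; rewrite tau1 tauK.
Qed.

Lemma exists_preim tau m : linear tau ->
  exists m' : {vspace A}, forall x, x \in m' <-> tau x \in m.
Proof.
move=> tau_lin; have [F FE] := linear_pack tau_lin.
by exists (linfun F @^-1: m)%VS => x; rewrite -memv_preim lfunE -FE.
Qed.

Variable tau : A -> A.
Hypothesis tauP : algebra_automorphism tau.
Variables m m' : {vspace A}.
Hypothesis mE : forall x, x \in m' <-> tau x \in m.

Lemma preim_ideal : ideal m -> ideal m'.
Proof.
have [_ tauM _ _] := tauP; move=> idm a x b /mE m_x; apply/mE.
by rewrite !tauM; apply: idm.
Qed.

Lemma dim_preim : \dim m' = \dim m.
Proof.
have [tau_lin _ _ tau_bij] := tauP; have [F FE] := linear_pack tau_lin.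
have [sigma sigmaK tauK] := tau_bij.
have <- : (linfun F @: m' = m)%VS.
  apply/vspaceP => x; apply/memv_imgP/idP => [[y m'y ->] | mx].
    by rewrite lfunE /= -FE; apply/mE.
  by exists (sigma x); [apply/mE; rewrite tauK | rewrite lfunE /= -FE tauK].
rewrite limg_dim_eq //; apply/eqP; rewrite -subv0; apply/subvP => x /memv_capP[_].
rewrite memv_ker lfunE /= -FE memv0 => /eqP tx0.
by apply/eqP/(can_inj sigmaK); rewrite tx0 (linear_fun0 tau_lin).
Qed.

Lemma preim_maximal : maximal_ideal m -> maximal_ideal m'.
Proof.
move=> [idm m1 maxm]; have [tau_lin tauM tau1 [sigma sigmaK tauK]] := tauP.
split; [exact: preim_ideal | by apply: contra m1 => /mE; rewrite tau1 |].
have [sigma' [sigP sigmaK' tauK']] := automorphism_inv tauP.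
have [sig_lin sigM sig1 _] := sigP.
move=> K idK sm'K K1; have [L LE] := exists_preim K sig_lin.
have mL : L = m.
  apply: maxm.
  - by move=> a x b /LE Kx; apply/LE; rewrite !sigM idK.
  - apply/subvP => x mx; apply/LE/(subvP sm'K)/mE.
    by rewrite tauK'.
  by apply: contra K1 => /LE; rewrite sig1.
apply/vspaceP => x; apply/idP/idP => [Kx | /(subvP sm'K)//].
by apply/mE; rewrite -mL; apply/LE; rewrite sigmaK'.
Qed.

End Automorphisms.

Lemma automorphism_block (k : fieldType) (A : falgType k) (tau : A -> A) (m m' : {vspace A}) e :
    algebra_automorphism tau -> (forall x, x \in m' <-> tau x \in m) ->
  block_idempotent m' e -> block_idempotent m (tau e).
Proof.
move=> tauP mE [ee m'e e_in]; have [tau_lin tauM tau1 _] := tauP.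
split; first by rewrite -tauM ee.
  by have /mE := m'e; rewrite (linear_funB tau_lin) tau1.
move=> m2 max_m2 ne_m2; have [m2' m2E] := exists_preim m2 tau_lin.
apply/m2E/e_in; first exact: (preim_maximal tauP m2E max_m2).
apply: contraNneq ne_m2 => eq_m2.
have [sigma [_ _ tauK]] := automorphism_inv tauP.
apply/eqP/vspaceP => x; rewrite -[x]tauK.
by apply/idP/idP => [/m2E | /mE]; [rewrite eq_m2 => /mE | rewrite -eq_m2 => /m2E].
Qed.

(** * Blocks of Frobenius algebras *)

Section Linkage.

Variables (k : closedFieldType) (A : falgType k).
Implicit Types (m : {vspace A}).

(* The projective cover of the simple module of [m'] has a composition factor
   belonging to [m]. *)
Definition linked m m' := exists e e' x,
  [/\ block_idempotent m e, block_idempotent m' e' & e * x * e' != 0].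

(** Linkage does not depend on the idempotents: the left one is exchanged inside the left module
    [A e1'], then the right one inside the right module [e A]. *)
Lemma linked_any m m' e e' : linked m m' ->
  block_idempotent m e -> block_idempotent m' e' -> exists x, e * x * e' != 0.
Proof.
case=> [e1 [e1' [x [me1 m'e1' x_neq0]]]] me m'e'.
have [L LE] : exists L : {vspace A}, forall y, y \in L <-> exists a, y = a * e1'.
  apply: vspace_comprehension => [|c _ _ [a ->] [b ->]].
    by exists 0; rewrite mul0r.
  by exists (c *: a + b); rewrite mulrDl scalerAl.
have stL : stable (fun a y : A => a * y) L.
  by move=> a _ /LE[b ->]; apply/LE; exists (a * b); rewrite mulrA.
have [||_ /LE[x2 ->]] := block_part_neq0 (left_action A) stL _ me1 _ me (x := x * e1').
- by apply/LE; exists x.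
- by rewrite mulrA.
rewrite mulrA => x2_neq0.
have [R RE] : exists R : {vspace A}, forall y, y \in R <-> exists a, y = e * a.
  apply: vspace_comprehension => [|c _ _ [a ->] [b ->]].
    by exists 0; rewrite mulr0.
  by exists (c *: a + b); rewrite mulrDr scalerAr.
have stR : stable (fun a y : A => y * a) R.
  by move=> a _ /RE[b ->]; apply/RE; exists (b * a); rewrite mulrA.
have [|//|_ /RE[x3 ->]] := block_part_neq0 (right_action A) stR _ m'e1' _ m'e' (x := e * x2).
  by apply/RE; exists x2.
by exists x3.
Qed.

Lemma linked_image tau m m' (p p' : {vspace A}) : algebra_automorphism tau ->
    (forall x, x \in p <-> tau x \in m) -> (forall x, x \in p' <-> tau x \in m') ->
  linked p p' -> linked m m'.
Proof.
move=> tauP pE p'E [e [e' [x [pe p'e' x_neq0]]]].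
exists (tau e), (tau e'), (tau x); split;
  [exact: (automorphism_block tauP pE) | exact: (automorphism_block tauP p'E)|].
have [tau_lin tauM _ [sigma sigmaK _]] := tauP.
rewrite -!tauM; apply: contra x_neq0 => /eqP x0; apply/eqP/(can_inj sigmaK).
by rewrite x0 (linear_fun0 tau_lin).
Qed.

(** [e A e'] is the [e]-part of the left module [A e'] and the [e']-part of the right module [e A],
    so the simple modules of both blocks give lower bounds. *)
Lemma linked_dim m m' e e' d (P : {vspace A}) : linked m m' ->
    block_idempotent m e -> block_idempotent m' e' ->
    (forall x, e * x * e' \in P) ->
    \dim {:A} = (\dim m + d ^ 2)%N \/ \dim {:A} = (\dim m' + d ^ 2)%N ->
  (d <= \dim P)%N.
Proof.
move=> mm' me m'e' Pee' dimA; have [x x_neq0] := linked_any mm' me m'e'.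
case: dimA => dimA.
- have [L LE] : exists L : {vspace A}, forall y, y \in L <-> exists a, y = a * e'.
    apply: vspace_comprehension => [|c _ _ [a ->] [b ->]].
      by exists 0; rewrite mul0r.
    by exists (c *: a + b); rewrite mulrDl scalerAl.
  have stL : stable (fun a y : A => a * y) L.
    by move=> a _ /LE[b ->]; apply/LE; exists (a * b); rewrite mulrA.
  apply: (block_part_dim (left_action A) stL (x := x * e') _ me _ dimA) => [||_ /LE[a ->]].
  + by apply/LE; exists x.
  + by rewrite mulrA.
  by rewrite mulrA.
have [R RE] : exists R : {vspace A}, forall y, y \in R <-> exists a, y = e * a.
  apply: vspace_comprehension => [|c _ _ [a ->] [b ->]].
    by exists 0; rewrite mulr0.
  by exists (c *: a + b); rewrite mulrDr scalerAr.
have stR : stable (fun a y : A => y * a) R.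
  by move=> a _ /RE[b ->]; apply/RE; exists (b * a); rewrite mulrA.
apply: (block_part_dim (right_action A) stR (x := e * x) _ m'e' _ dimA) => [||_ /RE[a ->]] //.
by apply/RE; exists x.
Qed.

(* The block of [m] is not simple projective once it is linked to another one:
   the elements killed by [m] lie in [m]. *)
Lemma linked_annihilator m m' s : maximal_ideal m -> maximal_ideal m' -> m != m' ->
  linked m' m -> (forall x, x \in m -> x * s = 0) -> s \in m.
Proof.
move=> maxm maxm' ne_m [e' [e [x [m'e' me x_neq0]]]] ms.
have [idm _ _] := maxm.
apply: contraT => ms'.
have [S SE] : exists S : {vspace A}, forall s, s \in S <-> forall x, x \in m -> x * s = 0.
  apply: vspace_comprehension => [y _|c y z y0 z0 w mw]; first by rewrite mulr0.
  by rewrite mulrDr -scalerAr y0 // z0 // scaler0 addr0.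
have idS : ideal S.
  move=> a y b /SE y0; apply/SE => w mw.
  by rewrite !mulrA y0 ?mul0r // ideal_mulr.
(* The annihilator [S] contains some [u] congruent to 1 modulo [m]. The element [z] of [e' A e] lies
   in [m], so [z * u] is 0 and [z] equals [z * (1 - u)], which vanishes in the simple quotient. *)
have [|u /SE mu um] := maximal_ideal_comax maxm idS.
  by apply/subvPn; exists s => //; apply/SE.
have st1 : stable (fun a y : A => y * a) fullv by move=> a y _; rewrite memvf.
have [N1 [N' [d [_ _ N1z N'z [mE _ _ _]]]]] :=
  block_section (right_action A) st1 (memvf (e' * x)) me x_neq0.
case/negP: N'z; set z := e' * x * e in N1z *.
have mz : z \in m.
  have [_ _ e'_in] := m'e'; have e'm := e'_in m maxm ne_m.
  by rewrite /z -mulrA ideal_mulr.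
have -> : z = z * (1 - u) by rewrite mulrBr mulr1 mu // subr0.
exact: (proj1 (mE _) um).
Qed.

End Linkage.

Section Frobenius.

Variables (k : closedFieldType) (A : falgType k) (lam : A -> k).
Hypothesis char0 : [pchar k] =i pred0.
Hypothesis lam_lin : scalar lam.
Hypothesis lam_nondeg : forall a, (forall b, lam (a * b) = 0) -> a = 0.
Implicit Types (m : {vspace A}).

Lemma frobenius_linl b : scalar (fun a => lam (a * b)).
Proof. by move=> c x y; rewrite mulrDl -scalerAl lam_lin. Qed.

Lemma frobenius_linr a : scalar (fun b => lam (a * b)).
Proof. by move=> c x y; rewrite mulrDr -scalerAr lam_lin. Qed.

Lemma frobenius_nondegr b : (forall a, lam (a * b) = 0) -> b = 0.
Proof.
apply: (pairing_nondegr frobenius_linl frobenius_linr lam_nondeg).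
by [].
Qed.

(** By nondegeneracy [c] is determined by the functional it defines, and elements and functionals
    form spaces of the same dimension. *)
Lemma frobenius_represent (f : A -> k) : scalar f -> exists c, forall a, f a = lam (c * a).
Proof.
move=> f_lin; pose n := \dim {:A}.
pose g c : 'rV[k]_n := \row_i lam (c * (vbasis {:A})`_i).
have g_lin : linear g by move=> a x y; apply/rowP => i; rewrite !mxE frobenius_linl.
have [G GE] := linear_pack g_lin.
have basis_ext (h : A -> k) (h' : A -> k) : scalar h -> scalar h' ->
    (forall i : 'I_n, h (vbasis {:A})`_i = h' (vbasis {:A})`_i) -> h =1 h'.
  move=> h_lin h'_lin hh' a; rewrite (coord_vbasis (memvf a)).
  have hl : linear (h : A -> k^o) := h_lin; have h'l : linear (h' : A -> k^o) := h'_lin.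
  rewrite [LHS](linear_fun_sum hl) [RHS](linear_fun_sum h'l); apply: eq_bigr => i _.
  by rewrite [LHS](linear_funZ hl) [RHS](linear_funZ h'l) hh'.
have kerG : lker (linfun G) == 0%VS.
  rewrite -subv0; apply/subvP => c; rewrite memv_ker lfunE /= -GE memv0 => /eqP c0.
  apply/eqP/lam_nondeg; apply: basis_ext => [||i]; first exact: frobenius_linr.
    by move=> a x y; rewrite mulr0 addr0.
  by move/rowP/(_ i): c0; rewrite !mxE.
have : \row_i f (vbasis {:A})`_i \in limg (linfun G).
  suff -> : limg (linfun G) = fullv by rewrite memvf.
  apply/eqP; rewrite eqEdim subvf limg_dim_eq ?(eqP kerG) ?capv0 //.
  by rewrite [X in (X <= _)%N]dimvf dim_matrix [X in (X <= _)%N]mul1n /=.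
case/memv_imgP=> c _ cE; exists c; apply: basis_ext => //; first exact: frobenius_linr.
by move=> i; move/rowP/(_ i): cE; rewrite lfunE /= -GE !mxE.
Qed.

(** [nu b] represents the functional sending [a] to [lam (a * b)]; nondegeneracy turns identities
    between functionals into identities for [nu]. *)
Lemma nakayama : exists2 nu, algebra_automorphism nu
  & forall a b, lam (a * b) = lam (nu b * a).
Proof.
have /functional_choice[nu nuE] (b : A) :=
  frobenius_represent (frobenius_linl b).
have lam_inj c c' : (forall a, lam (c * a) = lam (c' * a)) -> c = c'.
  move=> cc'; apply/eqP; rewrite -subr_eq0; apply/eqP/lam_nondeg => a.
  have lam_l : linear (lam : A -> k^o) := lam_lin.
  by rewrite mulrBl [LHS](linear_funB lam_l) cc' subrr.
exists nu => [|a b]; last exact: nuE.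
apply: injective_automorphism => [c x y|x y||x y eq_nu].
- apply: lam_inj => a; rewrite -nuE mulrDr -scalerAr lam_lin.
  by rewrite mulrDl -scalerAl lam_lin -!nuE.
- by apply: lam_inj => a; rewrite -nuE mulrA nuE mulrA nuE mulrA.
- by apply: lam_inj => a; rewrite -nuE mulr1 mul1r.
apply/eqP; rewrite -subr_eq0; apply/eqP/frobenius_nondegr => a.
have lam_l : linear ((fun b => lam (a * b)) : A -> k^o) := frobenius_linr a.
rewrite [LHS](linear_funB lam_l).
by rewrite nuE [X in _ - X]nuE eq_nu subrr.
Qed.

Variable nu : A -> A.
Hypothesis nuP : algebra_automorphism nu.
Hypothesis nuE : forall a b, lam (a * b) = lam (nu b * a).

(** [nu (e0 m')] is again an idempotent of the block [m]. If [e_p A e_m'] vanished, the form would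
    make [nu (e0 m')] kill the left module generated by some nonzero [y] of [e_m A e_p], yet [e_m]
    fixes [y]. *)
Lemma linked_nakayama m m' p : maximal_ideal m -> maximal_ideal p ->
  (forall x, x \in m' <-> nu x \in m) -> linked m p -> linked p m'.
Proof.
move=> maxm maxp m'E mp; have [e0 [e0max _]] := exists_block_idempotents A char0.
have maxm' := preim_maximal nuP m'E maxm.
have me := e0max m maxm; have pe := e0max p maxp; have m'e := e0max m' maxm'.
have [x x_neq0] := linked_any mp me pe.
apply: NNPP => npm'; set y := e0 m * x * e0 p in x_neq0.
have pm'0 a : e0 p * a * e0 m' = 0.
  by apply: NNPP => /eqP pa; apply: npm'; exists (e0 p), (e0 m'), a.
have nuy0 a : nu (e0 m') * (a * y) = 0.
  apply: lam_nondeg => b.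
  rewrite -mulrA -nuE /y [X in lam X](_ : _ = a * e0 m * x * (e0 p * b * e0 m')); last first.
    by rewrite !mulrA.
  by rewrite pm'0 mulr0 [LHS](linear_fun0 (lam_lin : linear (lam : A -> k^o))).
have [L LL] : exists L : {vspace A}, forall z, z \in L <-> exists a, z = a * y.
  apply: vspace_comprehension => [|c _ _ [a ->] [b ->]].
    by exists 0; rewrite mul0r.
  by exists (c *: a + b); rewrite mulrDl scalerAl.
have stL : stable (fun a y : A => a * y) L.
  by move=> a _ /LL[b ->]; apply/LL; exists (a * b); rewrite mulrA.
have [||_ /LL[a ->]] := block_part_neq0 (left_action A) stL _ me _
  (automorphism_block nuP m'E m'e) (x := y).
- by apply/LL; exists 1; rewrite mul1r.
- by have [ee _ _] := me; rewrite /y !mulrA ee.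
by rewrite nuy0 eqxx.
Qed.

(** [S] is the orthogonal of [m] for the form. Its elements are fixed by [e] on the left because
    [1 - e] is in [m], and by [e'] on the right because [nu (1 - e')] is in [m]. *)
Lemma exists_annihilator m m' e e' :
    maximal_ideal m -> (forall x, x \in m' <-> nu x \in m) ->
    block_idempotent m e -> block_idempotent m' e' ->
  exists S : {vspace A}, [/\ \dim {:A} = (\dim m + \dim S)%N,
    forall s, s \in S <-> (forall x, x \in m -> x * s = 0)
    & forall s, s \in S -> s = e * s * e'].
Proof.
move=> [idm m1 _] m'E [_ me _] [_ m'e _].
have [S SE] := perp_exists frobenius_linr m.
have SP s : s \in S <-> (forall x, x \in m -> x * s = 0).
  split=> [Ss x mx | s0]; last first.
    by apply/SE => x mx; rewrite s0 // -[0 in LHS](mulr0 0) (beta0r frobenius_linr).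
  apply: frobenius_nondegr => a; rewrite mulrA; apply: (proj1 (SE s)) => //.
  exact: ideal_mull.
exists S; split=> [|//|s Ss].
  by rewrite (dim_perp frobenius_linl frobenius_linr lam_nondeg SE).
have es : e * s = s.
  apply/eqP; rewrite eq_sym -subr_eq0 -{1}[s]mul1r -mulrBl.
  by rewrite (proj1 (SP s)).
rewrite es; apply/eqP; rewrite -subr_eq0 -{1}[s]mulr1 -mulrBr; apply/eqP.
apply: lam_nondeg => b; rewrite nuE mulrA nuE mulrA.
by apply: (proj1 (SE s)) => //; apply: ideal_mulr => //; apply/m'E.
Qed.

End Frobenius.

Lemma dim_orthogonal_projections (k : fieldType) (V : vectType k) (I : eqType)
    (P : I -> 'End(V)) (s : seq I) :
    uniq s -> {in s, forall i x, P i (P i x) = P i x} ->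
    {in s &, forall i j, i != j -> forall x, P i (P j x) = 0} ->
  (\sum_(i <- s) \dim (limg (P i)) <= \dim {:V})%N.
Proof.
move=> uniq_s PP P0; rewrite (@leq_trans (\dim (\sum_(i <- s) limg (P i))%VS)) //; last first.
  by rewrite dimvS ?subvf.
elim: s uniq_s PP P0 => [|i s IHs]; first by rewrite !big_nil.
move=> /andP[i_s uniq_s] PP P0.
have si j : j \in s -> j \in i :: s by rewrite inE orbC => ->.
rewrite !big_cons dimv_disjoint_sum ?leq_add2l ?IHs //.
- by move=> j /si sj; apply: PP.
- by move=> j1 j2 /si sj1 /si; apply: P0.
apply/eqP; rewrite -subv0; apply/subvP => x /memv_capP[/memv_imgP[y _ xE] sx].
have <- : P i x = x by rewrite xE PP ?mem_head.
rewrite memv0.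
suff : (\sum_(j <- s) limg (P j) <= lker (P i))%VS by move/subvP/(_ x sx); rewrite memv_ker.
rewrite big_seq; apply: (big_ind (fun U => U <= lker (P i))%VS) => [|U W sU sW|j sj].
- exact: sub0v.
- by rewrite subv_add sU.
apply/subvP => _ /memv_imgP[z _ ->]; rewrite memv_ker P0 ?mem_head ?si //.
by apply: contraNneq i_s => ->.
Qed.

(** * Counting dimensions of Peirce components *)

Section Counting.

Variables (k : closedFieldType) (A : falgType k) (lam : A -> k).
Hypothesis lam_lin : scalar lam.
Hypothesis lam_nondeg : forall a, (forall b, lam (a * b) = 0) -> a = 0.
Variable nu : A -> A.
Hypothesis nuP : algebra_automorphism nu.
Hypothesis nuE : forall a b, lam (a * b) = lam (nu b * a).

Variable e : {vspace A} -> A.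
Hypothesis eP : forall m, maximal_ideal m -> block_idempotent m (e m).
Hypothesis e0 : forall m m', maximal_ideal m -> maximal_ideal m' -> m != m' ->
  e m * e m' = 0.

Definition peirce (m m' : {vspace A}) : {vspace A} := limg (amulr (e m') \o amull (e m))%VF.

Lemma peirceP m m' x : e m * x * e m' \in peirce m m'.
Proof.
have <- : (amulr (e m') \o amull (e m))%VF x = e m * x * e m' by rewrite lfunE /= !lfunE.
by rewrite memv_img ?memvf.
Qed.

Lemma sum_dim_peirce (s : seq {vspace A}) : uniq s -> {in s, forall m, maximal_ideal m} ->
  (\sum_(m <- s) \sum_(m' <- s) \dim (peirce m m') <= \dim {:A})%N.
Proof.
move=> uniq_s max_s; pose P (mm : {vspace A} * {vspace A}) := (amulr (e mm.2) \o amull (e mm.1))%VF.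
have PE mm x : P mm x = e mm.1 * x * e mm.2 by rewrite lfunE /= !lfunE.
rewrite -(big_allpairs (F := fun mm => \dim (limg (P mm)))).
apply: dim_orthogonal_projections => [|[m m'] /allpairsP[[m1 m2] /= [s1 s2 [-> ->]]] x|].
- by rewrite allpairs_uniq // => -[? ?] [? ?].
- rewrite !PE /= !mulrA; have [ee _ _] := eP (max_s _ s1); have [ee' _ _] := eP (max_s _ s2).
  by rewrite ee -!mulrA ee'.
move=> [m m'] [p p'] /allpairsP[[m1 m2] /= [s1 s2 [-> ->]]].
move=> /allpairsP[[p1 p2] /= [t1 t2 [-> ->]]] ne x; rewrite !PE /=.
have [eq1 | ne1] := eqVneq m1 p1; last by rewrite !mulrA e0 ?mul0r //; apply: max_s.
have [eq2 | ne2] := eqVneq p2 m2; last by rewrite -!mulrA e0 ?mulr0 //; apply: max_s.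
by rewrite eq1 eq2 eqxx in ne.
Qed.

Lemma fullv_sub_peirce m : maximal_ideal m -> (fullv <= peirce m m + m)%VS.
Proof.
move=> maxm; have [_ m1e _] := eP maxm; have [idm _ _] := maxm.
apply/subvP => x _; rewrite -[x](subrK (e m * x * e m)) addrC memv_add ?peirceP //.
rewrite (_ : _ - _ = (1 - e m) * x + e m * (x * (1 - e m))).
  by apply: memvD; [exact: ideal_mulr | do 2!apply: ideal_mull => //].
by rewrite mulrBl mul1r mulrBr mulr1 mulrBr !mulrA addrA subrK.
Qed.

(** The top contributes the codimension of [m] through the surjection of [peirce m m] onto [A / m];
    the socle [S] contributes it again inside [peirce m m']. *)
Lemma sum_dim_peirce_class (s : seq {vspace A}) m :
    uniq s -> {in s, forall m, maximal_ideal m} ->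
    {in s, forall m m' : {vspace A}, (forall x, x \in m' <-> nu x \in m) -> m' \in s} ->
    m \in s -> (forall t, (forall x, x \in m -> x * t = 0) -> t \in m) ->
  (2 * (\dim {:A} - \dim m) <= \sum_(m' <- s) \dim (peirce m m'))%N.
Proof.
move=> uniq_s max_s nu_s sm ann_m; have maxm := max_s m sm.
have [nu_lin _ _ _] := nuP; have [m' m'E] := exists_preim m nu_lin.
have sm' := nu_s m sm m' m'E; have maxm' := max_s m' sm'.
have [S [dimS SE eSe]] :=
  exists_annihilator lam_lin lam_nondeg nuE maxm m'E (eP maxm) (eP maxm').
have sSP : (S <= peirce m m')%VS.
  by apply/subvP => t /eSe->; apply: peirceP.
have dim_d : (\dim {:A} <= \dim (peirce m m) + \dim m)%N.
  have [+ _] := dimv_add_leqif (peirce m m) m; apply: leq_trans.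
  exact/dimvS/fullv_sub_peirce.
rewrite (bigD1_seq m) //=.
have [eq_m | ne_m] := eqVneq m' m; last first.
  rewrite (big_rem m') //= ne_m /=; have := dimvS sSP; lia.
(* Here both contributions sit in the same component. They stay independent because [S] lies in [m],
   the kernel of the map to [A / m]. *)
have sS_m : (S <= peirce m m :&: m)%VS.
  apply/subvP => t St; rewrite memv_cap ann_m ?andbT; last exact/SE.
  by rewrite -[X in peirce _ X]eq_m (subvP sSP).
suff : (\dim {:A} + \dim (peirce m m :&: m) <= \dim (peirce m m) + \dim m)%N.
  have := dimvS sS_m; lia.
rewrite -(dimv_sum_cap (peirce m m) m) leq_add2r dimvS //.
exact: fullv_sub_peirce.
Qed.

Theorem dim_lower_bound (Gs Vs : seq {vspace A}) (d : nat) :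
    (1 < d)%N -> uniq Gs -> uniq Vs ->
    {in Gs, forall m, maximal_ideal m /\ \dim {:A} = (\dim m + 1)%N} ->
    {in Vs, forall m, maximal_ideal m /\ \dim {:A} = (\dim m + d ^ 2)%N} ->
    {in Gs, forall m m' : {vspace A}, (forall x, x \in m' <-> nu x \in m) -> m' \in Gs} ->
    {in Vs, forall m m' : {vspace A}, (forall x, x \in m' <-> nu x \in m) -> m' \in Vs} ->
    {in Gs ++ Vs, forall (m : {vspace A}) (t : A), (forall x, x \in m -> x * t = 0) -> t \in m} ->
    {in Gs, forall g, exists2 m, m \in Vs & linked g m} ->
    {in Gs, forall g, exists2 m, m \in Vs & linked m g} ->
  (2 * size Gs + 2 * d * size Gs + 2 * (d ^ 2 * size Vs) <= \dim {:A})%N.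
Proof.
move=> d_gt1 uniq_G uniq_V GP VP nuG nuV annGV linkGV linkVG.
have uniq_GV : uniq (Gs ++ Vs).
  rewrite cat_uniq uniq_G uniq_V andbT /=; apply/hasPn => m /VP[_ dim_m].
  apply/negP => /GP[_]; rewrite dim_m => /addnI/eqP; rewrite -(exp1n 2) eqn_exp2r //.
  by rewrite gtn_eqF.
have max_GV : {in Gs ++ Vs, forall m, maximal_ideal m}.
  by move=> m; rewrite mem_cat => /orP[/GP[] | /VP[]].
apply: leq_trans (sum_dim_peirce uniq_GV max_GV).
rewrite big_cat /=.
under eq_bigr do rewrite big_cat /=.
under [X in (_ <= _ + X)%N]eq_bigr do rewrite big_cat /=.
rewrite !big_split /= [X in (_ <= _ + (X + _))%N]exchange_big /=.
have sum_ge (s : seq {vspace A}) (F : {vspace A} -> nat) c :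
    {in s, forall m, c <= F m}%N -> (c * size s <= \sum_(m <- s) F m)%N.
  move=> cF; rewrite -iter_addn_0 -(count_predT s) -big_const_seq.
  by rewrite big_seq [leqRHS]big_seq; apply: leq_sum.
have GG : (2 * size Gs <= \sum_(m <- Gs) \sum_(m' <- Gs) \dim (peirce m m'))%N.
  apply: sum_ge => g Gg; have [maxg dim_g] := GP g Gg.
  have := sum_dim_peirce_class uniq_G (fun m Gm => (GP m Gm).1) nuG Gg.
  by rewrite dim_g addKn muln1; apply; apply: annGV; rewrite mem_cat Gg.
have VV : (2 * d ^ 2 * size Vs <= \sum_(m <- Vs) \sum_(m' <- Vs) \dim (peirce m m'))%N.
  apply: sum_ge => g Gg; have [maxg dim_g] := VP g Gg.
  have := sum_dim_peirce_class uniq_V (fun m Gm => (VP m Gm).1) nuV Gg.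
  by rewrite dim_g addKn; apply; apply: annGV; rewrite mem_cat Gg orbT.
(* A mixed component is measured by the simple module of its ideal in [Vs], of dimension [d]; one
   such ideal per grouplike is enough. *)
have GV : (d * size Gs <= \sum_(m <- Gs) \sum_(m' <- Vs) \dim (peirce m m'))%N.
  apply: sum_ge => g Gg; have [m Vm gm] := linkGV g Gg.
  have [[maxg _] [maxm dim_m]] := (GP g Gg, VP m Vm).
  rewrite (bigD1_seq m) //= (leq_trans _ (leq_addr _ _)) //.
  by apply: (linked_dim gm (eP maxg) (eP maxm)) => [x|]; [apply: peirceP | right].
have VG : (d * size Gs <= \sum_(m <- Gs) \sum_(m' <- Vs) \dim (peirce m' m))%N.
  apply: sum_ge => g Gg; have [m Vm gm] := linkVG g Gg.
  have [[maxg _] [maxm dim_m]] := (GP g Gg, VP m Vm).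
  rewrite (bigD1_seq m) //= (leq_trans _ (leq_addr _ _)) //.
  by apply: (linked_dim gm (eP maxm) (eP maxg)) => [x|]; [apply: peirceP | left].
move: GG VV GV VG; rewrite -!mulnA; lia.
Qed.

End Counting.

(** * Sweedler sums *)

Definition bilinear (k : fieldType) (U V W : lmodType k) (F : U -> V -> W) :=
  (forall v, linear (F^~ v)) /\ (forall u, linear (F u)).

Section LinearCombinators.

Variables (k : fieldType) (U V W : lmodType k).

Lemma linear_id : linear (fun u : U => u). Proof. by []. Qed.

Lemma linear_comp_hom (f : {linear V -> W}) (F : U -> V) :
  linear F -> linear (fun u => f (F u)).
Proof. by move=> F_lin a u v; rewrite F_lin linearP. Qed.

Lemma linear_scale c (F : U -> W) : linear F -> linear (fun u => c *: F u).
Proof. by move=> F_lin a u v; rewrite F_lin scalerDr !scalerA mulrC. Qed.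

Lemma linear_scalel (F : U -> k^o) (w : W) :
  linear F -> linear (fun u => (F u : k) *: w).
Proof. by move=> F_lin a u v; rewrite F_lin scalerDl -scalerA. Qed.

Lemma linear_scalar_mull (c : k) (F : U -> k^o) :
  linear F -> linear (fun u => (c * F u : k^o)).
Proof. by move=> F_lin a u v; rewrite F_lin mulrDr scalerAr. Qed.

Lemma linear_scalar_mulr (c : k) (F : U -> k^o) :
  linear F -> linear (fun u => (F u * c : k^o)).
Proof. by move=> F_lin a u v; rewrite F_lin mulrDl scalerAl. Qed.

Lemma linear_sum_fun (I : finType) (F : I -> U -> W) :
  (forall i, linear (F i)) -> linear (fun u => \sum_i F i u).
Proof.
move=> F_lin a u v; rewrite scaler_sumr -big_split.
by apply: eq_bigr => i _; rewrite F_lin.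
Qed.

End LinearCombinators.

Section LinearCombinatorsAlgebra.

Variables (k : fieldType) (U : lmodType k) (B : falgType k).

Lemma linear_mull (c : B) (F : U -> B) : linear F -> linear (fun u => c * F u).
Proof. by move=> F_lin a u v; rewrite F_lin mulrDr scalerAr. Qed.

Lemma linear_mulr (c : B) (F : U -> B) : linear F -> linear (fun u => F u * c).
Proof. by move=> F_lin a u v; rewrite F_lin mulrDl scalerAl. Qed.

End LinearCombinatorsAlgebra.

Section Sweedler.

Variables (k : fieldType) (C : fdCoalgType k).
Implicit Types (x y : C).

Local Notation bas := (vbasis {:C}).

(* [sw x F] is Sweedler's sum of [F x1 x2]. *)
Definition sw (W : lmodType k) (x : C) (F : C -> C -> W) : W :=
  \sum_(i < \dim {:C}) \sum_(j < \dim {:C}) (comul x : 'M_(_, _)) i j *: F bas`_i bas`_j.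

Lemma sw_lift (W : vectType k) x (F : C -> C -> W) : sw x F = tensor_lift F (comul x).
Proof. by rewrite tensor_liftE. Qed.

Lemma eq_sw (W : lmodType k) x (F F' : C -> C -> W) : F =2 F' -> sw x F = sw x F'.
Proof. by move=> FF'; do 2!apply: eq_bigr => ? _; rewrite FF'. Qed.

Lemma linear_sw (U W : lmodType k) (f : U -> C) (F : C -> C -> W) :
  linear f -> linear (fun u => sw (f u) F).
Proof.
move=> f_lin a u v; rewrite /sw scaler_sumr -big_split; apply: eq_bigr => i _.
rewrite scaler_sumr -big_split; apply: eq_bigr => j _ /=.
by rewrite f_lin linearP !mxE scalerDl scalerA.
Qed.

Lemma linear_sw_fun (U W : lmodType k) x (F : U -> C -> C -> W) :
  (forall a b, linear (fun u => F u a b)) -> linear (fun u => sw x (F u)).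
Proof. by move=> F_lin; do 2!apply: linear_sum_fun => ?; apply: linear_scale. Qed.

Lemma linear_of_sw (U W : lmodType k) (L : {linear U -> W}) x (F : C -> C -> U) :
  L (sw x F) = sw x (fun a b => L (F a b)).
Proof. by rewrite /sw; do 2!(rewrite linear_sum; apply: eq_bigr => ? _); rewrite linearZ. Qed.

Lemma apply_sw (U W : lmodType k) (L : U -> W) x (F : C -> C -> U) :
  linear L -> L (sw x F) = sw x (fun a b => L (F a b)).
Proof. by move=> /linear_pack[F' ->]; apply: linear_of_sw. Qed.

Lemma exchange_sw (W : lmodType k) x y (F : C -> C -> C -> C -> W) :
  sw x (fun a b => sw y (fun c d => F a b c d)) =
  sw y (fun c d => sw x (fun a b => F a b c d)).
Proof.
rewrite /sw; under eq_bigr do under eq_bigr do rewrite scaler_sumr.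
under [RHS]eq_bigr do under eq_bigr do rewrite scaler_sumr.
under eq_bigr do under eq_bigr do under eq_bigr do rewrite scaler_sumr.
under [RHS]eq_bigr do under eq_bigr do under eq_bigr do rewrite scaler_sumr.
under eq_bigr do rewrite exchange_big; rewrite exchange_big /=.
apply: eq_bigr => c _; under eq_bigr do rewrite exchange_big; rewrite exchange_big /=.
do 3!apply: eq_bigr => ? _; by rewrite !scalerA mulrC.
Qed.

Lemma comul_pure x :
  comul x = \sum_(i < \dim {:C}) \sum_(j < \dim {:C})
    (comul x : 'M_(_, _)) i j *: (bas`_i \ox bas`_j).
Proof. exact: tensor_pure_span. Qed.

(** [Phi] is the linear map attached to [F] on the triple tensor product; the two sums are its
    values on the two sides of [comulA]. *)
Lemma coassoc_sw (W : vectType k) x (F : C -> C -> C -> W) :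
    (forall a b, linear (fun c => F a b c)) -> (forall a c, linear (fun b => F a b c)) ->
    (forall b c, linear (fun a => F a b c)) ->
  sw x (fun a b => sw a (fun c d => F c d b)) = sw x (fun a b => sw b (fun c d => F a c d)).
Proof.
move=> F3 F2 F1; pose Phi := tensor_lift (fun a => tensor_lift (F a)).
have Phi_pure a b c : Phi (a \ox (b \ox c)) = F a b c.
  rewrite /Phi tensor_lift_pure => [|t d u v|u d t t'].
  - by rewrite tensor_lift_pure.
  - by apply: tensor_liftC => b' c'; rewrite F1.
  by rewrite linearP.
have comul_sw y : comul y = sw y (fun a b => a \ox b) by rewrite [LHS]comul_pure.
have pure_linl (U V : vectType k) (v : V) : linear (fun u : U => u \ox v).
  exact: tensor_pure_linearl.
have pure_linr (U V : vectType k) (u : U) : linear (fun v : V => u \ox v).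
  exact: tensor_pure_linearr.
transitivity (Phi (tensor_assoc C C C (tensor_map comul \1 (comul x)))).
  rewrite [comul x]comul_sw !linear_of_sw; apply: eq_sw => a b /=.
  rewrite tensor_map_pure id_lfunE comul_sw (apply_sw _ _ (pure_linl _ _ b)) !linear_of_sw.
  by apply: eq_sw => c d /=; rewrite tensor_assoc_pure Phi_pure.
rewrite comulA [comul x]comul_sw !linear_of_sw; apply: eq_sw => a b /=.
rewrite tensor_map_pure id_lfunE comul_sw (apply_sw _ _ (pure_linr _ _ a)) linear_of_sw.
by apply: eq_sw => c d /=; rewrite Phi_pure.
Qed.


End Sweedler.

Lemma linear_bilinearl (k : fieldType) (T U V W : lmodType k) (F : U -> V -> W)
    (f : T -> U) v :
  bilinear F -> linear f -> linear (fun t => F (f t) v).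
Proof. by case=> Fl _ f_lin a t t'; rewrite f_lin Fl. Qed.

Lemma linear_bilinearr (k : fieldType) (T U V W : lmodType k) (F : U -> V -> W)
    (f : T -> V) u :
  bilinear F -> linear f -> linear (fun t => F u (f t)).
Proof. by case=> _ Fr f_lin a t t'; rewrite f_lin Fr. Qed.

Ltac linear_step := first
  [ exact: linear_id
  | assumption
  | match goal with H : context [GRing.linear_for] |- _ => exact: H end
  | match goal with H : bilinear _ |- _ =>
      first [apply: (linear_bilinearl _ H) | apply: (linear_bilinearr _ H)] end
  | apply: linear_sw_fun => ? ?
  | apply: linear_sw
  | apply: linear_mull
  | apply: linear_mulr
  | apply: linear_scalar_mull
  | apply: linear_scalar_mulr
  | apply: linear_scale
  | apply: linear_scalel
  | apply: linear_comp_hom ].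

Ltac linear_tac := intros; cbv beta; repeat linear_step.

Section SweedlerRules.

Variables (k : fieldType) (C : fdCoalgType k).
Implicit Types (x y : C).

Lemma sw_counitl x : sw x (fun a b => (counit a : k) *: b) = x.
Proof. by rewrite sw_lift counitl. Qed.

Lemma sw_counitr x : sw x (fun a b => (counit b : k) *: a) = x.
Proof. by rewrite sw_lift counitr. Qed.

Lemma sw_counitlE (W : lmodType k) x (F : C -> W) :
  linear F -> sw x (fun a b => (counit a : k) *: F b) = F x.
Proof.
move=> F_lin; rewrite -[in RHS](sw_counitl x) (apply_sw _ _ F_lin).
by apply: eq_sw => a b; have [L ->] := linear_pack F_lin; rewrite linearZ.
Qed.

Lemma sw_counitrE (W : lmodType k) x (F : C -> W) :
  linear F -> sw x (fun a b => (counit b : k) *: F a) = F x.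
Proof.
move=> F_lin; rewrite -[in RHS](sw_counitr x) (apply_sw _ _ F_lin).
by apply: eq_sw => a b; have [L ->] := linear_pack F_lin; rewrite linearZ.
Qed.

Lemma sw_comul (W : vectType k) x (F : C -> C -> W) u v :
  bilinear F -> comul x = u \ox v -> sw x F = F u v.
Proof. by case=> Fl Fr xE; rewrite sw_lift xE tensor_lift_pure. Qed.

End SweedlerRules.

Section SweedlerBialgebra.

Variables (k : fieldType) (H : fdBialgType k).
Implicit Types (x y : H).

Lemma sw1 (W : vectType k) (F : H -> H -> W) : bilinear F -> sw 1 F = F 1 1.
Proof. by move/sw_comul; apply; rewrite comul1. Qed.

Lemma sw_mul (W : vectType k) x y (F : H -> H -> W) : bilinear F ->
  sw (x * y) F = sw x (fun a b => sw y (fun c d => F (a * c) (b * d))).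
Proof.
case=> Fl Fr; rewrite sw_lift comulM /tensor_mul [X in tensor_lift F X]tensor_liftE.
rewrite linear_sum; apply: eq_bigr => i _; rewrite linear_sum; apply: eq_bigr => j _.
rewrite linearZ /=; congr (_ *: _); rewrite [X in tensor_lift F X]tensor_liftE linear_sum.
apply: eq_bigr => i' _; rewrite linear_sum; apply: eq_bigr => j' _.
by rewrite linearZ /= tensor_lift_pure.
Qed.

End SweedlerBialgebra.

(** * The antipode reverses products and coproducts *)

Section Antipode.

Variables (k : fieldType) (H : fdHopfAlgType k).
Implicit Types (x y : H).

Local Notation S := (antipode : 'End(H)).
Local Notation eps x := (counit x : k).

Lemma sw_antipodel x : sw x (fun a b => S a * b) = eps x *: 1.
Proof. by rewrite sw_lift antipodel. Qed.

Lemma sw_antipoder x : sw x (fun a b => a * S b) = eps x *: 1.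
Proof. by rewrite sw_lift antipoder. Qed.

Lemma antipode1 : S 1 = 1.
Proof.
have := sw_antipodel 1; rewrite counit1 scale1r sw1 ?mulr1 //.
by split; linear_tac.
Qed.

Lemma counit_antipode x : counit (S x) = counit x.
Proof.
have := congr1 (@counit k H) (sw_antipodel x); rewrite linear_of_sw linearZ /= counit1.
rewrite [RHS]mulr1 => <-; under eq_sw do rewrite counitM.
rewrite -[in LHS](sw_counitr x) !linear_of_sw; apply: eq_sw => a b /=.
by rewrite !linearZ /= mulrC.
Qed.

Lemma sw_antipodelE (W : lmodType k) x (L : H -> W) :
  linear L -> sw x (fun a b => L (S a * b)) = eps x *: L 1.
Proof.
move=> L_lin; rewrite -(apply_sw _ _ L_lin) sw_antipodel.
by have [L' ->] := linear_pack L_lin; rewrite linearZ.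
Qed.

Lemma sw_antipoderE (W : lmodType k) x (L : H -> W) :
  linear L -> sw x (fun a b => L (a * S b)) = eps x *: L 1.
Proof.
move=> L_lin; rewrite -(apply_sw _ _ L_lin) sw_antipoder.
by have [L' ->] := linear_pack L_lin; rewrite linearZ.
Qed.

(* Both sides equal the sum of [S (x1 y1) (x2 y2) S y3 S x3]. *)
Lemma antipodeM x y : S (x * y) = S y * S x.
Proof.
pose F a b1 b2 := sw y (fun c d => sw d (fun d1 d2 =>
  S (a * c) * (b1 * d1) * (S d2 * S b2))).
transitivity (sw x (fun a b => sw b (fun b1 b2 => F a b1 b2))).
  have FE a b1 b2 : F a b1 b2 = S (a * y) * (b1 * S b2).
    rewrite -[RHS](@sw_counitrE _ _ _ _ (fun c => S (a * c) * (b1 * S b2))); last by linear_tac.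
    apply: eq_sw => c d; pose L z := S (a * c) * (b1 * (z * S b2)).
    transitivity (sw d (fun d1 d2 => L (d1 * S d2))).
      by apply: eq_sw => d1 d2; rewrite /L !mulrA.
    by rewrite sw_antipoderE /L ?mul1r //; linear_tac.
  rewrite -[LHS](@sw_counitrE _ _ _ _ (fun a => S (a * y))); last by linear_tac.
  apply: eq_sw => a b; under [RHS]eq_sw do rewrite FE.
  by rewrite (@sw_antipoderE _ _ (fun z => S (a * y) * z)) ?mulr1 //; linear_tac.
(* Regrouped this way, [S (x1 y1) * (x2 y2)] collapses to counits and leaves [S y * S x]. *)
rewrite -coassoc_sw; try by rewrite /F; linear_tac.
rewrite -[RHS](@sw_counitlE _ _ _ _ (fun b => S y * S b)); last by linear_tac.
apply: eq_sw => u b; rewrite /F.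
transitivity (sw u (fun a1 a2 => sw y (fun w d2 => sw w (fun c d1 =>
    S (a1 * c) * (a2 * d1) * (S d2 * S b))))).
  by apply: eq_sw => a1 a2; rewrite -coassoc_sw //; linear_tac.
rewrite exchange_sw -[S y * S b](@sw_counitlE _ _ _ _ (fun d => S d * S b)); last by linear_tac.
pose scl (z : H) := eps u *: z; have scl_lin : linear scl by rewrite /scl; linear_tac.
rewrite -/(scl _) (apply_sw _ _ scl_lin); apply: eq_sw => w d2.
transitivity (sw (u * w) (fun p q => S p * q * (S d2 * S b))).
  by rewrite sw_mul //; split; linear_tac.
rewrite (@sw_antipodelE _ _ (fun z => z * (S d2 * S b))); last by linear_tac.
by rewrite mul1r counitM /scl scalerA.
Qed.

(* [Delta (S x)] and [S x2 (x) S x1] are both equal to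
   [S(x1)_1 x2 S(x5) (x) S(x1)_2 x3 S(x4)]. *)
Lemma sw_antipode (W : vectType k) x (F : H -> H -> W) : bilinear F ->
  sw (S x) F = sw x (fun a b => F (S b) (S a)).
Proof.
move=> F_bil.
pose K a q1 q2 w1 w2 := sw (S a) (fun s1 s2 => F (s1 * q1 * S w2) (s2 * q2 * S w1)).
pose G a q w := sw q (fun q1 q2 => sw w (fun w1 w2 => K a q1 q2 w1 w2)).
(* Collapsing x3 S(x4) and then x2 S(x5) leaves the left side; cancelling S(x1) against [q], whose
   coproduct gives x2 and x3, leaves the right side. *)
transitivity (sw x (fun a r => sw r (fun q w => G a q w))).
  rewrite -[LHS](@sw_counitrE _ _ _ _ (fun a => sw (S a) F)); last by linear_tac.
  apply: eq_sw => a r; rewrite /G.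
  rewrite (@coassoc_sw _ _ _ _ (fun q1 q2 w => sw w (fun w1 w2 => K a q1 q2 w1 w2))).
  - pose L z := sw (S a) (fun s1 s2 => F (s1 * z) s2).
    transitivity (sw r (fun q1 v => L (q1 * S v))).
      rewrite sw_antipoderE /L; last by linear_tac.
      by congr (_ *: _); apply: eq_sw => s1 s2; rewrite mulr1.
    apply: eq_sw => q1 v; rewrite -(@coassoc_sw _ _ _ _ (K a q1)).
    + rewrite -[LHS](@sw_counitlE _ _ _ _ (fun v => L (q1 * S v))); last first.
        by rewrite /L; linear_tac.
      apply: eq_sw => v' w2.
      pose L' z := sw (S a) (fun s1 s2 => F (s1 * q1 * S w2) (s2 * z)).
      transitivity (sw v' (fun q2 w1 => L' (q2 * S w1))).
        rewrite sw_antipoderE /L'; last by linear_tac.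
        by congr (_ *: _); apply: eq_sw => s1 s2; rewrite mulr1 mulrA.
      by apply: eq_sw => q2 w1; rewrite /K /L'; apply: eq_sw => s1 s2; rewrite mulrA.
    all: rewrite /K; linear_tac.
  all: rewrite /K; linear_tac.
rewrite -coassoc_sw.
- rewrite -[RHS](@sw_counitlE _ _ _ _ (fun w => sw w (fun a b => F (S b) (S a))));
    last by linear_tac.
  apply: eq_sw => u w; rewrite /G.
  under eq_sw do rewrite exchange_sw.
  rewrite exchange_sw.
  pose scl (z : W) := eps u *: z; have scl_lin : linear scl by rewrite /scl; linear_tac.
  rewrite -/(scl _) (apply_sw _ _ scl_lin); apply: eq_sw => w1 w2; rewrite /scl.
  pose L z := sw z (fun z1 z2 => F (z1 * S w2) (z2 * S w1)).
  have L_lin : linear L by rewrite /L; linear_tac.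
  transitivity (sw u (fun a q => L (S a * q))).
    apply: eq_sw => a q; rewrite /L sw_mul //; first by rewrite exchange_sw.
    by split; linear_tac.
  rewrite (sw_antipodelE _ L_lin) /L sw1 ?mul1r //.
  by split; linear_tac.
all: rewrite /G /K; linear_tac.
Qed.

End Antipode.

(** * The convolution algebra *)

Definition dual (k : fieldType) (H : fdHopfAlgType k) := 'Hom(H, k^o).

HB.instance Definition _ (k : fieldType) (H : fdHopfAlgType k) :=
  Vector.copy (dual H) 'Hom(H, k^o).

Section Dual.

Variables (k : fieldType) (H : fdHopfAlgType k).
Implicit Types (p q : dual H) (x y : H).

Definition ev p x : k := (p : 'Hom(H, k^o)) x.

Lemma ev_linearr p : scalar (ev p).
Proof. by move=> a x y; rewrite /ev linearP. Qed.

Lemma ev_linearl x : scalar (ev^~ x).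
Proof. by move=> a p q; rewrite /ev add_lfunE scale_lfunE. Qed.

Lemma dual_ext p q : ev p =1 ev q -> p = q.
Proof. by move=> pq; apply/lfunP => x; apply: pq. Qed.

Lemma dual_exists (f : H -> k) : scalar f -> {p : dual H | forall x, ev p x = f x}.
Proof.
move=> f_lin; have [F FE] := linear_pack (f_lin : linear (f : H -> k^o)).
by exists (linfun F) => x; rewrite /ev lfunE /= -FE.
Qed.

Lemma ev_linear p : linear (ev p : H -> k^o). Proof. exact: ev_linearr. Qed.
Lemma evl_linear x : linear (ev^~ x : dual H -> k^o). Proof. exact: ev_linearl. Qed.

Lemma convolution_linear p q : scalar (fun x => sw x (fun a b => (ev p a * ev q b : k^o))).
Proof.
have sw_lin : linear (fun x => sw x (fun a b => (ev p a * ev q b : k^o))) by linear_tac.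
exact: sw_lin.
Qed.

Definition convolution p q : dual H := sval (dual_exists (convolution_linear p q)).

Lemma convolutionE p q x : ev (convolution p q) x = sw x (fun a b => (ev p a * ev q b : k^o)).
Proof. exact: (svalP (dual_exists _)). Qed.

Definition dual_counit : dual H := counit.

Fact convolutionA : associative convolution.
Proof.
move=> p q s; apply: dual_ext => x; rewrite !convolutionE.
under eq_sw => a b.
  rewrite convolutionE.
  have -> : (ev p a * sw b (fun c d => (ev q c * ev s d : k^o)) : k^o) =
            sw b (fun c d => ev p a * (ev q c * ev s d) : k^o).
    by rewrite (@apply_sw _ _ _ _ (fun z : k^o => ev p a * z : k^o)) //; linear_tac.
  over.
under [RHS]eq_sw => a b.
  rewrite convolutionE.
  have -> : (sw a (fun c d => (ev p c * ev q d : k^o)) * ev s b : k^o) =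
            sw a (fun c d => ev p c * (ev q d * ev s b) : k^o).
    rewrite (@apply_sw _ _ _ _ (fun z : k^o => z * ev s b : k^o)) //; last by linear_tac.
    by apply: eq_sw => c d; rewrite mulrA.
  over.
by rewrite -(@coassoc_sw _ _ _ _ (fun a b c => (ev p a * (ev q b * ev s c) : k^o))) //;
  linear_tac; exact: ev_linear.
Qed.

Fact convolution1l : left_id dual_counit convolution.
Proof.
move=> p; apply: dual_ext => x; rewrite convolutionE.
exact: (@sw_counitlE _ _ _ _ (ev p : H -> k^o)) (ev_linear p).
Qed.

Fact convolution1r : right_id dual_counit convolution.
Proof.
move=> p; apply: dual_ext => x; rewrite convolutionE.
under eq_sw do rewrite mulrC.
exact: (@sw_counitrE _ _ _ _ (ev p : H -> k^o)) (ev_linear p).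
Qed.

Lemma convolution_linearl p : linear (convolution^~ p).
Proof.
move=> c q s; apply: dual_ext => x; rewrite ev_linearl !convolutionE.
by apply: (@linear_sw_fun _ _ _ _ _ (fun q a b => ev q a * ev p b : k^o)); linear_tac;
  exact: evl_linear.
Qed.

Lemma convolution_linearr p : linear (convolution p).
Proof.
move=> c q s; apply: dual_ext => x; rewrite ev_linearl !convolutionE.
by apply: (@linear_sw_fun _ _ _ _ _ (fun q a b => ev p a * ev q b : k^o)); linear_tac;
  exact: evl_linear.
Qed.

Fact convolutionDl : left_distributive convolution +%R.
Proof. by move=> p q s; have := convolution_linearl s 1 p q; rewrite !scale1r. Qed.

Fact convolutionDr : right_distributive convolution +%R.
Proof. by move=> p q s; have := convolution_linearr p 1 q s; rewrite !scale1r. Qed.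

Fact dual_counit_neq0 : dual_counit != 0.
Proof.
apply/eqP => /(congr1 (ev^~ 1)) /eqP; rewrite /ev /= counit1 zero_lfunE.
by rewrite oner_eq0.
Qed.

HB.instance Definition _ := GRing.Zmodule_isNzRing.Build (dual H)
  convolutionA convolution1l convolution1r convolutionDl convolutionDr dual_counit_neq0.

Fact convolutionZl (c : k) p q : c *: (p * q) = c *: p * q.
Proof.
have := convolution_linearl q c p 0.
by rewrite addr0 (mul0r q : convolution 0 q = 0) addr0 => /esym.
Qed.

Fact convolutionZr (c : k) p q : c *: (p * q) = p * (c *: q).
Proof.
have := convolution_linearr p c q 0.
by rewrite addr0 (mulr0 p : convolution p 0 = 0) addr0 => /esym.
Qed.

HB.instance Definition _ := GRing.Lmodule_isLalgebra.Build k (dual H) convolutionZl.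
HB.instance Definition _ := GRing.Lalgebra_isAlgebra.Build k (dual H) convolutionZr.
HB.instance Definition _ := Algebra_isFalgebra.Build k (dual H).

Lemma ev_mul p q x : ev (p * q) x = sw x (fun a b => (ev p a * ev q b : k^o)).
Proof. exact: convolutionE. Qed.

Lemma ev1 x : ev 1 x = counit x. Proof. by []. Qed.

End Dual.

Section DualAction.

Variables (k : fieldType) (H : fdHopfAlgType k).
Implicit Types (p q : dual H) (x y h m t : H).

Local Notation S := (antipode : 'End(H)).
Local Notation eps x := (counit x : k).
Local Notation n := (\dim {:H}).
Local Notation bas := (vbasis {:H}).

Lemma coord_scalar (i : 'I_n) : scalar (coord bas i).
Proof. by move=> a x y; rewrite linearP. Qed.

Definition dual_basis (i : 'I_n) : dual H := sval (dual_exists (@coord_scalar i)).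

Lemma ev_dual_basis i x : ev (dual_basis i) x = coord bas i x.
Proof. exact: (svalP (dual_exists _)). Qed.

Lemma basis_expand x : x = \sum_i ev (dual_basis i) x *: bas`_i.
Proof.
by rewrite {1}[x](coord_vbasis (memvf x)); apply: eq_bigr => i _; rewrite ev_dual_basis.
Qed.

Lemma ev_sumr p (I : finType) (x : I -> H) : ev p (\sum_i x i) = \sum_i ev p (x i).
Proof. by rewrite /ev linear_sum. Qed.

Lemma ev_suml (I : finType) (p : I -> dual H) x : ev (\sum_i p i) x = \sum_i ev (p i) x.
Proof. exact: (linear_fun_sum (evl_linear x)). Qed.

Lemma ev_scaler p c x : ev p (c *: x) = c * ev p x.
Proof. by rewrite /ev linearZ. Qed.

Lemma ev_scalel p c x : ev (c *: p) x = c * ev p x.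
Proof. by rewrite /ev scale_lfunE. Qed.

Lemma ev0l x : ev (0 : dual H) x = 0. Proof. by rewrite /ev zero_lfunE. Qed.

Lemma ev0r p : ev p 0 = 0. Proof. by rewrite /ev linear0. Qed.

Lemma dual_expand p : p = \sum_(i < n) ev p bas`_i *: dual_basis i.
Proof.
apply: dual_ext => x; rewrite {1}[x]basis_expand ev_sumr ev_suml.
by apply: eq_bigr => i _; rewrite ev_scaler ev_scalel mulrC.
Qed.

Lemma ev_inj x : (forall p, ev p x = 0) -> x = 0.
Proof. by move=> x0; rewrite [x]basis_expand big1 // => i _; rewrite x0 scale0r. Qed.

Lemma dim_dual : \dim {:dual H} = n.
Proof. by rewrite !dimvf; exact: muln1. Qed.

(** The left action of the dual on [H], transpose of right multiplication by [p] (see [ev_hit]). *)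
Definition hit p x : H := sw x (fun a b => ev p b *: a).

Lemma hit_linearl x : linear (hit^~ x).
Proof. by rewrite /hit; linear_tac; exact: evl_linear. Qed.

Lemma hit_linearr p : linear (hit p).
Proof. by rewrite /hit; apply: (@linear_sw _ _ _ _ (fun x => x)). Qed.

Lemma hit_suml (I : finType) (p : I -> dual H) x : hit (\sum_i p i) x = \sum_i hit (p i) x.
Proof. exact: (linear_fun_sum (hit_linearl x)). Qed.

Lemma hit_scalel c p x : hit (c *: p) x = c *: hit p x.
Proof. exact: (linear_funZ (hit_linearl x)). Qed.

Lemma hit_sumr (I : finType) p (x : I -> H) : hit p (\sum_i x i) = \sum_i hit p (x i).
Proof. exact: (linear_fun_sum (hit_linearr p)). Qed.

Lemma hit_scaler c p x : hit p (c *: x) = c *: hit p x.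
Proof. exact: (linear_funZ (hit_linearr p)). Qed.

Lemma hit0r p : hit p 0 = 0.
Proof. exact: (linear_fun0 (hit_linearr p)). Qed.

Lemma hit1 x : hit 1 x = x.
Proof. exact: sw_counitr. Qed.

Lemma ev_hit p q x : ev p (hit q x) = ev (p * q) x.
Proof.
rewrite /hit (apply_sw _ _ (ev_linear p)) ev_mul.
by apply: (@eq_sw _ _ k^o) => a b; rewrite ev_scaler mulrC.
Qed.

Lemma hit_mul p q x : hit (p * q) x = hit p (hit q x).
Proof.
suff ext y : (forall s, ev s y = ev s (hit p (hit q x))) -> y = hit p (hit q x).
  by apply: ext => s; rewrite !ev_hit mulrA.
move=> yE; apply/eqP; rewrite -subr_eq0; apply/eqP/ev_inj => s.
by rewrite /ev linearB /= -![fun_of_lfun _ _]/(ev s _) yE subrr.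
Qed.

Lemma shift_scalar h p : scalar (fun x => ev p (h * x)).
Proof. by move=> a x y; rewrite mulrDr -scalerAr ev_linearr. Qed.

(** The right action of [H] on its dual, transpose of left multiplication by [h]. *)
Definition shift h p : dual H := sval (dual_exists (shift_scalar h p)).

Lemma ev_shift h p x : ev (shift h p) x = ev p (h * x).
Proof. exact: (svalP (dual_exists _)). Qed.

Lemma shift_linearl p : linear (shift^~ p).
Proof.
move=> c x y; apply: dual_ext => z; rewrite ev_linearl !ev_shift.
by rewrite mulrDl -scalerAl ev_linearr.
Qed.

Lemma shift_linearr x : linear (shift x).
Proof. by move=> c p q; apply: dual_ext => z; rewrite ev_linearl !ev_shift ev_linearl. Qed.

(** On the canonical tensor of dual bases, a linear map on one leg agrees with its transpose on the
    other. *)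
Lemma dual_basis_shift (W : lmodType k) h (Q : dual H -> H -> W) : bilinear Q ->
  \sum_i Q (shift h (dual_basis i)) bas`_i = \sum_i Q (dual_basis i) (h * bas`_i).
Proof.
case=> Ql Qr.
transitivity (\sum_i \sum_(j < n) ev (dual_basis i) (h * bas`_j) *: Q (dual_basis j) bas`_i).
  apply: eq_bigr => i _; rewrite [shift _ _]dual_expand (linear_fun_sum (Ql _)).
  by apply: eq_bigr => j _; rewrite (linear_funZ (Ql _)) ev_shift.
rewrite exchange_big; apply: eq_bigr => j _ /=.
rewrite [in RHS](basis_expand (h * bas`_j)) (linear_fun_sum (Qr _)).
by apply: eq_bigr => i _; rewrite (linear_funZ (Qr _)).
Qed.

(** The compatibility that makes [H] a Hopf module over its dual, [h] acting through [S h]. It comes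
    from inserting [h1 * S h2] in front of the factor fed to [p], then applying [sw_antipode]. *)
Lemma antipode_hit h p m :
  S h * hit p m = sw h (fun h1 h2 => hit (shift h1 p) (S h2 * m)).
Proof.
pose K g2 z := sw m (fun a b => ev p (z * b) *: (S g2 * a)).
transitivity (sw h (fun u g2 => sw u (fun h1 g1 => K g2 (h1 * S g1)))).
  rewrite -[LHS](@sw_counitlE _ _ _ _ (fun g => S g * hit p m)); last by linear_tac.
  apply: eq_sw => u g2; rewrite sw_antipoderE /K; last first.
    by linear_tac; apply: linear_comp_hom; linear_tac.
  congr (_ *: _); rewrite /hit (@apply_sw _ _ _ _ (fun z => S g2 * z)); last by linear_tac.
  by apply: eq_sw => a b; rewrite mul1r -scalerAr.
rewrite (@coassoc_sw _ _ _ _ (fun h1 g1 g2 => K g2 (h1 * S g1))); first last.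
- by rewrite /K; linear_tac; apply: linear_comp_hom; linear_tac.
- by rewrite /K; linear_tac; apply: linear_comp_hom; linear_tac.
- by rewrite /K; linear_tac.
apply: eq_sw => h1 h2; rewrite /hit sw_mul; last by split; linear_tac; exact: ev_linear.
rewrite sw_antipode; last by split; linear_tac; apply: linear_comp_hom; linear_tac.
by apply: eq_sw => g1 g2; apply: eq_sw => a b; rewrite ev_shift mulrA.
Qed.

End DualAction.

(** * Integrals and the Frobenius property *)

Section Integrals.

Variables (k : fieldType) (H : fdHopfAlgType k).
Implicit Types (p q : dual H) (x y h m t : H).

Local Notation S := (antipode : 'End(H)).
Local Notation eps x := (counit x : k).
Local Notation n := (\dim {:H}).
Local Notation bas := (vbasis {:H}).

(* For a bijective antipode this says that [t] is a left integral. *)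
Definition integral t := forall h, S h * t = eps h *: t.

Lemma hit_bilinear (F : H -> H) : linear F -> bilinear (fun p x => hit p (F x)).
Proof.
move=> F_lin; split=> [x|p]; first exact: hit_linearl.
by move=> c x y; rewrite F_lin hit_linearr.
Qed.

(* The projection of the Hopf module [H] over the dual of [H] onto its coinvariants. *)
Definition integral_proj m := \sum_i hit (dual_basis i) (S (S bas`_i) * m).

Lemma integral_proj_linear : linear integral_proj.
Proof.
apply: linear_sum_fun => i c x y.
by rewrite mulrDr -scalerAr hit_linearr.
Qed.

(** Moving [h1] across the dual bases brings [S h2] next to [S (S h1)]; together they are
    [S (S h1 * h2)], which collapses to a counit. *)
Lemma integral_projP m : integral (integral_proj m).
Proof.
move=> h; rewrite mulr_sumr; under eq_bigr do rewrite antipode_hit.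
transitivity (sw h (fun h1 h2 => \sum_i hit (shift h1 (dual_basis i)) (S h2 * (S (S bas`_i) * m)))).
  rewrite /sw exchange_big; apply: eq_bigr => a _ /=.
  rewrite exchange_big; apply: eq_bigr => b _ /=.
  by rewrite scaler_sumr.
transitivity (sw h (fun h1 h2 => \sum_i hit (dual_basis i) (S (S h1 * h2) * S (S bas`_i) * m))).
  apply: eq_sw => h1 h2.
  rewrite (@dual_basis_shift _ _ _ h1 (fun p x => hit p (S h2 * (S (S x) * m)))).
    apply: eq_bigr => i _; congr hit.
    by rewrite !antipodeM !mulrA.
  by apply: (hit_bilinear (F := fun x => S h2 * (S (S x) * m))); linear_tac.
rewrite (@sw_antipodelE _ _ _ _ (fun z => \sum_i hit (dual_basis i) (S z * S (S bas`_i) * m))).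
  by rewrite antipode1; congr (_ *: _); apply: eq_bigr => i _; rewrite mul1r.
apply: linear_sum_fun => i c x y; rewrite linearP mulrDl mulrDl.
by rewrite -!scalerAl hit_linearr.
Qed.

(** The reconstruction half of the fundamental theorem of Hopf modules: [m] is recovered from
    integrals. *)
Lemma integral_proj_reconstruct m : \sum_i hit (dual_basis i) (integral_proj (S bas`_i * m)) = m.
Proof.
(* [T y] is the sum of the [y1 * S y2], written in dual bases. *)
pose T y : H := \sum_(i < n) \sum_(j < n) ev (dual_basis i * dual_basis j) y *: (bas`_i * S bas`_j).
have TE y : T y = eps y *: 1.
  rewrite -sw_antipoder /T.
  transitivity (sw y (fun a c => \sum_(i < n) \sum_(j < n)
      (ev (dual_basis i) a * ev (dual_basis j) c) *: (bas`_i * S bas`_j))).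
    rewrite [RHS]/sw; under [RHS]eq_bigr do under eq_bigr do rewrite scaler_sumr.
    under [RHS]eq_bigr do rewrite exchange_big; rewrite [RHS]exchange_big /=.
    apply: eq_bigr => i _.
    under [RHS]eq_bigr do under eq_bigr do rewrite scaler_sumr.
    under [RHS]eq_bigr do rewrite exchange_big; rewrite [RHS]exchange_big /=.
    apply: eq_bigr => j _; rewrite ev_mul /sw scaler_suml; apply: eq_bigr => a _.
    by rewrite scaler_suml; apply: eq_bigr => b _; rewrite [RHS]scalerA.
  apply: eq_sw => a c; rewrite [in RHS](basis_expand a) [in RHS](basis_expand c).
  rewrite mulr_suml; apply: eq_bigr => i _.
  rewrite linear_sum mulr_sumr; apply: eq_bigr => j _.
  by rewrite linearZ /= -scalerAl -scalerAr scalerA.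
transitivity (\sum_l hit (dual_basis l) (S (T bas`_l) * m)); last first.
  under eq_bigr do rewrite TE linearZ /= antipode1 -scalerAl mul1r hit_scaler -hit_scalel.
  rewrite -hit_suml -[RHS]hit1; congr hit.
  by rewrite [1 in RHS]dual_expand; apply: eq_bigr => l _; rewrite ev1.
transitivity (\sum_(i < n) \sum_(j < n) hit (dual_basis i * dual_basis j) (S (bas`_i * S
  bas`_j) * m)).
  apply: eq_bigr => i _; rewrite hit_sumr; apply: eq_bigr => j _.
  by rewrite hit_mul antipodeM mulrA.
under [RHS]eq_bigr => l _.
  rewrite /T linear_sum mulr_suml hit_sumr.
  under eq_bigr => i _.
    rewrite linear_sum mulr_suml hit_sumr.
    under eq_bigr => j _ do rewrite linearZ /= -scalerAl hit_scaler -hit_scalel.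
    over.
  over.
rewrite [RHS]exchange_big; apply: eq_bigr => i _; rewrite [RHS]exchange_big.
by apply: eq_bigr => j _; rewrite {1}[dual_basis i * _]dual_expand hit_suml.
Qed.

Lemma exists_integral : exists2 t, integral t & t != 0.
Proof.
apply: NNPP => no_int; have proj0 m : integral_proj m = 0.
  apply: NNPP => /eqP m_neq0; apply: no_int.
  by exists (integral_proj m); first exact: integral_projP.
have /eqP := oner_neq0 H; apply; rewrite -[LHS]integral_proj_reconstruct.
by rewrite big1 // => i _; rewrite proj0 hit0r.
Qed.

Section NonzeroIntegral.

Variable t : H.
Hypotheses (t_int : integral t) (t_neq0 : t != 0).

Lemma shift_hit_integral h p : hit (shift h p) t = S h * hit p t.
Proof.
rewrite antipode_hit -[LHS](@sw_counitrE _ _ _ _ (fun h => hit (shift h p) t)); last first.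
  by move=> c x y; rewrite shift_linearl hit_linearl.
by apply: eq_sw => h1 h2; rewrite t_int hit_scaler.
Qed.

(** The functionals acting on [t] add up to the one sending [y] to the sum of [p (S y1 * y2)], that
    is, to [ev p 1] times the counit. *)
Lemma integral_proj_hit p : integral_proj (hit p t) = ev p 1 *: t.
Proof.
rewrite /integral_proj; under eq_bigr do rewrite -shift_hit_integral -hit_mul.
rewrite -hit_suml [X in hit X t](_ : _ = ev p 1 *: 1); first by rewrite hit_scalel hit1.
apply: dual_ext => y; rewrite ev_suml ev_scalel ev1 mulrC.
transitivity (sw y (fun a c => (ev p (S a * c) : k^o))); last first.
  by rewrite (@sw_antipodelE _ _ k^o _ (ev p)) //; exact: ev_linear.
under eq_bigr do rewrite ev_mul.
rewrite /sw exchange_big; apply: eq_bigr => a _; rewrite exchange_big.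
apply: eq_bigr => c _ /=.
transitivity ((comul y : 'M_(_, _)) a c * \sum_i (ev (dual_basis i) bas`_a *
    ev (shift (S (bas`_i)) p) bas`_c)); first by rewrite mulr_sumr.
congr (_ * _).
rewrite [in RHS](basis_expand bas`_a) linear_sum mulr_suml ev_sumr.
by apply: eq_bigr => i _; rewrite ev_shift linearZ /= -scalerAl ev_scaler.
Qed.

(** [integral_proj] recovers the value at 1 from [hit p t]; applied to [shift h p], which kills [t]
    along with [p], it recovers the value at [h]. *)
Lemma hit_integral_inj p : hit p t = 0 -> p = 0.
Proof.
move=> p0; apply: dual_ext => h; rewrite ev0l.
have /eqP := integral_proj_hit (shift h p).
rewrite shift_hit_integral p0 mulr0 ev_shift mulr1 (linear_fun0 integral_proj_linear).
by rewrite eq_sym scaler_eq0 (negPf t_neq0) orbF => /eqP.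
Qed.

Lemma antipode_inj h : S h = 0 -> h = 0.
Proof.
move=> Sh0; apply: ev_inj => p; have : shift h p = 0.
  by apply: hit_integral_inj; rewrite shift_hit_integral Sh0 mul0r.
by move/(congr1 (fun q => ev q 1)); rewrite ev_shift mulr1 ev0l.
Qed.

Lemma antipode_onto y : exists x, S x = y.
Proof.
have kerS : lker S == 0%VS.
  by rewrite -subv0; apply/subvP => x; rewrite memv_ker memv0 => /eqP/antipode_inj->.
by exists (S^-1%VF y); rewrite lker0_lfunVK.
Qed.

Lemma hit_integral_onto x : exists p, hit p t = x.
Proof.
have [L LE] := linear_pack (hit_linearl t).
have kerL : lker (linfun L) == 0%VS.
  rewrite -subv0; apply/subvP => p; rewrite memv_ker lfunE memv0 /= -LE => /eqP.
  by move/hit_integral_inj->.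
have /memv_imgP[p _ ->] : x \in limg (linfun L).
  suff -> : limg (linfun L) = fullv by rewrite memvf.
  apply/eqP; rewrite eqEdim subvf limg_dim_eq ?(eqP kerL) ?capv0 //.
  by rewrite dim_dual leqnn.
by exists p; rewrite lfunE /= -LE.
Qed.

Lemma integral_left h : h * t = eps h *: t.
Proof. by have [x <-] := antipode_onto h; rewrite t_int counit_antipode. Qed.

Lemma dual_nondeg p : (forall q, ev (p * q) t = 0) -> p = 0.
Proof.
move=> p0; apply: dual_ext => x; have [q <-] := hit_integral_onto x.
by rewrite ev_hit p0 ev0l.
Qed.

End NonzeroIntegral.

End Integrals.

(** * Maschke's theorem *)

Section Maschke.

Variables (k : fieldType) (H : fdHopfAlgType k).
Implicit Types (p q : dual H) (x y : H).

Local Notation S := (antipode : 'End(H)).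
Local Notation eps x := (counit x : k).
Local Notation n := (\dim {:H}).
Local Notation bas := (vbasis {:H}).

Variables (t : H) (s : dual H).
Hypotheses (t_int : integral t) (t_neq0 : t != 0).
Hypotheses (s_int : forall p, p * s = ev p 1 *: s) (s1_neq0 : ev s 1 != 0).

Lemma hit_dual_integral x : hit s x = ev s x *: 1.
Proof.
apply/eqP; rewrite -subr_eq0; apply/eqP/ev_inj => p.
rewrite (linear_funB (ev_linear p)) ev_hit s_int ev_scalel ev_scaler mulrC.
exact: subrr.
Qed.

(** Inserting [S x1 * x2] in front of [y1] gives [S x1] times [hit s (x2 * y)], and the latter is a
    scalar because [s] is an integral. *)
Lemma hit_shift_integral x y : hit (shift x s) y = sw x (fun a b => ev s (b * y) *: S a).
Proof.
pose K a b c := sw y (fun u v => ev s (c * v) *: (S a * (b * u))).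
have K1 b c : linear (fun a => K a b c) by rewrite /K; linear_tac.
have K2 a c : linear (fun b => K a b c) by rewrite /K; linear_tac.
have K3 a b : linear (fun c => K a b c).
  by rewrite /K; linear_tac; apply: linear_comp_hom; linear_tac.
transitivity (sw x (fun a b => sw b (fun b1 b2 => K a b1 b2))); last first.
  apply: eq_sw => a b; rewrite -[S a]mulr1 scalerAr -hit_dual_integral /hit sw_mul; last first.
    by split; linear_tac; exact: ev_linear.
  rewrite (@apply_sw _ _ _ _ (fun z => S a * z)); last by linear_tac.
  apply: eq_sw => b1 b2; rewrite (@apply_sw _ _ _ _ (fun z => S a * z)); last by linear_tac.
  by apply: eq_sw => c d; rewrite -scalerAr.
rewrite -(coassoc_sw _ K3 K2 K1) -[LHS](@sw_counitlE _ _ _ _ (fun x => hit (shift x s) y)).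
  apply: eq_sw => u b.
  pose L z := sw y (fun c d => ev s (b * d) *: (z * c)).
  have L_lin : linear L by rewrite /L; linear_tac.
  transitivity (sw u (fun a c => L (S a * c))).
    rewrite sw_antipodelE // /L /hit; congr (_ *: _); apply: eq_sw => c d.
    by rewrite ev_shift mul1r.
  by apply: eq_sw => a c; rewrite /L /K; apply: eq_sw => u' v; rewrite mulrA.
by move=> c x' y'; rewrite shift_linearl hit_linearl.
Qed.

Lemma hit_shift_at_integral x : hit (shift x s) t = ev s t *: S x.
Proof.
rewrite hit_shift_integral -[S x](@sw_counitrE _ _ _ _ (fun x => S x)); last by linear_tac.
rewrite (@apply_sw _ _ _ _ (fun z => ev s t *: z)); last by linear_tac.
apply: eq_sw => a b; rewrite (integral_left t_int t_neq0) ev_scaler scalerA.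
by rewrite [ev s t * _]mulrC.
Qed.

Lemma integrals_pairing_neq0 : ev s t != 0.
Proof.
apply: contraNneq s1_neq0 => st0; rewrite -[1]mul1r -ev_shift.
suff -> : shift 1 s = 0 by rewrite ev0l.
by apply: (hit_integral_inj t_int t_neq0); rewrite hit_shift_at_integral st0 scale0r.
Qed.

Lemma antipode_inverse : exists T : 'End(H), (forall x, S (T x) = x) /\ (forall x, T (S x) = x).
Proof.
have kerS : lker S == 0%VS.
  rewrite -subv0; apply/subvP => x; rewrite memv_ker memv0.
  by move=> /eqP/(antipode_inj t_int t_neq0)->.
by exists S^-1%VF; split=> x; rewrite ?lker0_lfunVK ?lker0_lfunK.
Qed.

(** A Casimir element: its legs are dual bases for the form given by [t], and its product is a
    nonzero scalar because [ev s 1] is nonzero. *)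
Lemma exists_separability : exists c : 'I_n -> dual H,
  (forall i, hit (c i) t = bas`_i) /\
  \sum_i c i * dual_basis i = (ev s t)^-1 * ev s 1 *: 1.
Proof.
have st_neq0 := integrals_pairing_neq0; have [T [TK KT]] := antipode_inverse.
(* By [hit_shift_at_integral], [shift x s] sends [t] to [ev s t *: S x]; the witness divides by
   [ev s t] and undoes [S]. *)
exists (fun i => (ev s t)^-1 *: shift (T bas`_i) s); split=> [i|].
  by rewrite hit_scalel hit_shift_at_integral scalerA mulVf // scale1r TK.
apply: dual_ext => y; rewrite ev_suml ev_scalel ev1 -mulrA.
transitivity (\sum_(i < n) (ev s t)^-1 * ev (shift (T bas`_i) s * dual_basis i) y).
  by apply: eq_bigr => i _; rewrite -scalerAl ev_scalel.
rewrite -mulr_sumr; congr (_ * _).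
transitivity (sw y (fun a b => ev s (T b * a) : k^o)).
  under eq_bigr do rewrite ev_mul.
  rewrite /sw exchange_big; apply: eq_bigr => a _; rewrite exchange_big.
  apply: eq_bigr => b _ /=.
  transitivity ((comul y : 'M_(_, _)) a b * \sum_(i < n)
      (ev (shift (T bas`_i) s) bas`_a * ev (dual_basis i) bas`_b)); first by rewrite mulr_sumr.
  congr (_ * _); rewrite [in RHS](basis_expand bas`_b) linear_sum mulr_suml ev_sumr.
  by apply: eq_bigr => i _; rewrite ev_shift linearZ /= -scalerAl ev_scaler mulrC.
rewrite -(@apply_sw _ _ _ k^o (ev s)); last exact: ev_linear.
rewrite (_ : sw _ _ = eps y *: 1); first by rewrite ev_scaler mulrC.
rewrite -[LHS]KT linear_of_sw /= (_ : sw _ _ = eps y *: 1).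
  by rewrite linearZ /= -[X in T X]antipode1 KT.
rewrite -sw_antipodel; apply: eq_sw => a b.
by rewrite antipodeM TK.
Qed.

(** Maschke averaging: the linear projection onto [K], averaged over the Casimir element, becomes
    left linear and is multiplication by [z] on [K]. The image of 1, divided by [z], is the right
    unit. *)
Lemma left_ideal_unit (K : {vspace dual H}) : (forall p q, q \in K -> p * q \in K) ->
  exists2 f, f \in K & forall a, a \in K -> a * f = a.
Proof.
move=> idK; have [c [ct cas]] := exists_separability.
set z := _^-1 * _ in cas; have z_neq0 : z != 0.
  by rewrite mulf_neq0 // invr_eq0 integrals_pairing_neq0.
have expand_c q : q = \sum_i ev (dual_basis i * q) t *: c i.
  apply/eqP; rewrite -subr_eq0; apply/eqP/(hit_integral_inj t_int t_neq0).
  rewrite (linear_funB (hit_linearl t)) hit_suml.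
  under eq_bigr do rewrite hit_scalel ct -ev_hit.
  by rewrite -basis_expand subrr.
have expand_b q : q = \sum_i ev (q * c i) t *: dual_basis i.
  by rewrite {1}[q]dual_expand; apply: eq_bigr => i _; rewrite -ev_hit ct.
pose P a := \sum_i c i * projv K (dual_basis i * a).
have PM p a : P (p * a) = p * P a.
  rewrite /P; transitivity (\sum_i \sum_l ev (dual_basis i * p * c l) t *:
                              (c i * projv K (dual_basis l * a))).
    apply: eq_bigr => i _; rewrite mulrA [dual_basis i * p]expand_b.
    rewrite mulr_suml linear_sum mulr_sumr; apply: eq_bigr => l _.
    by rewrite -scalerAl linearZ /= -scalerAr -expand_b.
  rewrite exchange_big mulr_sumr; apply: eq_bigr => l _ /=.
  rewrite mulrA [in RHS](expand_c (p * c l)) mulr_suml; apply: eq_bigr => i _.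
  by rewrite mulrA -scalerAl.
have PK a : a \in K -> P a = z *: a.
  move=> Ka; rewrite -[a in RHS]mul1r scalerAl -cas mulr_suml.
  by apply: eq_bigr => i _; rewrite projv_id ?idK // mulrA.
exists (z^-1 *: P 1) => [|a Ka].
  by rewrite memvZ // memv_suml // => i _; rewrite idK // memv_proj.
by rewrite -scalerAr -PM mulr1 PK // scalerA mulVf // scale1r.
Qed.

End Maschke.

(** * Subcoalgebras and ideals of the dual *)

Section Subcoalgebras.

Variables (k : fieldType) (H : fdHopfAlgType k).
Implicit Types (p q : dual H) (x y : H) (D E : {vspace H}) (m : {vspace dual H}).

Local Notation n := (\dim {:H}).
Local Notation bas := (vbasis {:H}).

Definition hitl p x : H := sw x (fun a b => ev p a *: b).

Lemma ev_hitl p q x : ev p (hitl q x) = ev (q * p) x.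
Proof.
rewrite /hitl (apply_sw _ _ (ev_linear p)) ev_mul.
by apply: (@eq_sw _ _ k^o) => a b; rewrite ev_scaler.
Qed.

Lemma sw_hit (W : lmodType k) x (F : H -> H -> W) : bilinear F ->
  sw x F = \sum_(i < n) F (hit (dual_basis i) x) bas`_i.
Proof.
case=> Fl Fr; transitivity (sw x (fun a b => \sum_(i < n) ev (dual_basis i) b *: F a bas`_i)).
  apply: eq_sw => a b; rewrite [b in LHS]basis_expand (linear_fun_sum (Fr a)).
  by apply: eq_bigr => i _; rewrite (linear_funZ (Fr a)).
rewrite /sw; under eq_bigr do under eq_bigr do rewrite scaler_sumr.
under eq_bigr do rewrite exchange_big; rewrite exchange_big /=; apply: eq_bigr => i _.
rewrite /hit /sw (linear_fun_sum (Fl _)); apply: eq_bigr => a _.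
rewrite (linear_fun_sum (Fl _)); apply: eq_bigr => b _.
by rewrite !(linear_funZ (Fl _)).
Qed.

Lemma sw_hitl (W : lmodType k) x (F : H -> H -> W) : bilinear F ->
  sw x F = \sum_(i < n) F bas`_i (hitl (dual_basis i) x).
Proof.
case=> Fl Fr; transitivity (sw x (fun a b => \sum_(i < n) ev (dual_basis i) a *: F bas`_i b)).
  apply: eq_sw => a b; rewrite [a in LHS]basis_expand (linear_fun_sum (Fl b)).
  by apply: eq_bigr => i _; rewrite (linear_funZ (Fl b)).
rewrite /sw; under eq_bigr do under eq_bigr do rewrite scaler_sumr.
under eq_bigr do rewrite exchange_big; rewrite exchange_big /=; apply: eq_bigr => i _.
rewrite /hitl /sw (linear_fun_sum (Fr _)); apply: eq_bigr => a _.
rewrite (linear_fun_sum (Fr _)); apply: eq_bigr => b _.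
by rewrite !(linear_funZ (Fr _)).
Qed.

Lemma tensorv_pure D u v : u \in D -> v \in D -> u \ox v \in tensorv D D.
Proof.
move=> Du Dv; rewrite (coord_vbasis Du) (coord_vbasis Dv).
rewrite (linear_fun_sum (@tensor_pure_linearl _ _ _ _)); apply: memv_suml => i _.
rewrite (linear_funZ (@tensor_pure_linearl _ _ _ _)) memvZ //.
rewrite (linear_fun_sum (@tensor_pure_linearr _ _ _ _)); apply: memv_suml => j _.
rewrite (linear_funZ (@tensor_pure_linearr _ _ _ _)) memvZ // memv_span //.
by apply/allpairsP; exists ((vbasis D)`_i, (vbasis D)`_j); rewrite !mem_nth ?size_tuple.
Qed.

(** Once the left legs of the coproduct are known to lie in [D], they may be projected onto [D]
    before the tensor is expanded again with right legs in [D]. *)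
Lemma sub_bicomodule_subcoalgebra D :
    (forall p x, x \in D -> hit p x \in D) -> (forall p x, x \in D -> hitl p x \in D) ->
  subcoalgebra D.
Proof.
move=> hitD hitlD; apply/subvP => _ /memv_imgP[x Dx ->].
rewrite [comul x]tensor_pure_span -[X in X \in _]/(sw x (fun a b => a \ox b)).
have pure_bil (f g : H -> H) : linear f -> linear g ->
    bilinear (fun a b => f a \ox g b : tensor H H).
  move=> f_lin g_lin; split=> [v c u u' | u c v v'].
    by rewrite f_lin tensor_pure_linearl.
  by rewrite g_lin tensor_pure_linearr.
have proj_lin : linear (projv D) by move=> c u v; rewrite linearP.
rewrite (sw_hit _ (pure_bil _ _ (@linear_id _ _) (@linear_id _ _))).
under eq_bigr => i _ do rewrite -[hit _ x](@projv_id _ _ D) ?hitD //.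
rewrite -(sw_hit _ (pure_bil _ _ proj_lin (@linear_id _ _))).
rewrite (sw_hitl _ (pure_bil _ _ proj_lin (@linear_id _ _))).
by apply: memv_suml => i _; rewrite tensorv_pure ?memv_proj ?hitlD.
Qed.

Lemma tensorv_map D (L : 'Hom(tensor H H, H)) z :
  (forall u v, u \in D -> v \in D -> L (u \ox v) \in D) -> z \in tensorv D D -> L z \in D.
Proof.
move=> LD; suff /subvP sub : (tensorv D D <= L @^-1: D)%VS by move/sub; rewrite -memv_preim.
apply/span_subvP => _ /allpairsP[[u v] /= [Du Dv ->]].
by rewrite -memv_preim LD // vbasis_mem.
Qed.

Lemma subcoalgebra_hit D p x : subcoalgebra D -> x \in D -> hit p x \in D.
Proof.
move=> subD Dx; rewrite /hit sw_lift; apply: tensorv_map => [u v Du Dv|]; last first.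
  by apply: (subvP subD); rewrite memv_img.
by rewrite tensor_lift_pure ?memvZ // => *; linear_tac; exact: ev_linear.
Qed.

Lemma subcoalgebra_hitl D p x : subcoalgebra D -> x \in D -> hitl p x \in D.
Proof.
move=> subD Dx; rewrite /hitl sw_lift; apply: tensorv_map => [u v Du Dv|]; last first.
  by apply: (subvP subD); rewrite memv_img.
by rewrite tensor_lift_pure ?memvZ // => *; linear_tac; exact: ev_linear.
Qed.

Lemma ev_nondegl p : (forall x, ev p x = 0) -> p = 0.
Proof. by move=> p0; apply: dual_ext => x; rewrite p0 ev0l. Qed.

(** Orthogonality sends a subcoalgebra inside [D] to an ideal containing [m]; maximality leaves only
    [m] and the whole algebra. *)
Lemma maximal_ideal_simple_subcoalgebra m D : maximal_ideal m ->
  (forall x, x \in D <-> {in m, forall p, ev p x = 0}) -> simple_subcoalgebra D.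
Proof.
move=> [idm m1 maxm] DE.
have mE p : p \in m <-> {in D, forall x, ev p x = 0}.
  by apply: double_perp DE p => //;
    [exact: ev_linearl | exact: ev_linearr | exact: ev_nondegl | exact: dim_dual].
split.
- apply: sub_bicomodule_subcoalgebra => p x /DE x0; apply/DE => q mq.
    by rewrite ev_hit x0 // ideal_mulr.
  by rewrite ev_hitl x0 // ideal_mull.
- apply: contraNneq m1 => D0; apply/mE => x.
  by rewrite D0 memv0 => /eqP->; rewrite ev0r.
move=> E subE sED.
have [I IE] := @perp_exists _ _ _ (fun (x : H) (p : dual H) => ev p x) (@ev_linearl _ H) E.
have idI : ideal I.
  move=> a p b /IE p0; apply/IE => x Ex.
  by rewrite -ev_hit -ev_hitl p0 // subcoalgebra_hitl // subcoalgebra_hit.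
have smI : (m <= I)%VS.
  by apply/subvP => p /mE p0; apply/IE => x Ex; rewrite p0 // (subvP sED).
have EE x : x \in E <-> {in I, forall p, ev p x = 0}.
  by apply: (double_perp (beta := fun (x : H) (p : dual H) => ev p x)) IE x => //;
     [exact: ev_linearr | exact: ev_linearl | exact: ev_inj | rewrite dim_dual].
have [I1 | I1] := boolP (1 \in I); [left | right].
  apply/eqP; rewrite -subv0; apply/subvP => x /EE x0; rewrite memv0; apply/eqP/ev_inj => p.
  by rewrite x0 // (ideal1 idI I1) memvf.
by apply/vspaceP => x; apply/idP/idP => [/(subvP sED)//|/DE]; rewrite -(maxm I) // => /EE.
Qed.

End Subcoalgebras.

(** Otherwise the right ideal [f A] would have a simple quotient annihilated by [f], although [f]
    fixes its generator. *)
Lemma no_idempotent_in_radical (k : closedFieldType) (A : falgType k) (f : A) :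
  f * f = f -> (forall m, maximal_ideal m -> f \in m) -> f = 0.
Proof.
move=> ff fm; apply: NNPP => /eqP f_neq0.
have [R RE] : exists R : {vspace A}, forall y, y \in R <-> exists a, y = f * a.
  apply: vspace_comprehension => [|c _ _ [a ->] [b ->]].
    by exists 0; rewrite mulr0.
  by exists (c *: a + b); rewrite mulrDr scalerAr.
have stR : stable (fun a y : A => y * a) R.
  by move=> a _ /RE[b ->]; apply/RE; exists (b * a); rewrite mulrA.
have Rf : f \in R by apply/RE; exists 1; rewrite mulr1.
have [|N' [I [d [stN' sN'R maxI IE [dimR d_gt0 _]]]]] := simple_section (right_action A) stR.
  by apply: contraNneq f_neq0 => R0; rewrite -memv0 -R0.
have N'f : f \in N' by have := proj1 (IE f) (fm I maxI) f Rf; rewrite ff.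
have : (R <= N')%VS by apply/subvP => _ /RE[a ->]; apply: stN'.
by move/dimvS; rewrite dimR leqNgt -[X in (X < _)%N]addn0 ltn_add2l d_gt0.
Qed.

(** The right unit [f] of the radical [J] is an idempotent of [J], so [f] and then [J] are 0. The
    annihilator of the sum of the simple subcoalgebras lies in [J], hence this sum is [H]. *)
Lemma integral_cosemisimple (k : closedFieldType) (H : fdHopfAlgType k) (s : dual H) :
  (forall p, p * s = ev p 1 *: s) -> ev s 1 != 0 -> cosemisimple H.
Proof.
move=> s_int s1_neq0; have [t t_int t_neq0] := exists_integral H.
have [ms uniq_ms msE] := exists_maximal_ideals (dual H).
have [J JE] : exists J : {vspace dual H}, forall p, p \in J <-> forall m,
  maximal_ideal m -> p \in m.
  apply: vspace_comprehension => [m _|c p q pm qm m maxm]; first exact: mem0v.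
  by rewrite memvD ?memvZ ?pm ?qm.
have [f Jf fE] : exists2 f, f \in J & forall a, a \in J -> a * f = a.
  apply: (left_ideal_unit t_int t_neq0 s_int s1_neq0) => p q /JE qm; apply/JE => m maxm.
  by have [idm _ _] := maxm; apply: ideal_mull (qm m maxm).
have J0 (p : dual H) : (forall m : {vspace dual H}, maximal_ideal m -> p \in m) -> p = 0.
  move=> pm; have Jp : p \in J by apply/JE.
  rewrite -(fE p Jp) [f]no_idempotent_in_radical ?mulr0 ?fE //.
  exact/JE.
have /functional_choice[D DE] (m : {vspace dual H}) :=
  @perp_exists _ _ _ (@ev k H) (@ev_linearr k H) m.
move=> x; exists [seq D m | m <- ms] => [_ /mapP[m /msE maxm ->]|].
  exact: maximal_ideal_simple_subcoalgebra maxm (DE m).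
rewrite big_map; set W := (\sum_(m <- ms) D m)%VS.
suff -> : W = fullv by rewrite memvf.
have [I IE] := @perp_exists _ _ _ (fun (x : H) (p : dual H) => ev p x) (@ev_linearl _ H) W.
have := dim_perp (@ev_linearr k H) (@ev_linearl k H) (@ev_inj k H) IE.
suff -> : I = 0%VS.
  by rewrite dimv0 addn0 dim_dual => dimW; apply/eqP; rewrite eqEdim subvf dimW leqnn.
apply/eqP; rewrite -subv0; apply/subvP => p /IE p0; rewrite memv0; apply/eqP/J0 => m maxm.
apply/(double_perp (beta := @ev k H) (W := m) (W' := D m)) => //.
- exact: ev_linearl.
- exact: ev_linearr.
- exact: ev_nondegl.
- exact: dim_dual.
move=> y Dy; apply: p0; apply: (subvP _ y Dy).
have /msE m_ms := maxm; rewrite /W (big_rem m) //=; exact: addvSl.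
Qed.

(** * Traces of matrices of finite order *)

Lemma pchar0_intr_eq0 (k : fieldType) (a : int) : [pchar k] =i pred0 ->
  (a%:~R == 0 :> k) = (a == 0).
Proof.
move=> char0; case: a => a; first exact: pchar0_natr_eq0.
by rewrite NegzE mulrNz !oppr_eq0; apply: pchar0_natr_eq0.
Qed.

(* A relation between roots of unity transfers to the algebraic complex numbers,
   where the triangle inequality is available. *)
Lemma sum_root_unity_lt (k : fieldType) (z : k) (es : seq nat) (e m : nat) :
    [pchar k] =i pred0 -> e \in es -> (0 < m)%N ->
  \sum_(l < m) z ^+ (e * l) = 0 -> \sum_(i <- es) z ^+ i != (size es)%:R.
Proof.
move=> char0 es_e m_gt0 zm0; apply/eqP => zs.
pose P : {poly int} := \sum_(i <- es) 'X^i - (size es)%:R%:P.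
pose Q : {poly int} := \sum_(l < m) 'X^(e * l).
have PE (R : comNzRingType) (w : R) :
    (map_poly intr P).[w] = \sum_(i <- es) w ^+ i - (size es)%:R.
  rewrite rmorphB rmorph_sum /= map_polyC /= hornerD hornerN hornerC horner_sum.
  rewrite rmorph_nat; congr (_ - _); apply: eq_bigr => i _.
  by rewrite map_polyXn hornerXn.
have QE (R : comNzRingType) (w : R) : (map_poly intr Q).[w] = \sum_(l < m) w ^+ (e * l).
  rewrite rmorph_sum /= horner_sum; apply: eq_bigr => i _.
  by rewrite map_polyXn hornerXn.
(* At a common complex root [w], [Q] makes [w ^+ e] a root of unity other than 1, so [w] has
   absolute value 1; [P] then asks for equality in the triangle inequality, which forces every term
   to be 1. *)
have coPQ : coprimep (map_poly intr P) (map_poly intr Q : {poly rat}).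
  apply: contraT => ncop.
  have mapQ (F : {poly int}) : map_poly (ratr : rat -> algC) (map_poly intr F) = map_poly intr F.
    by rewrite -map_poly_comp; apply: eq_map_poly => a /=; rewrite ratr_int.
  have : ~~ coprimep (map_poly intr P) (map_poly intr Q : {poly algC}).
    by rewrite -!mapQ coprimep_map.
  rewrite /coprimep => /closed_rootP[w]; rewrite root_gcd !rootE PE QE subr_eq0.
  move=> /andP[/eqP wP /eqP wQ].
  have wem : (w ^+ e) ^+ m = 1.
    apply/eqP; rewrite -subr_eq0 subrX1.
    by under eq_bigr do rewrite -exprM; rewrite wQ mulr0.
  have we1 : w ^+ e != 1.
    apply: contraTneq isT => we1; move/eqP: wQ.
    under eq_bigr do rewrite exprM we1 expr1n.
    by rewrite sumr_const card_ord Num.Theory.pnatr_eq0 eqn0Ngt m_gt0.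
  have e_gt0 : (0 < e)%N by case: (e) we1 => //; rewrite expr0 eqxx.
  have w_norm : `|w| = 1.
    apply/eqP; rewrite -(@Num.Theory.pexpr_eq1 _ _ (e * m)) ?Num.Theory.normr_ge0 ?muln_gt0
      ?e_gt0 //.
    by rewrite -Num.Theory.normrX exprM wem Num.Theory.normr1.
  have [i eE] := tnthP (in_tuple es) e es_e; case/eqP: we1; rewrite eE.
  apply: (@Num.Theory.normC_sum_upper _ _ xpredT (fun i => w ^+ tnth (in_tuple es) i)
    (fun=> 1)) => // [j _|].
    by rewrite Num.Theory.normrX w_norm expr1n.
  by rewrite -(big_tnth _ _ es xpredT (fun i => w ^+ i)) wP sumr_const card_ord.
have /Bezout_eq1_coprimepP[[u v] /= uv1] := coPQ.
have [[u' [a a_neq0 uE]] [v' [b b_neq0 vE]]] := (rat_poly_scale u, rat_poly_scale v).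
(* Clearing denominators in the Bezout relation allows evaluation at [z] in [k], where [a * b]
   remains nonzero in characteristic 0. *)
have PQ : b%:P * u' * P + a%:P * v' * Q = (a * b)%:P.
  apply: (@map_inj_poly _ _ (intr : int -> rat)) => //; first exact: intr_inj.
  rewrite !rmorphD !rmorphM /= !map_polyC /= -[RHS]mulr1 -uv1 uE vE -!mul_polyC.
  have aV : (a%:~R : rat)%:P * (a%:~R^-1)%:P = 1.
    by rewrite -polyCM mulfV ?intr_eq0.
  have bV : (b%:~R : rat)%:P * (b%:~R^-1)%:P = 1.
    by rewrite -polyCM mulfV ?intr_eq0.
  rewrite mulrDr.
  rewrite (_ : _ * (_ * _ * map_poly intr P) =
    (a%:~R : rat)%:P * (a%:~R^-1)%:P * ((b%:~R)%:P * map_poly intr u' * map_poly intr P));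
      last by ring.
  rewrite (_ : _ * (_ * _ * map_poly intr Q) =
    (b%:~R : rat)%:P * (b%:~R^-1)%:P * ((a%:~R)%:P * map_poly intr v' * map_poly intr Q));
      last by ring.
  by rewrite aV bV !mul1r.
have := congr1 (fun F => (map_poly (intr : int -> k) F).[z]) PQ.
rewrite /= !rmorphD !rmorphM /= !map_polyC /= !hornerE PE QE zm0 zs subrr !mulr0 addr0.
move/esym/eqP; rewrite -?rmorphM pchar0_intr_eq0 // mulf_eq0.
by rewrite (negPf a_neq0) (negPf b_neq0).
Qed.

(** The eigenvalues are powers of one primitive [m]-th root of unity and are not all 1, so
    [sum_root_unity_lt] applies to their sum. *)
Lemma finite_order_trace (k : closedFieldType) n (X : 'M[k]_n.+1) (m : nat) :
    [pchar k] =i pred0 -> (0 < m)%N -> X ^+ m = 1 -> X != 1 -> \tr X != n.+1%:R.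
Proof.
move=> char0 m_gt0 Xm X1.
have [z prim_z] : exists z : k, m.-primitive_root z.
  have [rs rsE] := closed_field_poly_normal ('X^m - 1 : {poly k}).
  rewrite (monicP (monicXnsubC 1 m_gt0)) scale1r in rsE.
  have /hasP[z _ prim_z] : has m.-primitive_root rs; last by exists z.
  apply: has_prim_root => //.
  - by apply/allP => z rs_z; rewrite /root_of_unity rsE root_prod_XsubC.
  - rewrite -separable_prod_XsubC -rsE separable_Xn_sub_1 //.
    by rewrite pchar0_natr_eq0 // -lt0n.
  by rewrite -ltnS -(size_prod_XsubC _ id) -rsE size_XnsubC.
have eig_root c : eigenvalue X c -> c ^+ m = 1.
  case/eigenvalueP=> v vX v_neq0.
  have vXi i : v *m X ^+ i = c ^+ i *: v.
    elim: i => [|i IH]; first by rewrite expr0 mulmx1 scale1r.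
    by rewrite exprSr mulmxA IH -scalemxAl vX scalerA exprSr.
  have := vXi m; rewrite Xm mulmx1 => /eqP; rewrite -{1}[v]scale1r -subr_eq0 -scalerBl.
  by rewrite scaler_eq0 (negPf v_neq0) orbF subr_eq0 eq_sym => /eqP.
have [rs rsE] := closed_field_poly_normal (char_poly X).
rewrite (monicP (char_poly_monic X)) scale1r in rsE.
have sz_rs : size rs = n.+1.
  by apply: succn_inj; rewrite -(size_prod_XsubC _ id) -rsE size_char_poly.
have trE : \tr X = \sum_(c <- rs) c.
  apply: oppr_inj; rewrite -char_poly_trace // rsE -coefPn_prod_XsubC ?sz_rs //.
have eig_rs c : c \in rs = eigenvalue X c.
  by rewrite eigenvalue_root_char rsE root_prod_XsubC.
have /functional_choice[f fE] (c : k) : exists i : nat, eigenvalue X c -> c = z ^+ i.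
  have [ec | ] := boolP (eigenvalue X c); last by exists 0%N.
  by have [i ->] := prim_rootP prim_z (eig_root c ec); exists i.
pose es := [seq f c | c <- rs].
have sz_es : size es = n.+1 by rewrite size_map.
(* If 1 were the only eigenvalue, the factors of [X ^+ m - 1] other than [X - 1] would be invertible
   and [X] would be 1. *)
have [c rs_c c1] : exists2 c, c \in rs & c != 1.
  apply: NNPP => no_c; case/eqP: X1.
  case: m m_gt0 prim_z {fE Xm eig_root} (factor_Xn_sub_1 prim_z) Xm => // m _ prim_z factor Xm.
  have : horner_mx X ('X^(m.+1) - 1) = 0.
    by rewrite rmorphB rmorphXn /= horner_mx_X rmorph1 Xm subrr.
  rewrite -factor big_nat_recl // rmorphM rmorphB /= horner_mx_X horner_mx_C expr0.
  set Y := horner_mx X _ => XY0.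
  have Y_unit : Y \is a GRing.unit.
    rewrite /Y rmorph_prod big_nat; apply: (big_ind (fun Z => Z \is a GRing.unit)).
    - exact: unitr1.
    - by move=> Z1 Z2 Z1u Z2u; rewrite unitrMl.
    move=> i lt_im; rewrite rmorphB /= horner_mx_X horner_mx_C.
    change (X - (z ^+ i.+1)%:M \in unitmx); rewrite -row_free_unit -kermx_eq0.
    apply: contraT => ker_neq0; case: no_c; exists (z ^+ i.+1); first by rewrite eig_rs.
    by rewrite -(prim_order_dvd prim_z) gtnNdvd.
  apply/eqP; rewrite -subr_eq0; apply/eqP/(mulIr Y_unit).
  by rewrite mul0r -[1]/(1%:M).
have z_es : z ^+ f c \in rs by rewrite -fE ?eig_rs // -eig_rs.
have zc : \sum_(l < m) z ^+ (f c * l) = 0.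
  have := subrX1 c m; rewrite eig_root -?eig_rs // subrr => /esym/eqP.
  rewrite mulf_eq0 subr_eq0 (negPf c1) /= => /eqP cs0.
  by rewrite -[RHS]cs0; apply: eq_bigr => l _; rewrite exprM -fE // -eig_rs.
have := sum_root_unity_lt char0 (map_f f rs_c) m_gt0 zc.
rewrite -/es sz_es trE /es big_map big_seq [X in _ -> X != _]big_seq.
by under eq_bigr => c' rs_c' do rewrite -fE -?eig_rs //.
Qed.

Lemma finite_order_mxtrace (k : closedFieldType) n (X : 'M[k]_n) (m : nat) :
    [pchar k] =i pred0 -> (0 < m)%N -> iter m (mulmx X) 1%:M = 1%:M -> X != 1%:M ->
  \tr X != n%:R.
Proof.
case: n X => [|n] X char0 m_gt0 Xm X1; first by rewrite [X]flatmx0 [1%:M]flatmx0 eqxx in X1.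
apply: (@finite_order_trace _ _ _ m) => //.
rewrite -[RHS]Xm; elim: (m) => [|i IH]; first by rewrite expr0.
by rewrite exprS IH.
Qed.

(** A rank factorisation [X = C *m R] of an idempotent has [R *m C] equal to the identity of size
    the rank. *)
Lemma mxtrace_idempotent (k : fieldType) n (X : 'M[k]_n) :
  X *m X = X -> \tr X = (\rank X)%:R.
Proof.
move=> XX; move: (row_base X) (col_base X) (row_base_free X) (col_base_full X) (mulmx_base X).
move=> R C freeR fullC XE; rewrite -{1}XE mxtrace_mulC.
suff -> : R *m C = 1%:M by rewrite mxtrace1.
apply: (row_free_inj freeR); apply: (row_full_inj fullC).
by rewrite /= mul1mx !mulmxA XE -mulmxA XE.
Qed.


(** * Grouplike elements as characters of the convolution algebra *)

Section GroupLikes.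

Variables (k : fieldType) (H : fdHopfAlgType k).
Implicit Types (p q : dual H) (x y g h : H).

Local Notation S := (antipode : 'End(H)).
Local Notation n := (\dim {:H}).
Local Notation bas := (vbasis {:H}).

Lemma ev_subl p q x : ev (p - q) x = ev p x - ev q x.
Proof. exact: (linear_funB (evl_linear x) p q). Qed.

Lemma grouplike_comul g : grouplike H g -> comul g = g \ox g.
Proof. by case/andP=> _ /eqP. Qed.

Lemma sw_grouplike (W : vectType k) g (F : H -> H -> W) :
  grouplike H g -> bilinear F -> sw g F = F g g.
Proof. by move=> /grouplike_comul g2 /sw_comul; apply. Qed.

Lemma ev_grouplikeM p q g : grouplike H g -> ev (p * q) g = ev p g * ev q g.
Proof.
move=> gg; rewrite ev_mul (sw_grouplike (W := k^o)) //.
by split; linear_tac; exact: ev_linear.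
Qed.

Lemma counit_grouplike g : grouplike H g -> counit g = 1.
Proof.
move=> gg; have := sw_counitl g; rewrite sw_grouplike //; last first.
  by split; linear_tac.
have /andP[g_neq0 _] := gg => gE; apply/eqP; rewrite -subr_eq0.
have : ((counit g : k) - 1) *: g == 0 by rewrite scalerBl scale1r gE subrr.
by rewrite scaler_eq0 (negPf g_neq0) orbF.
Qed.

Lemma antipode_grouplike g : grouplike H g -> S g * g = 1 /\ g * S g = 1.
Proof.
move=> gg; have := sw_antipodel g; have := sw_antipoder g.
rewrite !sw_grouplike // ?counit_grouplike ?scale1r //; by split; linear_tac.
Qed.

Lemma grouplike1 : grouplike H 1.
Proof. by rewrite /grouplike inE oner_eq0 comul1 eqxx. Qed.

Lemma grouplike_mulI g : grouplike H g -> injective ( *%R g).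
Proof.
move=> /antipode_grouplike[Sg _] x y /(congr1 ( *%R (S g))).
by rewrite !mulrA Sg !mul1r.
Qed.

Lemma grouplikeM g h : grouplike H g -> grouplike H h -> grouplike H (g * h).
Proof.
move=> gg gh; rewrite /grouplike inE comulM !grouplike_comul // tensor_mul_pure eqxx andbT.
have /andP[h_neq0 _] := gh; apply: contra h_neq0 => /eqP gh0; apply/eqP.
by apply: (grouplike_mulI gg); rewrite gh0 mulr0.
Qed.

Lemma sw_grouplike_mull (W : vectType k) g x (F : H -> H -> W) :
  grouplike H g -> bilinear F -> sw (g * x) F = sw x (fun a b => F (g * a) (g * b)).
Proof.
move=> gg F_bil; rewrite sw_mul //.
by apply: (sw_grouplike gg (F := fun a b => sw x (fun c d => F (a * c) (b * d)))); split;
  linear_tac.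
Qed.

Lemma shift_automorphism g : grouplike H g -> algebra_automorphism (shift g).
Proof.
move=> gg; apply: injective_automorphism; first exact: shift_linearr.
- move=> p q; apply: dual_ext => x; rewrite ev_shift !ev_mul.
  rewrite (sw_grouplike_mull (W := k^o)) //; last by split; linear_tac; exact: ev_linear.
  by apply: (@eq_sw _ _ k^o) => a b; rewrite !ev_shift.
- by apply: dual_ext => x; rewrite ev_shift !ev1 counitM (counit_grouplike gg) mul1r.
move=> p q pq; apply: dual_ext => x; have [_ gS] := antipode_grouplike gg.
by have := congr1 (fun s => ev s (S g * x)) pq; rewrite !ev_shift mulrA gS mul1r.
Qed.

Lemma grouplike_ext g h : (forall p, ev p g = ev p h) -> g = h.
Proof.
move=> gh; apply/eqP; rewrite -subr_eq0; apply/eqP/ev_inj => p.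
by rewrite (linear_funB (ev_linear p)) gh; apply: subrr.
Qed.

Lemma codim1_maximal (A : falgType k) (I : {vspace A}) :
  ideal I -> 1 \notin I -> \dim {:A} = (\dim I).+1 -> maximal_ideal I.
Proof.
move=> idI I1 dimI; split=> // K idK sIK K1; apply/eqP; rewrite eq_sym eqEdim sIK /=.
rewrite -ltnS -dimI ltn_neqAle dimvS ?subvf // andbT; apply: contra K1 => /eqP dimK.
suff /eqP-> : K == fullv by rewrite memvf.
by rewrite eqEdim subvf dimK leqnn.
Qed.

Lemma exists_grouplike_ideal g : grouplike H g -> exists2 m : {vspace dual H},
  forall p, p \in m <-> ev p g = 0 & maximal_ideal m /\ \dim {:dual H} = (\dim m + 1)%N.
Proof.
move=> gg; have [g_neq0 _] := andP gg.
have [m mE] := @perp_exists _ _ _ (fun x p => ev p x) (@ev_linearl k H) <[g]>%VS.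
have mP p : p \in m <-> ev p g = 0.
  split=> [/mE|g0]; first by apply; apply: memv_line.
  by apply/mE => _ /vlineP[c ->]; rewrite ev_scaler g0 mulr0.
have dimm : \dim {:dual H} = (\dim m + 1)%N.
  have := dim_perp (@ev_linearr k H) (@ev_linearl k H) (@ev_inj k H) mE.
  by rewrite dim_vline g_neq0 addnC.
exists m; first exact: mP.
split=> //; apply: codim1_maximal; last by rewrite dimm addn1.
  move=> p q s /mP q0; apply/mP.
  by rewrite !ev_grouplikeM // q0 mulr0 mul0r.
by apply/negP => /mP; rewrite ev1 counit_grouplike // => /eqP; rewrite oner_eq0.
Qed.

(** The orthogonal of [m] is a line. Its generator [g], normalised to counit 1, evaluates products
    multiplicatively because [q - ev q g *: 1] always lies in [m]. *)
Lemma codim1_grouplike (m : {vspace dual H}) : ideal m -> 1 \notin m ->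
    \dim {:dual H} = (\dim m + 1)%N ->
  exists2 g, grouplike H g & forall p, p \in m <-> ev p g = 0.
Proof.
move=> idm m1 dimm.
have [D DE] := perp_exists (@ev_linearr k H) m.
have mE p : p \in m <-> {in D, forall x, ev p x = 0}.
  by apply: double_perp DE p => //;
    [exact: ev_linearl | exact: ev_linearr | exact: ev_nondegl | exact: dim_dual].
have dimD : \dim D = 1%N.
  have := dim_perp (@ev_linearl k H) (@ev_linearr k H) (@ev_nondegl k H) DE.
  by rewrite -dim_dual dimm => /addnI.
pose x := vpick D; have Dx : x \in D := memv_pick D.
have x_neq0 : x != 0 by rewrite vpick0 -dimv_eq0 dimD.
have Dline : D = <[x]>%VS.
  by apply/eqP; rewrite eq_sym eqEdim -memvE Dx dim_vline x_neq0 dimD.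
have mP p : p \in m <-> ev p x = 0.
  split=> [/mE|x0]; first exact.
  by apply/mE => y; rewrite Dline => /vlineP[c ->]; rewrite ev_scaler x0 mulr0.
have ex_neq0 : counit x != 0 by apply: contra m1 => /eqP x0; apply/mP.
have [g gE] : exists g : H, g = (counit x : k)^-1 *: x by eexists.
have gP p : p \in m <-> ev p g = 0.
  rewrite gE ev_scaler; split=> [/mP->|/eqP]; first by rewrite mulr0.
  by rewrite mulf_eq0 invr_eq0 (negPf ex_neq0) => /eqP/mP.
have g1 : ev 1 g = 1 by rewrite gE ev_scaler ev1 mulVf.
have evM p q : ev (p * q) g = ev p g * ev q g.
  have qm : q - ev q g *: 1 \in m.
    by apply/gP; rewrite ev_subl ev_scalel g1 mulr1 subrr.
  have /gP := ideal_mull p idm qm.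
  rewrite mulrBr -scalerAr mulr1 ev_subl.
  by rewrite ev_scalel => /eqP; rewrite subr_eq0 mulrC => /eqP.
exists g => //; rewrite /grouplike inE {1}gE scaler_eq0 invr_eq0 (negPf ex_neq0) (negPf x_neq0) /=.
have hitg p : hit p g = ev p g *: g.
  by apply: grouplike_ext => q; rewrite ev_hit evM ev_scaler mulrC.
apply/eqP; rewrite [LHS]tensor_pure_span -[LHS]/(sw g (fun a b => a \ox b)).
rewrite sw_hit; last by split=> [v c u u'|u c v v'];
  rewrite ?tensor_pure_linearl ?tensor_pure_linearr.
rewrite [X in _ = _ \ox X]basis_expand (linear_fun_sum (@tensor_pure_linearr _ _ _ _)).
apply: eq_bigr => i _; rewrite hitg (linear_funZ (@tensor_pure_linearl _ _ _ _)).
by rewrite (linear_funZ (@tensor_pure_linearr _ _ _ _)).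
Qed.

End GroupLikes.

(** * Freeness over the group algebra of the grouplike elements *)

Section LeftTrace.

Variables (k : fieldType) (H : fdHopfAlgType k).
Implicit Types (x y g : H).

Local Notation S := (antipode : 'End(H)).
Local Notation n := (\dim {:H}).
Local Notation bas := (vbasis {:H}).

Definition left_mx x : 'M[k]_n := \matrix_(i, j) ev (dual_basis i) (x * bas`_j).

Lemma left_mxM x y : left_mx (x * y) = left_mx x *m left_mx y.
Proof.
apply/matrixP => i j; rewrite !mxE -mulrA [y * _]basis_expand mulr_sumr ev_sumr.
by apply: eq_bigr => l _; rewrite !mxE -scalerAr ev_scaler mulrC.
Qed.

Lemma left_mx1 : left_mx 1 = 1%:M.
Proof.
apply/matrixP => i j; rewrite !mxE mul1r ev_dual_basis.
by rewrite coord_free ?(basis_free (vbasisP _)) // eq_sym.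
Qed.

Lemma left_mx_eq1 x : left_mx x = 1%:M -> x = 1.
Proof.
move=> x1; rewrite -[x]mulr1 [X in x * X]basis_expand [RHS]basis_expand mulr_sumr.
apply: eq_bigr => j _; rewrite -scalerAr; congr (_ *: _).
rewrite [x * _]basis_expand (bigD1 j) //= big1 ?addr0 => [|i ne_ij].
  by move/matrixP/(_ j j): x1; rewrite !mxE eqxx => ->; rewrite scale1r.
by move/matrixP/(_ i j): x1; rewrite !mxE (negPf ne_ij) => ->; rewrite scale0r.
Qed.

Definition left_trace x : k := \tr (left_mx x).

Lemma left_trace_scalar : scalar left_trace.
Proof.
move=> c x y; rewrite /left_trace -mxtraceZ -mxtraceD; congr (\tr _).
by apply/matrixP => i j; rewrite !mxE mulrDl -scalerAl ev_linearr.
Qed.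

Lemma left_traceC x y : left_trace (x * y) = left_trace (y * x).
Proof. by rewrite /left_trace !left_mxM mxtrace_mulC. Qed.

Lemma left_trace1 : left_trace 1 = n%:R.
Proof. by rewrite /left_trace left_mx1 mxtrace1. Qed.

Lemma left_trace_sum (I : finType) (x : I -> H) : left_trace (\sum_i x i) = \sum_i left_trace (x i).
Proof. exact: (linear_fun_sum (left_trace_scalar : linear (left_trace : H -> k^o))). Qed.

Lemma left_traceZ c x : left_trace (c *: x) = c * left_trace x.
Proof. exact: (linear_funZ (left_trace_scalar : linear (left_trace : H -> k^o))). Qed.

Section RightCoideal.

Variable M : {vspace H}.
Hypothesis hitM : forall p x, x \in M -> hit p x \in M.

Local Notation d := (\dim M).
Local Notation b := (vbasis M).

Lemma vbasisM (i : 'I_d) : b`_i \in M.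
Proof. by rewrite vbasis_mem // mem_nth ?size_tuple. Qed.

(* [comul] maps the [j]-th basis vector of [M] to the sum of [b_i (x) matrix_coef i j]. *)
Definition matrix_coef (i j : 'I_d) : H :=
  \sum_(l < n) coord b i (hit (dual_basis l) b`_j) *: bas`_l.

Lemma sw_basis (W : lmodType k) (j : 'I_d) (F : H -> H -> W) : bilinear F ->
  sw b`_j F = \sum_(i < d) F b`_i (matrix_coef i j).
Proof.
move=> F_bil; have [Fl Fr] := F_bil; rewrite sw_hit //.
under eq_bigr => l _ do
  rewrite [hit _ _](coord_vbasis (hitM _ (vbasisM j))) (linear_fun_sum (Fl _)).
rewrite exchange_big; apply: eq_bigr => i _; rewrite (linear_fun_sum (Fr _)).
by apply: eq_bigr => l _; rewrite (linear_funZ (Fr _)) (linear_funZ (Fl _)).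
Qed.

Lemma coord_basisM (i j : 'I_d) : coord b i b`_j = (i == j)%:R.
Proof. by rewrite coord_free ?(basis_free (vbasisP _)) // eq_sym. Qed.

Lemma counit_matrix_coef i j : counit (matrix_coef i j) = (i == j)%:R :> k.
Proof.
have := sw_counitr b`_j; rewrite sw_basis; last by split; linear_tac.
move/(congr1 (coord b i)); rewrite linear_sum coord_basisM => <-.
rewrite (bigD1 i) //= linearZ /= coord_basisM eqxx mulr1 big1 ?addr0 // => l ne_li.
by rewrite linearZ /= coord_basisM eq_sym (negPf ne_li) mulr0.
Qed.

Lemma sum_coord_basisM (W : lmodType k) (i : 'I_d) (w : 'I_d -> W) :
  \sum_(l < d) coord b i b`_l *: w l = w i.
Proof.
rewrite (bigD1 i) //= coord_basisM eqxx scale1r big1 ?addr0 // => l ne_li.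
by rewrite coord_basisM eq_sym (negPf ne_li) scale0r.
Qed.

Lemma coordM_linear (i : 'I_d) : linear (coord b i : H -> k^o).
Proof. by move=> c x y; rewrite linearP. Qed.

(** Coassociativity at the [j]-th basis vector, read on the [i]-th coordinate of the first leg. *)
Lemma sw_matrix_coef (W : vectType k) i j (F : H -> H -> W) : bilinear F ->
  sw (matrix_coef i j) F = \sum_l F (matrix_coef i l) (matrix_coef l j).
Proof.
move=> F_bil; pose G x y z := coord b i x *: F y z.
have G1 y z : linear (fun x => G x y z) by apply: linear_scalel; exact: coordM_linear.
have G2 x z : linear (fun y => G x y z) by rewrite /G; linear_tac.
have G3 x y : linear (fun z => G x y z) by rewrite /G; linear_tac.
have := coassoc_sw b`_j G3 G2 G1.
rewrite sw_basis; last by split; linear_tac.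
rewrite sw_basis; last by split; linear_tac.
rewrite /G; under [RHS]eq_bigr => l _.
  have -> : sw (matrix_coef l j) (fun c d => coord b i b`_l *: F c d) =
            coord b i b`_l *: sw (matrix_coef l j) F.
    by rewrite (@apply_sw _ _ _ _ (fun z => coord b i b`_l *: z)) //; linear_tac.
  over.
rewrite sum_coord_basisM => <-; apply: eq_bigr => l _.
rewrite sw_basis; last first.
  by split; linear_tac; exact: coordM_linear.
by rewrite sum_coord_basisM.
Qed.

Lemma matrix_coef_antipoder i j :
  \sum_l matrix_coef i l * S (matrix_coef l j) = (i == j)%:R *: 1.
Proof.
have := sw_antipoder (matrix_coef i j); rewrite sw_matrix_coef ?counit_matrix_coef //.
by split; linear_tac.
Qed.

Lemma matrix_coef_antipodel i j :
  \sum_l S (matrix_coef i l) * matrix_coef l j = (i == j)%:R *: 1.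
Proof.
have := sw_antipodel (matrix_coef i j); rewrite sw_matrix_coef ?counit_matrix_coef //.
by split; linear_tac.
Qed.

Definition restrict_mx g : 'M[k]_d := \matrix_(i, j) coord b i (g * b`_j).

Section GrouplikeAction.

Variable g : H.
Hypotheses (gg : grouplike H g) (gM : forall x, x \in M -> g * x \in M).

Lemma restrict_mxE (j : 'I_d) : g * b`_j = \sum_i restrict_mx g i j *: b`_i.
Proof.
rewrite [LHS](coord_vbasis (gM (vbasisM j))); apply: eq_bigr => i _.
by rewrite mxE.
Qed.

(** Both sides are the [i]-th coordinate of the coproduct of [g] times the [j]-th basis vector, with
    [g] applied after or before comultiplication. *)
Lemma restrict_mx_coef i j :
  \sum_l restrict_mx g i l *: (g * matrix_coef l j) = \sum_l restrict_mx g l j *: matrix_coef i l.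
Proof.
pose F x y : H := coord b i x *: y.
have F_bil : bilinear F by split; rewrite /F; linear_tac; exact: coordM_linear.
have := sw_grouplike_mull b`_j gg F_bil.
rewrite sw_basis; last by split; linear_tac.
have sw_lin : linear (fun x => sw x F) by apply: (@linear_sw _ _ _ _ (fun x => x)).
rewrite restrict_mxE (linear_fun_sum sw_lin) => E.
transitivity (\sum_(l < d) F (g * b`_l) (g * matrix_coef l j)).
  by apply: eq_bigr => l _; rewrite mxE.
rewrite -E; apply: eq_bigr => l _; rewrite (linear_funZ sw_lin) sw_basis //.
by rewrite /F sum_coord_basisM.
Qed.

(* Conjugating [restrict_mx g] by the invertible matrix of coefficients multiplies it
   by [g]; compare traces. *)
Lemma trace_restrict_mx : \tr (restrict_mx g) * left_trace g = \tr (restrict_mx g) * n%:R.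
Proof.
transitivity (left_trace (\sum_i \sum_j
    (\sum_l restrict_mx g i l *: (g * matrix_coef l j)) * S (matrix_coef j i))).
  rewrite /mxtrace mulr_suml left_trace_sum; apply: eq_bigr => i _.
  under [in RHS]eq_bigr do rewrite mulr_suml; rewrite exchange_big /=.
  rewrite -left_traceZ; congr left_trace.
  transitivity (\sum_l restrict_mx g i l *: (g * ((l == i)%:R *: 1))).
    rewrite (bigD1 i) //= eqxx scale1r mulr1 big1 ?addr0 // => l ne_li.
    by rewrite (negPf ne_li) scale0r mulr0 scaler0.
  apply: eq_bigr => l _; rewrite -matrix_coef_antipoder mulr_sumr scaler_sumr.
  by apply: eq_bigr => j _; rewrite mulrA scalerAl.
(* This absorbs the factor [g]; cyclicity of the trace then puts the antipode in front, where the
   other antipode identity applies. *)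
under eq_bigr do under eq_bigr do rewrite restrict_mx_coef.
rewrite left_trace_sum.
transitivity (\sum_j \sum_l restrict_mx g l j *
   left_trace (\sum_i S (matrix_coef j i) * matrix_coef i l)).
  under eq_bigr do rewrite left_trace_sum; rewrite exchange_big /=.
  apply: eq_bigr => j _; under eq_bigr do rewrite mulr_suml left_trace_sum.
  rewrite exchange_big; apply: eq_bigr => l _ /=.
  rewrite left_trace_sum mulr_sumr; apply: eq_bigr => i _.
  by rewrite -scalerAl left_traceZ left_traceC.
rewrite /mxtrace mulr_suml; apply: eq_bigr => j _.
under eq_bigr do rewrite matrix_coef_antipodel left_traceZ left_trace1.
rewrite (bigD1 j) //= eqxx mul1r big1 ?addr0 // => l ne_lj.
by rewrite eq_sym (negPf ne_lj) mul0r mulr0.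
Qed.

End GrouplikeAction.

End RightCoideal.

End LeftTrace.

Section FiniteGrouplikes.

Variables (k : closedFieldType) (H : fdHopfAlgType k) (gs : seq H).
Hypothesis char0 : [pchar k] =i pred0.
Hypotheses (uniq_gs : uniq gs) (gsE : gs =i grouplike H).

Local Notation n := (\dim {:H}).

Lemma grouplikeX (g : H) i : grouplike H g -> grouplike H (g ^+ i).
Proof.
move=> gg; elim: i => [|i IH]; first by rewrite expr0 grouplike1.
by rewrite exprS grouplikeM.
Qed.

Lemma grouplike_finite_order (g : H) : grouplike H g -> exists2 m, (0 < m)%N & g ^+ m = 1.
Proof.
move=> gg; pose s := [seq g ^+ i | i <- iota 0 (size gs).+1].
have /(uniqPn 0)[i [j [lt_ij]]] : ~~ uniq s.
  apply/negP => /uniq_leq_size sub; have : (size s <= size gs)%N.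
    by apply: sub => _ /mapP[i _ ->]; rewrite gsE; apply: grouplikeX.
  by rewrite size_map size_iota ltnn.
rewrite size_map size_iota => lt_j; rewrite !(nth_map 0%N) ?size_iota //; last first.
  exact: ltn_trans lt_j.
rewrite !nth_iota //; last exact: ltn_trans lt_j.
rewrite !add0n => ij; exists (j - i)%N; first by rewrite subn_gt0.
apply: (grouplike_mulI (grouplikeX i gg)).
by rewrite -exprD subnKC ?(ltnW lt_ij) // -ij mulr1.
Qed.

(** For [M] all of [H], the trace relation leaves only the values 0 and [n], and [n] is excluded
    because [g] has finite order. *)
Lemma left_trace_grouplike (g : H) : grouplike H g -> g != 1 -> left_trace g = 0.
Proof.
move=> gg g1; have [m m_gt0 gm] := grouplike_finite_order gg.
have fullP (p : dual H) (x : H) : x \in {:H}%VS -> hit p x \in {:H}%VS by rewrite !memvf.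
have := trace_restrict_mx fullP gg (fun x _ => memvf (g * x)).
have -> : \tr (restrict_mx {:H} g) = left_trace g.
  by congr (\tr _); apply/matrixP => i j; rewrite !mxE ev_dual_basis.
move/eqP; rewrite -subr_eq0 -mulrBr mulf_eq0 subr_eq0 => /orP[/eqP //|].
have : left_trace g != n%:R.
  apply: (finite_order_mxtrace char0 m_gt0); last by apply: contra g1 => /eqP/left_mx_eq1->.
  rewrite -[RHS]left_mx1 -gm; elim: (m) => [|i IH]; first by rewrite expr0 left_mx1.
  by rewrite /= IH exprS left_mxM.
by move/negPf->.
Qed.

(** The average of the grouplikes acting on [M] is an idempotent of trace [\dim M] over [size gs],
    and this trace is its rank, a natural number. *)
Lemma grouplike_dvd_dim (M : {vspace H}) :
    (forall p x, x \in M -> hit p x \in M) ->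
    (forall g x, grouplike H g -> x \in M -> g * x \in M) ->
  (size gs %| \dim M)%N.
Proof.
move=> hitM gM; pose G (g : H) := restrict_mx M g.
have gs1 : 1 \in gs by rewrite gsE; apply: grouplike1.
have size_gs : (0 < size gs)%N by case: (gs) gs1.
have r_neq0 : (size gs)%:R != 0 :> k by rewrite pchar0_natr_eq0 // -lt0n.
have n_neq0 : n%:R != 0 :> k.
  by rewrite pchar0_natr_eq0 // dimv_eq0; apply: contraTneq (memvf (1 : H)) => ->;
    rewrite memv0 oner_eq0.
have GM g h : grouplike H g -> grouplike H h -> G g *m G h = G (g * h).
  move=> gg gh; apply/matrixP => i j; rewrite !mxE -mulrA.
  rewrite (restrict_mxE (fun x => gM h x gh)) mulr_sumr linear_sum.
  by apply: eq_bigr => l _; rewrite !mxE -scalerAr linearZ mulrC.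
have G1 : G 1 = 1%:M.
  by apply/matrixP => i j; rewrite !mxE mul1r coord_basisM.
have trG g : grouplike H g -> g != 1 -> \tr (G g) = 0.
  move=> gg g1; have := trace_restrict_mx hitM gg (fun x => gM g x gg).
  rewrite left_trace_grouplike // mulr0 => /esym/eqP.
  by rewrite mulf_eq0 (negPf n_neq0) orbF => /eqP.
pose P := (size gs)%:R^-1 *: \sum_(g <- gs) G g.
have gP g : grouplike H g -> G g *m (\sum_(h <- gs) G h) = \sum_(h <- gs) G h.
  move=> gg; rewrite mulmx_sumr.
  transitivity (\sum_(h <- [seq g * h | h <- gs]) G h).
    rewrite big_map big_seq [RHS]big_seq; apply: eq_bigr => h; rewrite gsE => gh.
    exact: GM.
  apply: perm_big; apply: uniq_perm => //.
    by rewrite map_inj_uniq //; apply: grouplike_mulI.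
  have [] := @uniq_min_size _ [seq g * h | h <- gs] gs; rewrite ?size_map //.
    by rewrite map_inj_uniq //; apply: grouplike_mulI.
  by move=> _ /mapP[h + ->]; rewrite !gsE; apply: grouplikeM.
have PP : P *m P = P.
  rewrite /P -scalemxAl -scalemxAr scalerA mulmx_suml big_seq.
  rewrite (eq_bigr (fun=> \sum_(h <- gs) G h)) => [|g]; last by rewrite gsE => /gP.
  rewrite -big_seq big_const_seq count_predT iter_addr_0.
  by rewrite -scaler_nat scalerA -mulrA mulVf // mulr1.
have trP : \tr P = (size gs)%:R^-1 * (\dim M)%:R.
  rewrite mxtraceZ; congr (_ * _); rewrite raddf_sum /= (bigD1_seq 1) //= G1 mxtrace1.
  rewrite big_seq_cond big1 ?addr0 // => g /andP[]; rewrite gsE; exact: trG.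
have := mxtrace_idempotent PP; rewrite trP => /(congr1 ( *%R (size gs)%:R)).
rewrite mulrA mulfV // mul1r -natrM => /eqP.
by move/eqP/(pchar0_natr_inj char0)->; apply: dvdn_mulr.
Qed.

End FiniteGrouplikes.

(** * Hopf algebras without nontrivial skew-primitives *)

Section NoSkewPrimitives.

Variables (k : closedFieldType) (H : fdHopfAlgType k) (gs : seq H).
Hypothesis char0 : [pchar k] =i pred0.
Hypothesis H_ncss : ~ cosemisimple H.
Hypothesis H_nsp : no_nontrivial_skew_primitives H.
Hypotheses (uniq_gs : uniq gs) (gsE : gs =i grouplike H).

Local Notation A := (dual H).
Implicit Types (m : {vspace A}) (g h x z : H) (p q : A).

Lemma comul_of_ev x (u v u' v' : H) :
    (forall p q, ev (p * q) x = ev p u * ev q v + ev p u' * ev q v') ->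
  comul x = u \ox v + u' \ox v'.
Proof.
move=> xE; have hitx q : hit q x = ev q v *: u + ev q v' *: u'.
  by apply: grouplike_ext => p; rewrite ev_hit xE (ev_linearr p) ev_scaler ![_ * ev p _]mulrC.
rewrite [LHS]tensor_pure_span -[LHS]/(sw x (fun a b => a \ox b)).
rewrite sw_hit; last first.
  by split=> [w c y y'|y c w w']; rewrite ?tensor_pure_linearl ?tensor_pure_linearr.
rewrite [in RHS](basis_expand v) [in RHS](basis_expand v').
rewrite !(linear_fun_sum (@tensor_pure_linearr _ _ _ _)) -big_split; apply: eq_bigr => i _ /=.
rewrite hitx tensor_pure_linearl (linear_funZ (@tensor_pure_linearl _ _ _ _)).
by rewrite !(linear_funZ (@tensor_pure_linearr _ _ _ _)).
Qed.

(** Here non-cosemisimplicity enters: an [s] killed by [m1] is an integral of the dual, so it must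
    vanish at 1. *)
Lemma unit_ideal_annihilator m1 s : (forall p, p \in m1 <-> ev p 1 = 0) ->
  (forall p, p \in m1 -> p * s = 0) -> s \in m1.
Proof.
move=> m1E m1s; apply/m1E; apply: NNPP => /eqP s1; apply: H_ncss.
apply: (integral_cosemisimple _ s1) => p.
have : p - ev p 1 *: 1 \in m1.
  by apply/m1E; rewrite ev_subl ev_scalel ev1 counit1 mulr1 subrr.
move/m1s/eqP; rewrite mulrBl subr_eq0 => /eqP->.
by rewrite -scalerAl mul1r.
Qed.

(* If the top of [e1 m1] had a one-dimensional quotient, killed by the ideal of a
   grouplike [h], the corresponding functional would be an [(h, 1)]-skew-primitive
   element not supported on the grouplikes. *)
Lemma exists_linked_simple m1 : maximal_ideal m1 -> (forall p, p \in m1 <-> ev p 1 = 0) ->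
  exists m d, [/\ maximal_ideal m, (1 < d)%N, \dim {:A} = (\dim m + d ^ 2)%N & linked m1 m].
Proof.
move=> max1 m1E; have [e [eP _]] := exists_block_idempotents A char0.
have [idm1 m1n1 _] := max1; have e1P := eP m1 max1; set e1 := e m1 in e1P.
have [e1e1 _ e1_in] := e1P.
have [R RE] : exists R : {vspace A}, forall y, y \in R <-> exists2 w, w \in m1 & y = e1 * w.
  apply: vspace_comprehension => [|c _ _ [a ma ->] [b mb ->]].
    by exists 0; rewrite ?mem0v ?mulr0.
  by exists (c *: a + b); rewrite ?memvD ?memvZ // mulrDr scalerAr.
have stR : stable (fun a y : A => y * a) R.
  by move=> a _ /RE[w mw ->]; apply/RE; exists (w * a); rewrite ?ideal_mulr ?mulrA.
(* The socle [S] has dimension the codimension of [m1], hence is nonzero; by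
   [unit_ideal_annihilator] it lies in [m1], and so in [e1 m1]. *)
have R_neq0 : R != 0%VS.
  have [t t_int t_neq0] := exists_integral H.
  have lam_nd := dual_nondeg t_int t_neq0.
  have [nu nuP nuE] := nakayama (ev_linearl t) lam_nd.
  have [nu_lin _ _ _] := nuP; have [m1' m1'E] := exists_preim m1 nu_lin.
  have max1' := preim_maximal nuP m1'E max1.
  have [S [dimS SE eSe]] := exists_annihilator (ev_linearl t) lam_nd nuE max1 m1'E e1P (eP _ max1').
  apply: contraTneq (maximal_ideal_codim_gt0 max1) => R0.
  suff S0 : S = 0%VS by rewrite dimS S0 dimv0 addn0 subnn.
  apply/eqP; rewrite -subv0; apply/subvP => s Ss; rewrite -R0; apply/RE.
  exists s; first by apply: (unit_ideal_annihilator m1E); exact/SE.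
  by rewrite {2}(eSe s Ss) !mulrA e1e1 -(eSe s Ss).
have [R' [I [d [stR' sR'R maxI IE [dimR d_gt0 dimA]]]]] :=
  simple_section (right_action A) stR R_neq0.
have [idI I1 _] := maxI.
exists I, d; split=> //; last first.
  have eIP := eP I maxI; have [_ mI _] := eIP.
  apply: NNPP => n_linked; case/negP: I1.
  rewrite -(subrK (e I) 1) memvD //; apply/IE => _ /RE[w _ ->].
  suff -> : e1 * w * e I = 0 by apply: mem0v.
  by apply: NNPP => /eqP w0; apply: n_linked; exists e1, (e I), w.
rewrite ltn_neqAle d_gt0 andbT eq_sym; apply/eqP => d1.
have [h gh hE] : exists2 h, grouplike H h & forall p, p \in I <-> ev p h = 0.
  by apply: codim1_grouplike => //; rewrite dimA d1.
have [D DE] := perp_exists (@ev_linearr k H) R'.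
(* [z] gives a functional on [R] that kills [R'] but not [R]; through it, right multiplication by
   [a] becomes the scalar [ev a h]. *)
have [z Dz [y0 Ry0 y0z]] : exists2 z, z \in D & exists2 y, y \in R & ev y z != 0.
  apply: NNPP => no_z.
  suff : (R <= R')%VS by move/dimvS; rewrite dimR d1 addn1 ltnn.
  apply/subvP => y Ry.
  apply/(double_perp (@ev_linearl k H) (@ev_linearr k H) (@ev_nondegl k H) (dim_dual H) DE).
  move=> z Dz; apply: NNPP => /eqP yz.
  by apply: no_z; exists z => //; exists y.
have Rz y a : y \in R -> ev (y * a) z = ev y z * ev a h.
  move=> Ry; have : a - ev a h *: 1 \in I.
    by apply/hE; rewrite ev_subl ev_scalel ev1 counit_grouplike // mulr1 subrr.
  move/IE/(_ y Ry) => R'y; have := proj1 (DE z) Dz _ R'y.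
  rewrite mulrBr -scalerAr mulr1 ev_subl ev_scalel => /eqP.
  by rewrite subr_eq0 mulrC => /eqP; rewrite mulrC.
have m1_sub p : p - ev p 1 *: 1 \in m1.
  by apply/m1E; rewrite ev_subl ev_scalel ev1 counit1 mulr1 subrr.
(* The correction makes the value of [p] at [x] that of [e1 * (p - ev p 1 *: 1)] at [z]; this
   element is in [R], where [Rz] applies. *)
pose x := hitl e1 z - ev e1 z *: 1.
have xE p : ev p x = ev (e1 * (p - ev p 1 *: 1)) z.
  rewrite /x (linear_funB (ev_linear p)) ev_hitl ev_scaler mulrBr -scalerAr mulr1.
  by rewrite ev_subl ev_scalel [ev p 1 * _]mulrC.
have Re1 p : e1 * (p - ev p 1 *: 1) \in R by apply/RE; exists (p - ev p 1 *: 1).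
have comulx : comul x = x \ox h + 1 \ox x.
  apply: comul_of_ev => p q; rewrite !xE.
  rewrite (_ : e1 * (p * q - _) =
     e1 * (p - ev p 1 *: 1) * q + ev p 1 *: (e1 * (q - ev q 1 *: 1))).
    by rewrite addrC (ev_linearl z) addrC Rz.
  rewrite ev_grouplikeM ?grouplike1 // !mulrBr mulrBl -!scalerAr !mulr1 -scalerAl scalerBr.
  by rewrite scalerA !mulrA addrA subrK.
have [gs' all_gs' xgs'] := H_nsp gh (grouplike1 H) comulx.
case/RE: (Ry0) => w m1w y0E.
(* In [y0 = e1 * w], the factor [w] vanishes at 1 and [e1] at every other grouplike. Yet [y0] does
   not vanish at [x], so [x] is outside the span of the grouplikes. *)
have y0_gl g : grouplike H g -> ev y0 g = 0.
  move=> gg; have [mg mgE [maxg _]] := exists_grouplike_ideal gg.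
  rewrite y0E ev_grouplikeM //; have [eq_m | ne_m] := eqVneq mg m1.
    by move: m1w; rewrite -eq_m => /mgE->; rewrite mulr0.
  by have /mgE-> := e1_in mg maxg ne_m; rewrite mul0r.
case/negP: y0z; rewrite (_ : ev y0 z = ev y0 x); last first.
  by rewrite xE (y0_gl _ (grouplike1 H)) scale0r subr0 y0E mulrA e1e1.
have [N NE] : exists N : {vspace H}, forall g, g \in N <-> ev y0 g = 0.
  apply: vspace_comprehension => [|c u v u0 v0]; first exact: ev0r.
  by rewrite ev_linearr u0 v0 mulr0 addr0.
apply/eqP/NE; apply: subvP xgs'; apply/span_subvP => g gs'g.
by apply/NE/y0_gl; apply: (allP all_gs').
Qed.

Variable mg : H -> {vspace A}.
Hypothesis mgE : forall g, grouplike H g -> forall p, p \in mg g <-> ev p g = 0.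

Lemma mg_maximal g : grouplike H g ->
  maximal_ideal (mg g) /\ \dim {:A} = (\dim (mg g) + 1)%N.
Proof.
move=> gg; have [m mE mP] := exists_grouplike_ideal gg.
suff -> : mg g = m by [].
by apply/vspaceP => p; apply/idP/idP => [/(mgE gg)/mE | /mE/(mgE gg)].
Qed.

Lemma codim1_mg m : maximal_ideal m -> \dim {:A} = (\dim m + 1)%N ->
  exists2 g, grouplike H g & m = mg g.
Proof.
case=> idm m1 _ dimm; have [g gg mE] := codim1_grouplike idm m1 dimm.
exists g => //.
by apply/vspaceP => p; apply/idP/idP => [/mE/(mgE gg) | /(mgE gg)/mE].
Qed.

Lemma mg_inj g h : grouplike H g -> grouplike H h -> mg g = mg h -> g = h.
Proof.
move=> gg gh eq_m; apply: grouplike_ext => p.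
have : p - ev p h *: 1 \in mg h.
  by apply/(mgE gh); rewrite ev_subl ev_scalel ev1 counit_grouplike // mulr1 subrr.
rewrite -eq_m => /(mgE gg)/eqP; rewrite ev_subl ev_scalel ev1 counit_grouplike // mulr1.
by rewrite subr_eq0 => /eqP.
Qed.

Lemma mg_preim tau g m : algebra_automorphism tau -> grouplike H g ->
    (forall p, p \in m <-> tau p \in mg g) ->
  exists2 h, grouplike H h & m = mg h.
Proof.
move=> tauP gg mE; have [maxg dimg] := mg_maximal gg.
apply: codim1_mg; first exact: (preim_maximal tauP mE maxg).
by rewrite (dim_preim tauP mE).
Qed.

Definition near_grouplike d m :=
  [/\ maximal_ideal m, \dim {:A} = (\dim m + d ^ 2)%N
    & exists2 g, grouplike H g & linked (mg g) m].

(** Automorphisms permute the ideals of codimension 1, that is, the [mg g], and they preserve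
    linkage. *)
Lemma near_grouplike_preim d tau m m' : algebra_automorphism tau ->
    (forall p, p \in m' <-> tau p \in m) -> near_grouplike d m -> near_grouplike d m'.
Proof.
move=> tauP m'E [maxm dimm [g gg gm]].
split; [exact: (preim_maximal tauP m'E) | by rewrite (dim_preim tauP m'E) |].
have [sigma [sigP tauK sigK]] := automorphism_inv tauP; have [tau_lin _ _ _] := tauP.
have [q qE] := exists_preim (mg g) tau_lin.
have [h gh qh] := mg_preim tauP gg qE; exists h => //; rewrite -qh.
by apply: (linked_image sigP _ _ gm) => p; [rewrite qE sigK | rewrite m'E sigK].
Qed.

(** Translations by grouplikes carry a link at [h] to the unit and from there to [g]. *)
Lemma exists_near_grouplike d m g : near_grouplike d m -> grouplike H g ->
  exists2 m', near_grouplike d m' & linked (mg g) m'.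
Proof.
move=> nearm gg; have [_ _ [h gh hm]] := nearm.
have [hinv [hinvP hK Kh]] := automorphism_inv (shift_automorphism gh).
have [ginv [ginvP gK Kg]] := automorphism_inv (shift_automorphism gg).
have shP := shift_automorphism gh; have sgP := shift_automorphism gg.
have [hinv_lin _ _ _] := hinvP; have [sg_lin _ _ _] := sgP.
have [m1 m1E] := exists_preim m hinv_lin.
have [m2 m2E] := exists_preim m1 sg_lin.
have m1h : forall p, p \in m <-> shift h p \in m1 by move=> p; rewrite m1E hK.
have m2g : forall p, p \in m1 <-> ginv p \in m2 by move=> p; rewrite m2E Kg.
have link1 : linked (mg 1) m1.
  apply: (linked_image shP _ m1h hm) => p.
  by rewrite (mgE gh) (mgE (grouplike1 H)) ev_shift mulr1.
have link2 : linked (mg g) m2.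
  apply: (linked_image ginvP _ m2g link1) => p.
  by rewrite (mgE gg) (mgE (grouplike1 H)) -{1}[p]Kg ev_shift mulr1.
exists m2 => //; apply: (near_grouplike_preim sgP m2E).
exact: (near_grouplike_preim hinvP m1E).
Qed.

Theorem dim_bound_of_near_grouplike d m0 : (1 < d)%N -> near_grouplike d m0 ->
  exists2 v : nat, (2 * size gs + 2 * d * size gs + 2 * v <= \dim {:H})%N
    & [/\ (0 < v)%N, (d ^ 2 %| v)%N & (size gs %| v)%N].
Proof.
move=> d_gt1 near0.
have [t t_int t_neq0] := exists_integral H.
have lam_nd := dual_nondeg t_int t_neq0.
have [nu nuP nuE] := nakayama (ev_linearl t) lam_nd.
have [e [eP e0]] := exists_block_idempotents A char0.
have [ms uniq_ms msE] := exists_maximal_ideals A.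
have /functional_choice[b bE] (m : {vspace A}) : exists b : bool, b <-> near_grouplike d m.
  by have [nearm | nnearm] := classic (near_grouplike d m); [exists true | exists false].
pose Gs := [seq mg g | g <- gs]; pose Vs := [seq m <- ms | b m].
have VsE m : m \in Vs <-> near_grouplike d m.
  rewrite mem_filter -bE; split=> [/andP[] // | bm]; rewrite bm.
  by apply/msE; have /bE[] := bm.
have GsE m : m \in Gs <-> exists2 g, grouplike H g & m = mg g.
  split=> [/mapP[g + ->] | [g gg ->]]; first by rewrite gsE; exists g.
  by apply: map_f; rewrite gsE.
have uniq_Gs : uniq Gs.
  by rewrite map_inj_in_uniq // => g h; rewrite !gsE; apply: mg_inj.
have uniq_Vs : uniq Vs by rewrite filter_uniq.
have size_Gs : size Gs = size gs by rewrite size_map.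
have GP m : m \in Gs -> maximal_ideal m /\ \dim {:A} = (\dim m + 1)%N.
  by case/GsE=> g gg ->; apply: mg_maximal.
have VP m : m \in Vs -> maximal_ideal m /\ \dim {:A} = (\dim m + d ^ 2)%N.
  by case/VsE.
have V_preim tau m m' : algebra_automorphism tau -> m \in Vs ->
    (forall p, p \in m' <-> tau p \in m) -> m' \in Vs.
  by move=> tauP /VsE nearm m'E; apply/VsE/(near_grouplike_preim tauP m'E).
have V0 : m0 \in Vs by apply/VsE.
have linkGV g : grouplike H g -> exists2 m, m \in Vs & linked (mg g) m.
  move=> gg; have [m nearm gm] := exists_near_grouplike near0 gg; exists m => //.
  exact/VsE.
(* [h] is chosen so that [mg g] is the preimage of [mg h] under [nu]; a link from [h] to [m] then
   becomes one from [m] to [g]. *)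
have linkVG g : grouplike H g -> exists2 m, m \in Vs & linked m (mg g).
  move=> gg; have [sigma [sigP nuK sigK]] := automorphism_inv nuP.
  have [sig_lin _ _ _] := sigP; have [q qE] := exists_preim (mg g) sig_lin.
  have [h gh qh] := mg_preim sigP gg qE; have [m Vm hm] := linkGV h gh; exists m => //.
  have [maxm _] := VP m Vm; have [maxh _] := mg_maximal gh.
  apply: (linked_nakayama char0 (ev_linearl t) lam_nd nuP nuE maxh maxm _ hm) => p.
  by rewrite -qh qE nuK.
have ne_GV g m : grouplike H g -> m \in Vs -> m != mg g.
  move=> gg Vm; apply/eqP => eq_m; have [_ dimm] := VP m Vm; have [_ dimg] := mg_maximal gg.
  move: dimg; rewrite dimm eq_m => /addnI/eqP; rewrite -[X in _ == X](exp1n 2) eqn_exp2r //.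
  by rewrite gtn_eqF.
(* Each ideal of [Gs] is linked to one of [Vs] and conversely, in the direction that
   [linked_annihilator] requires. *)
have annGV : {in Gs ++ Vs, forall (m : {vspace A}) (s : A),
    (forall p, p \in m -> p * s = 0) -> s \in m}.
  move=> m + s ms0; rewrite mem_cat => /orP[/GsE[g gg eq_m] | Vm].
    have [maxg _] := mg_maximal gg; have [m' Vm' m'g] := linkVG g gg.
    have [maxm' _] := VP m' Vm'; rewrite eq_m in ms0 *.
    by apply: (linked_annihilator maxg maxm' _ m'g ms0); rewrite eq_sym ne_GV.
  have [maxm _] := VP m Vm; have /VsE[_ _ [g gg gm]] := Vm; have [maxg _] := mg_maximal gg.
  exact: (linked_annihilator maxm maxg (ne_GV g m gg Vm) gm ms0).
have bound : (2 * size Gs + 2 * d * size Gs + 2 * (d ^ 2 * size Vs) <= \dim {:A})%N.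
  apply: (dim_lower_bound (ev_linearl t) lam_nd nuP nuE eP e0) => //.
  - move=> m /GsE[g gg ->] m' m'E; have [h gh ->] := mg_preim nuP gg m'E.
    by apply/GsE; exists h.
  - by move=> m Vm m' m'E; apply: (V_preim nu m).
  - by move=> m /GsE[g gg ->]; apply: linkGV.
  - by move=> m /GsE[g gg ->]; apply: linkVG.
exists (d ^ 2 * size Vs)%N; first by rewrite -size_Gs -(dim_dual H).
have Vs_gt0 : (0 < size Vs)%N by case: (Vs) V0.
split; first by rewrite muln_gt0 Vs_gt0 expn_gt0 (ltnW d_gt1).
  exact: dvdn_mulr.
(* The orthogonal [M] of this intersection is the subcoalgebra attached to [Vs]: Chinese remainders
   give its dimension, and translations preserve it because they permute [Vs]. *)
pose I := (\bigcap_(m <- Vs) m)%VS.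
have IE p : p \in I <-> {in Vs, forall m, p \in m}.
  rewrite /I; elim: (Vs) => [|m s IH]; first by rewrite big_nil memvf; split.
  rewrite big_cons memv_cap; split=> [/andP[pm /IH ps] m' /predU1P[-> // | /ps//] | ps].
  rewrite ps ?mem_head //=; apply/IH => m' sm'; apply: ps.
  by rewrite inE sm' orbT.
have [M ME] := perp_exists (@ev_linearr k H) I.
have dimM : \dim M = (d ^ 2 * size Vs)%N.
  have := dim_perp (@ev_linearl k H) (@ev_linearr k H) (@ev_nondegl k H) ME.
  rewrite -(dim_dual H) -(dim_bigcap_maximal uniq_Vs (fun m Vm => (VP m Vm).1)) => /addnI->.
  rewrite big_seq (eq_bigr (fun=> (d ^ 2)%N)) => [|m /VP[_ ->]]; last by rewrite addKn.
  by rewrite -big_seq big_const_seq count_predT iter_addn_0.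
rewrite -dimM; apply: grouplike_dvd_dim => // [p x /ME x0 | g x gg /ME x0].
  apply/ME => q /IE qI; rewrite ev_hit x0 //; apply/IE => m Vm.
  by have [[idm _ _] _] := VP m Vm; apply/ideal_mulr/qI.
apply/ME => q /IE qI; rewrite -ev_shift x0 //; apply/IE => m Vm.
have shP := shift_automorphism gg; have [sh_lin _ _ _] := shP.
have [m' m'E] := exists_preim m sh_lin.
by apply/m'E/qI/(V_preim _ m m' shP).
Qed.

End NoSkewPrimitives.

Lemma exists_is_min (P : nat -> Prop) n : P n -> exists2 m, is_min P m & (m <= n)%N.
Proof.
elim/ltn_ind: n => n IHn Pn.
have [[m [Pm lt_mn]] | no_m] := classic (exists m, P m /\ (m < n)%N).
  by have [l minl le_lm] := IHn m lt_mn Pm; exists l => //; apply: leq_trans (ltnW lt_mn).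
exists n => //; split=> // m Pm; rewrite leqNgt; apply/negP => lt_mn.
by apply: no_m; exists m.
Qed.

Local Close Scope ring_scope.

Theorem theorem3p1 (k : closedFieldType) (k_char0 : [pchar k]%R =i pred0)
    (H : fdHopfAlgType k) (H_ncss : ~ cosemisimple H)
    (H_nsp : no_nontrivial_skew_primitives H)
    (r : nat) (card_GH : has_card (grouplike H) r) :
  exists2 m : nat,
    is_min (fun n => exists2 d : nat,
              1 < d & n = (2 * d + 2) * r + 2 * lcmn (d ^ 2) r) m
    & m <= \dim {:H}.
Proof.
have [gs [uniq_gs gsE size_gs]] := card_GH.
have /functional_choice[mg mgP] (g : H) : exists m : {vspace dual H},
    grouplike H g -> forall p, p \in m <-> ev p g = 0%R.
  have [gg | ngg] := boolP (grouplike H g); last by exists 0%VS.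
  by have [m mE _] := exists_grouplike_ideal gg; exists m.
have [max1 _] := mg_maximal mgP (grouplike1 H).
have [m0 [d [max0 d_gt1 dim0 link0]]] :=
  exists_linked_simple k_char0 H_ncss H_nsp max1 (mgP _ (grouplike1 H)).
have near0 : near_grouplike mg d m0.
  by split=> //; exists 1%R => //; apply: grouplike1.
have [v bound [v_gt0 dvd_d dvd_r]]
  := dim_bound_of_near_grouplike k_char0 uniq_gs gsE mgP d_gt1 near0.
pose n := (2 * d + 2) * r + 2 * lcmn (d ^ 2) r.
have [|m min_m le_mn] := @exists_is_min (fun n => exists2 d : nat,
    1 < d & n = (2 * d + 2) * r + 2 * lcmn (d ^ 2) r) n; first by exists d.
exists m => //; apply: leq_trans le_mn _; apply: leq_trans bound.
(* Positivity of [v] matters: a common multiple dominates the least one only when it is nonzero. *)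
rewrite size_gs in dvd_r *; have : lcmn (d ^ 2) r <= v.
  by apply: dvdn_leq => //; rewrite dvdn_lcm dvd_d dvd_r.
rewrite /n; lia.
Qed.
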